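(* Let $T$ be a countable, weakly quasi-o-minimal theory. Suppose that at least one of the following two conditions holds. (1) $T$ does not have simple semiintervals; (2) there exists a non-convex type $p\in S_1(T)$. Then $I(T,\aleph_0)=2^{\aleph_0}$.
   Context: $T$ is a complete first-order theory with monster model $\mathfrak C$; parameter sets are small subsets of $\mathfrak C$; $I(T,\aleph_0)$ is the number of countable models of $T$ up to isomorphism; $S_1(T)=S_1(\emptyset)$. Weak quasi-o-minimality: $T$ (one-sorted) is weakly quasi-o-minimal if there is a $0$-definable linear order $<$ on $\mathfrak C$ such that every parametrically definable subset of $\mathfrak C$ is a finite Boolean combination of $0$-definable sets and $<$-convex sets. Relative definability: for a complete type $p\in S(A)$, $p(\mathfrak C)$ is its set of realizations; a set $X\subseteq p(\mathfrak C)^n$ is relatively $B$-definable if $X=\phi(\mathfrak C)\cap p(\mathfrak C)^n$ for some $L_B$-formula $\phi$, and relatively definable if it is so for some $B$. Weakly o-minimal types: a weakly o-minimal pair over $A$ is $\mathbf p=(p,<)$ where $p\in S(A)$, $<$ is a relatively $A$-definable linear order on $p(\mathfrak C)$, and every relatively definable subset of $p(\mathfrak C)$ is a finite union of $<$-convex subsets of $p(\mathfrak C)$. A type $p\in S(A)$ is weakly o-minimal if $(p,<)$ is such a pair for some $<$. In a weakly quasi-o-minimal theory all complete 1-types (over any $A$) are weakly o-minimal. $\mathcal E_p$ is the set of all relatively $A$-definable equivalence relations on $p(\mathfrak C)$. Convexity: for a weakly o-minimal pair $(p,<)$ over $A$, with $<$ relatively defined by the formula $x<y$, an $A$-definable extension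 of $(p(\mathfrak C),<)$ is $(D,<)$ where $D=\theta(\mathfrak C)$ for some $\theta\in p$ such that $x<y$ defines a linear order on $D$. A weakly o-minimal type $p\in S(A)$ is convex if for some weakly o-minimal pair $(p,<)$ over $A$ there is an $A$-definable extension $(D,<)$ of $(p(\mathfrak C),<)$ in which $p(\mathfrak C)$ is a convex subset. Simplicity of semiintervals: let $\mathbf p=(p,<)$ be a weakly o-minimal pair over $A$. A $\mathbf p$-semiinterval is a convex subset $S$ of $(p(\mathfrak C),<)$ such that $a=\min S$ exists and $S$ is relatively $Aa$-definable within $p(\mathfrak C)$. It is $\mathcal E_p$-determined if $S=\{x\in[a]_E\mid a\leqslant x\}$ for some $E\in\mathcal E_p$. The pair $\mathbf p$ has simple semiintervals if every $\mathbf p$-semiinterval is $\mathcal E_p$-determined; the type $p$ has simple semiintervals if every weakly o-minimal pair $(p,<_p)$ over $A$ does; $p$ has hereditarily simple semiintervals if every complete type (over any $B\supseteq A$) extending $p$ has simple semiintervals. A weakly quasi-o-minimal $T$ has simple semiintervals if all types $p\in S_1(T)$ have hereditarily simple semiintervals. *)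

(* Defs.v *)
From mathcomp Require Import all_boot all_classical.

Set Implicit Arguments.
Unset Strict Implicit.
Unset Printing Implicit Defensive.

Local Open Scope classical_set_scope.
Local Open Scope card_scope.

Definition card_lt (X Y : Type) (A : set X) (B : set Y) : Prop :=
  (A #<= B) /\ ~ (B #<= A).

Record language := Language {
  funs : Type;
  fun_arity : funs -> nat;
  rels : Type;
  rel_arity : rels -> nat
}.

(* [term L n] and [formula L n]: the free variables are indexed by ['I_n]. *)
Inductive term (L : language) (n : nat) : Type :=
| Var of 'I_n
| App (f : funs L) of ('I_(fun_arity f) -> term L n).

(* De Bruijn binding: in [All phi] the bound variable is [ord0], and the outer
   variable [i] appears in [phi] as [lift ord0 i]. *)
Inductive formula (L : language) (n : nat) : Type :=
| Bot
| Eq of term L n & term L n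
| Rel (r : rels L) of ('I_(rel_arity r) -> term L n)
| Imp of formula L n & formula L n
| All of formula L n.+1.

Arguments Var {L n} _.
Arguments Bot {L n}.

Definition Neg (L : language) (n : nat) (phi : formula L n) : formula L n :=
  Imp phi Bot.

Record interp (L : language) (D : Type) := Interp {
  fun_interp : forall f : funs L, ('I_(fun_arity f) -> D) -> D;
  rel_interp : forall r : rels L, ('I_(rel_arity r) -> D) -> Prop
}.

Record structure (L : language) := Structure {
  dom :> Type;
  dom_inhabited : inhabited dom;
  dom_interp : interp L dom
}.

Definition vcons (D : Type) (n : nat) (x : D) (v : 'I_n -> D) : 'I_n.+1 -> D :=
  fun i => if unlift ord0 i is Some j then v j else x.

Definition vcat (D : Type) (n m : nat) (v : 'I_n -> D) (w : 'I_m -> D) :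
  'I_(n + m) -> D :=
  fun i => match fintype.split i with inl j => v j | inr k => w k end.

Fixpoint eval (L : language) (M : structure L) (n : nat) (v : 'I_n -> M)
    (t : term L n) : M :=
  match t with
  | Var i => v i
  | App f ts => fun_interp (dom_interp M) (fun j => eval v (ts j))
  end.

Fixpoint sat (L : language) (M : structure L) (n : nat) (phi : formula L n) :
    ('I_n -> M) -> Prop :=
  match phi with
  | Bot => fun _ => False
  | Eq t u => fun v => eval v t = eval v u
  | Rel r ts => fun v => rel_interp (dom_interp M) (fun j => eval v (ts j))
  | Imp phi psi => fun v => sat phi v -> sat psi v
  | All phi => fun v => forall x : M, sat phi (vcons x v)
  end.

Definition isomorphism (L : language) (M N : structure L) (h : M -> N) : Prop :=
  [/\ bijective h,
      forall (f : funs L) (v : 'I_(fun_arity f) -> M),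
        h (fun_interp (dom_interp M) v) = fun_interp (dom_interp N) (h \o v)
    & forall (r : rels L) (v : 'I_(rel_arity r) -> M),
        rel_interp (dom_interp M) v <-> rel_interp (dom_interp N) (h \o v)].

Definition isomorphic (L : language) (M N : structure L) : Prop :=
  exists h : M -> N, isomorphism h.

Definition theory (L : language) := set (formula L 0).

Definition sat_sentence (L : language) (M : structure L) (s : formula L 0) :=
  forall v : 'I_0 -> M, sat s v.

Definition model (L : language) (T : theory L) (M : structure L) : Prop :=
  forall s, T s -> sat_sentence M s.

Definition entails (L : language) (T : theory L) (s : formula L 0) : Prop :=
  forall M : structure L, model T M -> sat_sentence M s.

Definition complete_theory (L : language) (T : theory L) : Prop :=
  (exists M : structure L, model T M) /\
  (forall s : formula L 0, entails T s \/ entails T (Neg s)).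

Definition countable_language (L : language) : Prop :=
  countable [set: funs L] /\ countable [set: rels L].

Definition nat_structure (L : language) (I : interp L nat) : structure L :=
  Structure (inhabits 0) I.

(* Every model of cardinality aleph_0 is isomorphic to one with universe [nat];
   [I(T, aleph_0)] is the cardinality of the following set. *)
Definition countable_model_classes (L : language) (T : theory L) :
    set (set (interp L nat)) :=
  [set C | exists2 I, model T (nat_structure I) &
     C = [set J | model T (nat_structure J) /\
                  isomorphic (nat_structure I) (nat_structure J)]].

(* The formula phi(x, b): the first [n] variables of [pbody] are x, the remaining
   ones are substituted by the tuple [params] = b. *)
Record pformula (L : language) (M : structure L) (n : nat) := PFormula {
  nparams : nat;
  pbody : formula L (n + nparams);
  params : 'I_nparams -> M
}.

Arguments params {L M n} _ _.

Definition over (L : language) (M : structure L) (n : nat) (B : set M)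
    (phi : pformula M n) : Prop :=
  forall i, B (params phi i).

Definition pneg (L : language) (M : structure L) (n : nat)
    (phi : pformula M n) : pformula M n :=
  PFormula (Neg (pbody phi)) (params phi).

Definition psat (L : language) (M : structure L) (n : nat)
    (phi : pformula M n) (v : 'I_n -> M) : Prop :=
  sat (pbody phi) (vcat v (params phi)).

Definition psat1 (L : language) (M : structure L) (phi : pformula M 1) (x : M) :=
  psat phi (fun=> x).

Definition unary (D : Type) (X : set D) : set ('I_1 -> D) :=
  [set v | X (v ord0)].

Definition binary (D : Type) (R : D -> D -> Prop) : set ('I_2 -> D) :=
  [set v | R (v ord0) (v ord_max)].

Definition definable (L : language) (M : structure L) (n : nat) (B : set M)
    (X : set ('I_n -> M)) : Prop :=
  exists2 phi : pformula M n, over B phi & X = [set v | psat phi v].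

(* [X] is relatively [B]-definable within [P]; in particular [X] is a subset of
   the corresponding power of [P]. *)
Definition rel_definable (L : language) (M : structure L) (n : nat) (P : set M)
    (B : set M) (X : set ('I_n -> M)) : Prop :=
  exists2 Y, definable B Y & X = Y `&` [set v | forall i, P (v i)].

(* [p] is an element of S_1(A); consistency with the elementary diagram of [M]
   amounts to finite satisfiability in [M]. *)
Definition complete_type (L : language) (M : structure L) (A : set M)
    (p : set (pformula M 1)) : Prop :=
  [/\ forall phi, p phi -> over A phi,
      forall (k : nat) (F : 'I_k -> pformula M 1), (forall i, p (F i)) ->
        exists x : M, forall i, psat1 (F i) x
    & forall phi, over A phi -> p phi \/ p (pneg phi)].

Definition realizations (L : language) (M : structure L)
    (p : set (pformula M 1)) : set M :=
  [set x | forall phi, p phi -> psat1 phi x].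

(* The cardinal kappa of the monster model is the cardinality of a type [K]. *)
Definition small (K D : Type) (A : set D) : Prop := card_lt A [set: K].

Definition saturated (K : Type) (L : language) (M : structure L) : Prop :=
  forall (A : set M) (p : set (pformula M 1)),
    small K A -> complete_type A p -> realizations p !=set0.

Definition elementary_on (L : language) (M : structure L) (A : set M)
    (f : M -> M) : Prop :=
  forall (n : nat) (phi : formula L n) (v : 'I_n -> M),
    (forall i, A (v i)) -> sat phi v <-> sat phi (f \o v).

Definition strongly_homogeneous (K : Type) (L : language) (M : structure L) :=
  forall (A : set M) (f : M -> M), small K A -> elementary_on A f ->
    exists g : M -> M, isomorphism g /\ forall x, A x -> g x = f x.

(* kappa-saturated and strongly kappa-homogeneous for some kappa > |T|, where
   |T| is the number of formulas. *)
Definition monster (K : Type) (L : language) (T : theory L) (M : structure L) :=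
  [/\ card_lt [set: {n : nat & formula L n}] [set: K],
      model T M, saturated K M & strongly_homogeneous K M].

Definition linear_order_on (D : Type) (P : set D) (R : D -> D -> Prop) : Prop :=
  [/\ forall x, P x -> ~ R x x,
      forall x y z, P x -> P y -> P z -> R x y -> R y z -> R x z
    & forall x y, P x -> P y -> [\/ R x y, x = y | R y x]].

Definition convex_in (D : Type) (P : set D) (R : D -> D -> Prop) (S : set D) :=
  S `<=` P /\
  forall x y z, S x -> P y -> S z -> R x y -> R y z -> S y.

Definition equivalence_on (D : Type) (P : set D) (E : D -> D -> Prop) : Prop :=
  [/\ forall x, P x -> E x x,
      forall x y, P x -> P y -> E x y -> E y x
    & forall x y z, P x -> P y -> P z -> E x y -> E y z -> E x z].

Inductive bool_comb (D : Type) (G : set (set D)) : set D -> Prop :=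
| BoolGen X of G X : bool_comb G X
| BoolC X of bool_comb G X : bool_comb G (~` X)
| BoolU X Y of bool_comb G X & bool_comb G Y : bool_comb G (X `|` Y).

Definition weakly_quasi_o_minimal (L : language) (M : structure L) : Prop :=
  exists R : M -> M -> Prop,
    [/\ definable set0 (binary R),
        linear_order_on setT R
      & forall X : set M, definable setT (unary X) ->
          bool_comb [set Y | definable set0 (unary Y) \/ convex_in setT R Y] X].

Section WeaklyOMinimalTypes.
Context (L : language) (M : structure L).
Implicit Types (A B : set M) (p q : set (pformula M 1)) (R E Q : M -> M -> Prop).

Definition wom_pair A p R : Prop :=
  [/\ complete_type A p,
      rel_definable (realizations p) A (binary R),
      linear_order_on (realizations p) R
    & forall X : set M, rel_definable (realizations p) setT (unary X) ->
        exists (n : nat) (F : 'I_n -> set M),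
          (forall i, convex_in (realizations p) R (F i)) /\
          X = \bigcup_i F i].

(* [Q] is the relation defined by the formula x < y on the whole structure and
   [R] is its restriction to the realizations of [p]. *)
Definition convex_type A p : Prop :=
  exists R Q (theta : pformula M 1),
    [/\ wom_pair A p R,
        definable A (binary Q) /\
        binary R = binary Q `&` [set v | forall i, realizations p (v i)],
        p theta,
        linear_order_on [set x | psat1 theta x] Q
      & convex_in [set x | psat1 theta x] Q (realizations p)].

(* The elements of E_p. *)
Definition rel_definable_equivalence A p E : Prop :=
  rel_definable (realizations p) A (binary E) /\
  equivalence_on (realizations p) E.

Definition semiinterval A p R (a : M) (S : set M) : Prop :=
  [/\ convex_in (realizations p) R S,
      S a,
      forall x, S x -> a = x \/ R a x
    & rel_definable (realizations p) (A `|` [set a]) (unary S)].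

Definition determined A p R (a : M) (S : set M) : Prop :=
  exists2 E, rel_definable_equivalence A p E &
    S = [set x | E a x /\ (a = x \/ R a x)].

Definition pair_simple_semiintervals A p R : Prop :=
  forall (a : M) (S : set M), semiinterval A p R a S -> determined A p R a S.

Definition type_simple_semiintervals A p : Prop :=
  forall R, wom_pair A p R -> pair_simple_semiintervals A p R.

Definition hereditarily_simple_semiintervals (K : Type) A p : Prop :=
  forall B q, small K B -> A `<=` B -> complete_type B q -> p `<=` q ->
    type_simple_semiintervals B q.

End WeaklyOMinimalTypes.

(* The theory is represented by its monster model [M]. *)
Definition has_simple_semiintervals (K : Type) (L : language) (M : structure L) :=
  forall p : set (pformula M 1), complete_type set0 p ->
    hereditarily_simple_semiintervals K set0 p.

(* Main.v *)
(* A binary tree of definable sets over a finite set gives continuum many types over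
   it, hence continuum many countable models; so one may assume there is none.

   Without simple semiintervals, over some small set a definable monotone relation
   [F] is not transitive on a complete 1-type, hence neither are its iterates. Iterating
   it from a point [c] yields an initial segment [Lam] which is a strictly increasing
   union of definable ones, and, in the absence of trees, a definable set [D] cofinal in
   [Lam] all of whose definable subsets are bounded or co-bounded in [Lam]. For [a]
   realizing the resulting type [OA] just above [Lam], write [ll x a] if [x] realizes
   the same definition over [a]. Elements of the cut defined by [Lam] reflect its
   properties, among them that [F] leads out of every proper definable initial segment;
   from this, all [ll]-decreasing tuples of a given length have the same type (or else
   a tree of short intervals could be built). Hence for a countable order [I] one
   can omit the elements of [OA] that are [ll]-comparable to all members of an
   [I]-indexed family, and the order [I] is recovered from the model as [OA] modulo
   [ll]-incomparability.

   If semiintervals are simple and [P] is the locus of a non-convex type, the convex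
   equivalence relations stating that no element of [pi] outside [rho] lies between two
   points, for [pi] and [rho] in the type, form a chain with union [sim]. Members of a Morley sequence at the end of
   [P] are not [sim]-related, and a definable subset of [P] containing [b] contains an
   equivalence class to the right or to the left of [b], so it cannot avoid the
   [sim]-classes of the members of the sequence that are used in its definition. Again
   a countable order is coded in a model, as [P] modulo [sim].

   There are continuum many pairwise non-isomorphic countable orders, and each
   countable model is named in countably many ways. *)

From Stdlib Require List.
Require Import Defs.
From mathcomp Require Import all_boot all_order ssralg ssrnum rat all_classical.
From mathcomp Require Import lra.

Set Implicit Arguments.
Unset Strict Implicit.
Unset Printing Implicit Defensive.

Local Open Scope classical_set_scope.
Local Open Scope card_scope.

(** Definability is obtained semantically. Semiintervals and the monotone relations derived from
    them are first described with a quantifier over the locus of a type, which is not first-order;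
    they become definable by compactness, once they are definable with some parameters and invariant
    under automorphisms. Invariance comes from the order: if an automorphism carried a point past a
    change of a definable set, its iterates would make that set alternate infinitely often, against
    weak o-minimality.

    Simplicity concerns every order that makes a type weakly o-minimal, so it is reduced to the
    given order and its reverse; this works because convex equivalence relations form a chain.

    Nothing forces a single step of the relation [G], obtained from a failure of transitivity, to
    leave a given definable initial segment. It is enlarged by means of [D] to a relation [F] that
    does lead out of such segments and still never leaves [Lam]. The first property provides points
    next to a definable cut, the second shows that points joined by [F] are not related by [ll]. *)

(** * Renaming of variables, and invariance of satisfaction under isomorphisms *)

Section Renaming.
Context (L : language).

Fixpoint tren n m (f : 'I_n -> 'I_m) (t : term L n) : term L m :=
  match t with
  | Var i => Var (f i)
  | App g ts => App (fun j => tren f (ts j))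
  end.

Definition upren n m (f : 'I_n -> 'I_m) (i : 'I_n.+1) : 'I_m.+1 :=
  if unlift ord0 i is Some j then lift ord0 (f j) else ord0.

Fixpoint ren n m (f : 'I_n -> 'I_m) (phi : formula L n) {struct phi} :
    formula L m :=
  match phi with
  | Bot => Bot
  | Eq t u => Eq (tren f t) (tren f u)
  | Rel r ts => Rel (fun j => tren f (ts j))
  | Imp a b => Imp (ren f a) (ren f b)
  | All a => All (ren (upren f) a)
  end.

Lemma eval_ren (M : structure L) n m (f : 'I_n -> 'I_m) t (v : 'I_m -> M) :
  eval v (tren f t) = eval (v \o f) t.
Proof. by elim: t => //= g ts IH; congr fun_interp; apply/funext. Qed.

Lemma vcons_upren (D : Type) n m (f : 'I_n -> 'I_m) (x : D) v :
  vcons x v \o upren f = vcons x (v \o f).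
Proof.
apply/funext => i; rewrite /vcons /upren /=.
case: (unliftP ord0 i) => [j|] _ /=; [by rewrite liftK|by rewrite unlift_none].
Qed.

Lemma sat_ren (M : structure L) n m (f : 'I_n -> 'I_m) phi (v : 'I_m -> M) :
  sat (ren f phi) v <-> sat phi (v \o f).
Proof.
elim: phi m f v => //=.
- by move=> {}n t u m f v; rewrite !eval_ren.
- move=> {}n r ts m f v.
  by rewrite (_ : (fun j => _) = fun j => eval (v \o f) (ts j)) //;
    apply/funext => j; rewrite eval_ren.
- by move=> {}n a IHa b IHb m f v; rewrite IHa IHb.
- move=> {}n a IH m f v; split=> h x; have := h x;
    by rewrite ?IH ?vcons_upren // -vcons_upren -IH.
Qed.

Lemma eval_iso (M N : structure L) (h : M -> N) n (v : 'I_n -> M) t :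
  isomorphism h -> h (eval v t) = eval (h \o v) t.
Proof.
move=> [_ hf _]; elim: t => //= f ts IH; rewrite hf; congr fun_interp.
exact/funext.
Qed.

Lemma vcons_comp (D D' : Type) (h : D -> D') n x (v : 'I_n -> D) :
  h \o vcons x v = vcons (h x) (h \o v).
Proof. by apply/funext => i; rewrite /vcons /=; case: unlift. Qed.

Lemma sat_iso (M N : structure L) (h : M -> N) n (phi : formula L n) v :
  isomorphism h -> sat phi v <-> sat phi (h \o v).
Proof.
move=> ih; have [[k hk kh] hf hr] := ih; elim: phi v => //=.
- move=> {}n t u v; rewrite -!(eval_iso _ _ ih); split=> [->//|].
  exact: (can_inj hk).
- move=> {}n r ts v; rewrite hr; suff -> : h \o (fun j => eval v (ts j)) =
    fun j => eval (h \o v) (ts j) by [].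
  by apply/funext => j /=; rewrite (eval_iso _ _ ih).
- by move=> {}n a IHa b IHb v; rewrite IHa IHb.
- move=> {}n a IH v; split=> H x.
    by rewrite -(kh x) -vcons_comp -IH.
  by rewrite IH vcons_comp.
Qed.

Lemma isomorphism_id (M : structure L) : isomorphism (@id M).
Proof. by split=> //; exists id. Qed.

Lemma isomorphism_comp (M N P : structure L) (h : M -> N) (k : N -> P) :
  isomorphism h -> isomorphism k -> isomorphism (k \o h).
Proof.
move=> [bh fh rh] [bk fk rk]; split; first exact: bij_comp.
- by move=> f v /=; rewrite fh fk compA.
- by move=> r v; rewrite rh rk compA.
Qed.

Lemma isomorphism_inv (M N : structure L) (h : M -> N) : isomorphism h ->
  exists2 k, isomorphism k & cancel h k /\ cancel k h.
Proof.
move=> [[k hk kh] fh rh]; exists k => //; split; first by exists h.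
- move=> f v; apply: (can_inj hk); rewrite kh fh; congr fun_interp.
  by apply/funext => i /=; rewrite kh.
- move=> r v; rewrite (rh _ (k \o v)); suff -> : h \o (k \o v) = v by [].
  by apply/funext => i /=; rewrite kh.
Qed.

End Renaming.

Definition tmv (D : Type) (v : nat -> D) (s : nat + D) : D :=
  match s with inl k => v k | inr c => c end.

Definition okp (D : Type) (A : set D) (s : nat + D) : Prop :=
  match s with inl _ => True | inr c => A c end.

(** * Definable sets *)

Section Definability.
Context (L : language) (C : structure L).
Implicit Types (A B : set C) (X Y : (nat -> C) -> Prop).

(* A definable set is a set of environments: a free variable of the formula is
   interpreted by a coordinate [inl k] or by a parameter [inr c]. *)
Definition Def A X : Prop := exists n (phi : formula L n) (u : 'I_n -> nat + C),
  (forall i, okp A (u i)) /\ forall v, X v <-> sat phi (tmv v \o u).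

Definition D1 A (X : C -> Prop) := Def A (fun v => X (v 0)).
Definition D2 A (R : C -> C -> Prop) := Def A (fun v => R (v 0) (v 1)).
Definition is_tm A (t : (nat -> C) -> C) :=
  exists2 s, okp A s & forall v, t v = tmv v s.

Lemma Def_ext A X Y : Def A X -> (forall v, X v <-> Y v) -> Def A Y.
Proof.
move=> [n [phi [u [hu h]]]] e; exists n, phi, u; split=> // v.
by rewrite -e h.
Qed.

Lemma okp_mono A B s : A `<=` B -> okp A s -> okp B s.
Proof. by case: s => //= c h /h. Qed.

Lemma Def_mono A B X : A `<=` B -> Def A X -> Def B X.
Proof.
move=> AB [n [phi [u [hu h]]]]; exists n, phi, u; split=> // i.
exact: okp_mono (hu i).
Qed.

Lemma Def_False A : Def A (fun=> False).
Proof.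
by exists 0, Bot, (fun=> inl 0).
Qed.

(** The variables of the two formulas are kept disjoint; a common coordinate is shared through the
    assignment [u], not through a common variable. *)
Lemma Def_imp A X Y : Def A X -> Def A Y -> Def A (fun v => X v -> Y v).
Proof.
move=> [n [phi [u [hu h]]]] [m [psi [w [hw k]]]].
exists (n + m), (Imp (ren (@lshift n m) phi) (ren (@rshift n m) psi)),
  (fun i => match fintype.split i with inl j => u j | inr j => w j end).
split=> [i|v]; first by case: fintype.split.
rewrite /= !sat_ren h k.
set r := tmv v \o (fun i => match fintype.split i with inl j => _ | inr j => _ end).
have -> : r \o @lshift n m = tmv v \o u.
  apply/funext => i; rewrite /r /=.
  by have := unsplitK (inl i : 'I_n + 'I_m); rewrite /unsplit => ->.
suff -> : r \o @rshift n m = tmv v \o w by [].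
apply/funext => i; rewrite /r /=.
by have := unsplitK (inr i : 'I_n + 'I_m); rewrite /unsplit => ->.
Qed.

(** Environments imitate de Bruijn contexts: the bound variable is coordinate 0 and all others are
    shifted. Several variables of [phi] may sit at coordinate 0; the renaming identifies them all
    with the bound one. *)
Lemma Def_all A (B : (nat -> C) -> C -> Prop) :
  Def A (fun w => B (fun k => w k.+1) (w 0)) -> Def A (fun v => forall x, B v x).
Proof.
move=> [n [phi [u [hu h]]]].
exists n, (All (ren (fun i => if u i is inl 0 then ord0 else lift ord0 i) phi)),
  (fun i => if u i is inl k then inl k.-1 else u i).
split=> [i|v]; first by have := hu i; case: (u i).
pose w x (k : nat) := if k is j.+1 then v j else x.
have aux x : vcons x (tmv v \o (fun i => if u i is inl k then inl k.-1 else u i))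
    \o (fun i => if u i is inl 0 then ord0 else lift ord0 i) = tmv (w x) \o u.
  apply/funext => i /=; case E: (u i) => [[|k]|c] /=.
  - by rewrite /vcons unlift_none.
  - by rewrite /vcons liftK /= ?E.
  - by rewrite /vcons liftK /= ?E.
rewrite /=; split=> H x; first by rewrite sat_ren aux; apply/(h (w x))/H.
by have := H x; rewrite sat_ren aux => /(h (w x)).
Qed.

Lemma Def_subst A X (t : nat -> (nat -> C) -> C) : (forall k, is_tm A (t k)) ->
  Def A X -> Def A (fun v => X (fun k => t k v)).
Proof.
move=> ht [n [phi [u [hu h]]]].
have [s hs] := choice (fun k => let: ex_intro2 s a b := ht k in
  ex_intro (fun s => okp A s /\ forall v, t k v = tmv v s) s (conj a b)).
exists n, phi, (fun i => if u i is inl k then s k else u i); split=> [i|v].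
  by have := hu i; case: (u i) => // k _; have [] := hs k.
rewrite h; suff -> : tmv (fun k => t k v) \o u = tmv v \o (fun i =>
  if u i is inl k then s k else u i) by [].
by apply/funext => i /=; case: (u i) => //= k; have [_ ->] := hs k.
Qed.

Lemma is_tm_var A k : is_tm A (fun v => v k).
Proof. by exists (inl k). Qed.

Lemma is_tm_par A c : A c -> is_tm A (fun=> c).
Proof. by exists (inr c). Qed.

Lemma D1_at A (X : C -> Prop) t : D1 A X -> is_tm A t -> Def A (fun v => X (t v)).
Proof. by move=> hX ht; apply: (@Def_subst _ _ (fun=> t)) hX. Qed.

Lemma D2_at A R s t : D2 A R -> is_tm A s -> is_tm A t ->
  Def A (fun v => R (s v) (t v)).
Proof.
by move=> hR hs ht; apply: (@Def_subst _ _ (fun k => if k is 0 then s else t)) hR;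
  case.
Qed.

Lemma Def_not A X : Def A X -> Def A (fun v => ~ X v).
Proof. by move=> h; apply: Def_imp h (Def_False A). Qed.

Lemma Def_or A X Y : Def A X -> Def A Y -> Def A (fun v => X v \/ Y v).
Proof.
move=> hX hY; apply: Def_ext (Def_imp (Def_not hX) hY) _ => v; split.
    by case: (pselect (X v)) => [?|? H]; [left|right; apply: H].
by move=> [h|h].
Qed.

Lemma Def_and A X Y : Def A X -> Def A Y -> Def A (fun v => X v /\ Y v).
Proof.
move=> hX hY; apply: Def_ext (Def_not (Def_imp hX (Def_not hY))) _ => v.
by split=> [/not_implyP[? /contrapT]|[x y] /(_ x)].
Qed.

Lemma Def_iff A X Y : Def A X -> Def A Y -> Def A (fun v => X v <-> Y v).
Proof. by move=> hX hY; apply: Def_and; apply: Def_imp. Qed.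

Lemma Def_ex A (B : (nat -> C) -> C -> Prop) :
  Def A (fun w => B (fun k => w k.+1) (w 0)) -> Def A (fun v => exists x, B v x).
Proof.
move=> h; apply: Def_ext (Def_not
  (@Def_all A (fun v x => ~ B v x) (Def_not h))) _ => v.
split; last by move=> [x hx] /(_ x); apply.
by move=> H; apply: contrapT => nx; apply: H => x hx; apply: nx; exists x.
Qed.

Lemma Def_True A : Def A (fun=> True).
Proof. by apply: Def_ext (Def_imp (Def_False A) (Def_False A)) _. Qed.

Lemma D2_eq A : D2 A eq.
Proof.
exists 2, (Eq (Var ord0) (Var ord_max)), (fun i : 'I_2 => inl (i : nat)).
by split.
Qed.

Lemma Def_support A X : Def A X ->
  exists N, forall v w, (forall k, k < N -> v k = w k) -> X v <-> X w.
Proof.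
move=> [n [phi [u [hu h]]]].
exists (\max_i (if u i is inl k then k.+1 else 0)) => v w vw; rewrite !h.
suff -> : tmv v \o u = tmv w \o u by [].
apply/funext => i /=.
have := @leq_bigmax _ (fun i => if u i is inl k then k.+1 else 0) i.
by case: (u i) => //= k hk; exact/vw.
Qed.

Lemma Def_params A X : Def A X ->
  exists l : seq C, (forall x, List.In x l -> A x) /\ Def (fun x => List.In x l) X.
Proof.
move=> [n [phi [u [hu h]]]].
pose l := [seq (if u i is inr c then [:: c] else [::]) | i <- enum 'I_n].
have inl_ x : List.In x (flatten l) <-> exists i, u i = inr x.
  rewrite /l; split; last first.
    move=> [i ui]; have : i \in enum 'I_n by rewrite mem_enum.
    elim: (enum _) => //= j s IH; rewrite inE => /orP[/eqP<-|/IH hi].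
      by rewrite ui; left.
    by apply/List.in_or_app; right.
  elim: (enum _) => //= j s IH /(@List.in_app_or C)[|//].
  by case uj: (u j) => [//|c] /=[<-|//]; exists j.
exists (flatten l); split=> [x|].
  by move=> /inl_[i ui]; have := hu i; rewrite ui.
exists n, phi, u; split=> // i; case ui: (u i) => //=.
by apply/inl_; exists i.
Qed.

Definition aut A (g : C -> C) := isomorphism g /\ forall x, A x -> g x = x.

Lemma Def_aut A X g v : Def A X -> aut A g -> X v <-> X (g \o v).
Proof.
move=> [n [phi [u [hu h]]]] [ig gA]; rewrite !h (sat_iso phi _ ig).
suff -> : g \o (tmv v \o u) = tmv (g \o v) \o u by [].
by apply/funext => i /=; have := hu i; case: (u i) => //= c /gA.
Qed.

Lemma aut_id A : aut A id.
Proof. by split=> //; exact: isomorphism_id. Qed.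

Lemma aut_comp A g h : aut A g -> aut A h -> aut A (g \o h).
Proof.
move=> [ig gA] [ih hA]; split; first exact: isomorphism_comp.
by move=> x Ax /=; rewrite hA // gA.
Qed.

Lemma aut_inv A g : aut A g -> exists2 h, aut A h & cancel g h /\ cancel h g.
Proof.
move=> [ig gA]; have [h ih [gh hg]] := isomorphism_inv ig.
by exists h => //; split=> // x Ax; rewrite -{1}(gA x Ax) gh.
Qed.

Lemma aut_mono A B g : A `<=` B -> aut B g -> aut A g.
Proof. by move=> AB [ig gB]; split=> // x /AB/gB. Qed.

Lemma D1_aut A (X : C -> Prop) g x : D1 A X -> aut A g -> X x <-> X (g x).
Proof. by move=> hX ha; exact: (Def_aut (fun=> x) hX ha). Qed.

Lemma D2_aut A R g x y : D2 A R -> aut A g -> R x y <-> R (g x) (g y).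
Proof.
move=> hX ha; exact: (Def_aut (fun k => if k is 0 then x else y) hX ha).
Qed.

(** Equality of types over [A]; the set [same A x] is the locus of the type of [x] and stands for
    that type in most of the proof. *)
Definition same A (x y : C) := forall X : C -> Prop, D1 A X -> X x -> X y.
Definition sameT A (v w : nat -> C) := forall X, Def A X -> X v -> X w.

Lemma same_refl A x : same A x x. Proof. by []. Qed.
Lemma same_sym A x y : same A x y -> same A y x.
Proof.
move=> h X hX Xy; apply: contrapT => nX.
exact: (h (fun z => ~ X z) (Def_not hX)).
Qed.
Lemma same_trans A x y z : same A x y -> same A y z -> same A x z.
Proof. by move=> h1 h2 X hX /(h1 X hX)/(h2 X hX). Qed.
Lemma same_mono A B x y : A `<=` B -> same B x y -> same A x y.
Proof. by move=> AB h X hX; apply: h; exact: Def_mono hX. Qed.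
Lemma same_aut A g x : aut A g -> same A x (g x).
Proof. by move=> ga X hX; rewrite (D1_aut x hX ga). Qed.
Lemma sameT_sym A x y : sameT A x y -> sameT A y x.
Proof.
move=> h X hX Xy; apply: contrapT => nX.
exact: (h (fun z => ~ X z) (Def_not hX)).
Qed.

End Definability.

Lemma Def_const (L : language) (C : structure L) (A : set C) (P : Prop) :
  Def A (fun=> P).
Proof.
case: (pselect P) => h; first exact: Def_ext (Def_True A) _.
exact: Def_ext (Def_False A) _.
Qed.

Lemma Def_ex2 (L : language) (C : structure L) (A : set C)
    (P Q : (nat -> C) -> C -> Prop) :
  Def A (fun w => P (fun k => w k.+1) (w 0) /\ Q (fun k => w k.+1) (w 0)) ->
  Def A (fun v => exists2 x, P v x & Q v x).
Proof.
move=> h; apply: Def_ext (@Def_ex _ _ _ (fun v x => P v x /\ Q v x) h) _ => v.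
by split=> [[x []]|[x]]; exists x.
Qed.

Ltac dtm :=
  lazymatch goal with
  | |- is_tm _ (fun v => v _) => apply: is_tm_var
  | |- is_tm _ (fun _ => _) => apply: is_tm_par
  end.

Ltac dstep :=
  lazymatch goal with
  | |- Def _ (fun _ => ?P) => exact: Def_const
  | |- Def _ (fun v => ~ _) => refine (Def_not _)
  | |- Def _ (fun v => _ /\ _) => refine (Def_and _ _)
  | |- Def _ (fun v => _ \/ _) => refine (Def_or _ _)
  | |- Def _ (fun v => _ <-> _) => refine (Def_iff _ _)
  | |- Def _ (fun v => _ = _) => refine (D2_at (@D2_eq _ _ _) _ _)
  | |- Def _ (fun v => exists x, _) => refine (Def_ex _); cbv beta
  | |- Def _ (fun v => exists2 x, _ & _) => refine (Def_ex2 _); cbv beta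
  | |- Def _ (fun v => _ -> _) =>
      first [refine (Def_imp _ _) | refine (Def_all _); cbv beta]
  | H : D1 ?A ?X |- Def ?A' (fun v => ?X _) =>
      refine (D1_at (Def_mono (_ : A `<=` A') H) _)
  | H : D2 ?A ?X |- Def ?A' (fun v => ?X _ _) =>
      refine (D2_at (Def_mono (_ : A `<=` A') H) _ _)
  | |- is_tm _ _ => dtm
  end.
Ltac dunfold :=
  rewrite /D1 /D2;
  lazymatch goal with |- Def ?A ?X =>
    let X' := eval cbv beta delta [setI setC setU setD mkset] in X in
    change (Def A X')
  end.
Ltac dtac := dunfold; repeat dstep; try done.

(** * Cardinalities and small sets *)

Lemma inj_le (T U : Type) (A : set T) (B : set U) (f : T -> U) :
  (forall x, A x -> B (f x)) -> (forall x y, A x -> A y -> f x = f y -> x = y) ->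
  A #<= B.
Proof.
move=> fAB fi; have [g] : $|{injfun A >-> B}|.
  by apply/injfunPex; exists f => // x y /set_mem Ax /set_mem Ay; exact: fi.
exact: inj_card_le g.
Qed.

Lemma le_inj (T U : Type) (A : set T) (B : set U) (u : U) : A #<= B ->
  exists2 f : T -> U, forall x, A x -> B (f x) &
    forall x y, A x -> A y -> f x = f y -> x = y.
Proof.
move=> /card_leP[f].
pose g x := if pselect (A x) is left h then val (f (SigSub (mem_set h))) else u.
exists g => [x Ax|x y Ax Ay]; rewrite /g; case: (pselect (A x)) => // hx.
  exact: set_mem (valP _).
case: (pselect (A y)) => // hy /val_inj /inj.
by rewrite !inE => /(_ I I)[].
Qed.

Lemma countableU (D : Type) (A B : set D) :
  countable A -> countable B -> countable (A `|` B).
Proof.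
move=> cA cB; have : countable (\bigcup_(b in [set: bool]) (if b then A else B)).
  by apply: bigcup_countable => [|[]].
by apply: sub_countable; apply: subset_card_le => x [] ?; [exists true | exists false].
Qed.

Lemma countable_range (D : Type) (f : nat -> D) : countable (range f).
Proof. exact: card_image_le. Qed.

Section SmallSets.
Context (K : Type).

Lemma small_sub (D : Type) (A B : set D) : A `<=` B -> small K B -> small K A.
Proof.
move=> AB [h1 h2]; split; first exact: card_le_trans (subset_card_le AB) h1.
by move=> h; apply: h2; exact: card_le_trans h (subset_card_le AB).
Qed.

Context (hK : card_lt [set: nat] [set: K]).

Lemma small_countable (D : Type) (A : set D) : countable A -> small K A.
Proof.
move=> cA; have [h1 h2] := hK; split; first exact: card_le_trans cA h1.
by move=> h; apply: h2; exact: card_le_trans h cA.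
Qed.

(** Hilbert's hotel along a copy of [nat] inside [K]; the freed room lets one point be added to a
    small set. *)
Lemma shift_type : exists2 e : K -> K, injective e & exists k0, forall k, e k <> k0.
Proof.
have [k0 _] : [set: K] !=set0.
  apply/set0P/negP => /eqP K0; have [+ _] := hK; rewrite K0.
  by move=> /card_le0P/seteqP[/(_ 0 I)].
have [/(le_inj k0)[i _ ii'] _] := hK.
have ii : injective i by move=> x y; exact: ii'.
exists (fun k => if pselect (exists n, i n = k) is left h then i (projT1 (cid h)).+1
  else k).
  move=> x y; case: pselect => hx; case: pselect => hy //.
  - by case: (cid hx) (cid hy) => n en [m em] /= /ii[e]; rewrite -en -em e.
  - by move=> e; case: hy; rewrite -e; eexists.
  - by move=> e; case: hx; rewrite e; eexists.
exists (i 0) => k; case: pselect => [h /ii//|nk e].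
by apply: nk; exists 0.
Qed.

Lemma small_add1 (D : Type) (A : set D) b : small K A -> small K (A `|` [set b]).
Proof.
move=> [h1 h2]; have [e ei [k0 ek0]] := shift_type.
have noK (i : K -> D) : injective i -> (forall k, A (i k)) -> False.
  by move=> ii Ai; apply: h2; apply: (@inj_le _ _ _ _ i) => [k _|k l _ _ ];
    [exact: Ai | exact: ii].
split; last first.
  move=> /(le_inj b)[h hA hi'].
  have hi : injective h by move=> x y; exact: hi'.
  case: (pselect (exists k1, h k1 = b)) => [[k1 hk1]|nb]; last first.
    apply: (noK h) => // k; have [//|] := hA k I.
    by move=> /= e1; case: nb; exists k.
  (* The shift misses [k0], so followed by this transposition it misses [k1], the only preimage of
     [b]. *)
  pose s k := if pselect (k = k1) then k0 else if pselect (k = k0) then k1 else k.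
  have ss : cancel s s.
    by move=> k; rewrite /s; do ?[case: pselect => ? /=]; congruence.
  apply: (noK (h \o s \o e)).
    by move=> x y /= /hi /(can_inj ss) /ei.
  move=> k /=; have [//|/= e1] := hA (s (e k)) I.
  have := hi _ _ (etrans e1 (esym hk1)) => e2.
  have : s k1 = k0 by rewrite /s; case: pselect.
  by rewrite -e2 ss => /ek0.
have [f _ fi] := le_inj k0 h1.
apply: (@inj_le _ _ _ _ (fun x => if pselect (A x) then e (f x) else k0)) => //.
move=> x y Bx By; case: pselect => Ax; case: pselect => Ay.
- by move=> /ei/fi; apply.
- by move=> /ek0.
- by move=> /esym/ek0.
- by case: Bx => // /= ->; case: By => // /= ->.
Qed.

End SmallSets.

(** * Formulas with parameters and definable sets of environments *)

Section Conversion.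
Context (L : language) (C : structure L).
Implicit Types (A B : set C).

Lemma vcat_lshift (D : Type) n m (v : 'I_n -> D) (w : 'I_m -> D) j :
  vcat v w (lshift m j) = v j.
Proof.
by rewrite /vcat; have := unsplitK (inl j : 'I_n + 'I_m); rewrite /unsplit => ->.
Qed.

Lemma vcat_rshift (D : Type) n m (v : 'I_n -> D) (w : 'I_m -> D) j :
  vcat v w (rshift n j) = w j.
Proof.
by rewrite /vcat; have := unsplitK (inr j : 'I_n + 'I_m); rewrite /unsplit => ->.
Qed.

Lemma Def_pformula A (X : (nat -> C) -> Prop) m : Def A X -> exists phi : pformula C m.+1,
  Defs.over A phi /\ forall v, X (fun k => v (inord k)) <-> psat phi v.
Proof.
move=> [n [phi [u [hu h]]]].
(* An element of [A] is the default filling the parameter slots of variables that are coordinates;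
   if [A] is empty, there are no parameters at all. *)
case: (pselect (exists a, A a)) => [[a Aa]|nA].
  pose f i := match u i with inl k => lshift n (inord k) | inr _ => rshift m.+1 i end.
  exists (PFormula (ren f phi) (fun i => if u i is inr c then c else a)); split.
    by move=> i /=; have := hu i; case: (u i).
  move=> v; rewrite h /psat /= sat_ren.
  set r := (X in sat phi X); set r' := (X in _ <-> sat phi X).
  suff -> : r = r' by [].
  apply/funext => i; rewrite /r /r' /= /f; case E: (u i) => [k|c] /=.
    by rewrite vcat_lshift.
  by rewrite vcat_rshift E.
pose f i : 'I_(m.+1 + 0) :=
  match u i with inl k => lshift 0 (inord k) | inr _ => lshift 0 ord0 end.
exists (PFormula (ren f phi) (fun i : 'I_0 => match notF (ltn_ord i) return C with end)).
split=> [[]//|v]; rewrite h /psat /= sat_ren.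
set r := (X in sat phi X); set r' := (X in _ <-> sat phi X).
suff -> : r = r' by [].
apply/funext => i; rewrite /r /r' /= /f; have := hu i.
by case E: (u i) => [k|c] /= hc; rewrite vcat_lshift //; case: nA; exists c.
Qed.

Lemma psat_Def A n (phi : pformula C n) : Defs.over A phi ->
  Def A (fun v => psat phi (fun i => v i)).
Proof.
move=> ho; exists _, (pbody phi), (fun i => match fintype.split i with
  inl j => inl (nat_of_ord j) | inr k => inr (params phi k) end); split=> [i|v].
  by case: fintype.split => //= k; exact: ho.
rewrite /psat; set r := (X in sat _ X); set r' := (X in _ <-> sat _ X).
suff -> : r = r' by [].
by apply/funext => i; rewrite /r /r' /vcat /=; case: fintype.split.
Qed.

Lemma D1_pformula A (X : C -> Prop) : D1 A X -> exists phi : pformula C 1,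
  Defs.over A phi /\ forall x, X x <-> psat1 phi x.
Proof.
move=> /(@Def_pformula _ _ 0)[phi [ho h]]; exists phi; split=> // x.
exact: (h (fun=> x)).
Qed.

Lemma psat1_D1 A (phi : pformula C 1) : Defs.over A phi -> D1 A (psat1 phi).
Proof.
move=> ho; apply: Def_ext (psat_Def ho) _ => v; rewrite /psat1.
suff -> : (fun i : 'I_1 => v i) = fun=> v 0 by [].
by apply/funext => i; rewrite ord1.
Qed.

Lemma definable_unary A (X : set C) : definable A (unary X) <-> D1 A X.
Proof.
split=> [[phi ho e]|hX].
  apply: Def_ext (psat1_D1 ho) _ => v.
  by have E : unary X (fun=> v 0) = psat1 phi (v 0); [rewrite e | rewrite -E].
have [phi [ho h]] := D1_pformula hX.
exists phi => //; apply/seteqP; split=> v /=.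
  rewrite /unary /= h /psat1 (_ : (fun=> v ord0) = v) //.
  by apply/funext => i; rewrite ord1.
rewrite /unary /= h /psat1 (_ : (fun=> v ord0) = v) //.
by apply/funext => i; rewrite ord1.
Qed.

Lemma definable_binary A (R : C -> C -> Prop) : definable A (binary R) <-> D2 A R.
Proof.
split=> [[phi ho e]|hR].
  apply: Def_ext (psat_Def ho) _ => v.
  have E : binary R (fun i : 'I_2 => v i) = psat phi (fun i => v i) by rewrite e.
  by rewrite -E.
have [phi [ho h]] := Def_pformula 1 hR.
have i0 : inord 0 = ord0 :> 'I_2 by apply/val_inj; rewrite /= inordK.
have i1 : inord 1 = ord_max :> 'I_2 by apply/val_inj; rewrite /= inordK.
exists phi => //; apply/seteqP; split=> v /=.
  by have := h v; rewrite i0 i1 => <-.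
by have := h v; rewrite i0 i1 => <-.
Qed.

Lemma rel_definable_unary (P A : set C) (X : set C) :
  rel_definable P A (unary X) <-> exists2 Y, D1 A Y & X = P `&` Y.
Proof.
split=> [[Y hY e]|[Y hY ->]]; last first.
  exists (unary Y); first exact/definable_unary.
  apply/seteqP; split=> v /=; rewrite /unary /=; last first.
    by move=> [Yv /(_ ord0)].
  by move=> [Pv Yv]; split=> // i; rewrite ord1.
exists (fun x => Y (fun=> x)).
  apply/definable_unary; move: hY => [phi ho ->]; exists phi => //.
  apply/seteqP; split=> v /=; rewrite /unary /= (_ : (fun=> v ord0) = v) //;
    by apply/funext => i; rewrite ord1.
apply/seteqP; split=> x.
  move=> Xx; have : unary X (fun=> x) by [].
  by rewrite e /= => -[Yx /(_ ord0)].
move=> [Px Yx]; suff : unary X (fun=> x) by [].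
by rewrite e /=.
Qed.

Lemma ord2P (P : 'I_2 -> Prop) : P ord0 -> P ord_max -> forall i, P i.
Proof.
move=> p0 p1 [[|[|//]] hi].
  by rewrite (_ : Ordinal hi = ord0) //; apply/val_inj.
by rewrite (_ : Ordinal hi = ord_max) //; apply/val_inj.
Qed.

Lemma rel_definable_binary (P A : set C) (R : C -> C -> Prop) :
  rel_definable P A (binary R) <->
  exists2 Q, D2 A Q & forall x y, R x y <-> [/\ P x, P y & Q x y].
Proof.
pose pr (x y : C) (i : 'I_2) := if i == ord0 then x else y.
have prE (v : 'I_2 -> C) : pr (v ord0) (v ord_max) = v.
  by apply/funext; apply: ord2P.
split=> [[Y hY e]|[Q hQ h]].
  exists (fun x y => Y (pr x y)).
    apply/definable_binary; move: hY => [phi ho ->]; exists phi => //.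
    by apply/seteqP; split=> v /=; rewrite /binary /= prE.
  move=> x y; transitivity (binary R (pr x y)); first by [].
  rewrite e /=; split=> [[hY' hP]|[Px Py hY']].
    by split=> //; [apply: (hP ord0) | apply: (hP ord_max)].
  by split=> //; apply: ord2P.
exists (binary Q); first exact/definable_binary.
apply/seteqP; split=> v /=; rewrite /binary /= h.
  by move=> [p0 p1 q]; split=> //; apply: ord2P.
by move=> [q hP].
Qed.

Lemma complete_type_locus A p x0 : complete_type A p -> realizations p x0 ->
  forall x, realizations p x <-> same A x0 x.
Proof.
move=> [pA _ pc] hx0 x; split=> [hx X hX Xx0|hx phi hphi].
  have [phi [ho h]] := D1_pformula hX.
  case: (pc phi ho) => hp; first by apply/h/hx.
  by have := hx0 _ hp; rewrite /psat1 /psat /= => /(_ (iffLR (h _) Xx0)).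
exact: hx (psat1_D1 (pA _ hphi)) (hx0 _ hphi).
Qed.

Lemma complete_type_eq A p x0 : complete_type A p -> realizations p x0 ->
  p = [set phi | Defs.over A phi /\ psat1 phi x0].
Proof.
move=> [pA _ pc] hx0; apply/seteqP; split=> phi.
  by move=> hp; split; [exact: pA | exact: hx0].
move=> [ho hp]; case: (pc phi ho) => // /hx0.
by rewrite /psat1 /psat /= => /(_ hp).
Qed.

End Conversion.

(** * Saturation and homogeneity *)

Section Saturation.
Context (L : language) (T : theory L) (K : Type) (C : structure L).
Context (hC : monster K T C).
Implicit Types (A B : set C) (F : set (set C)).

Lemma nat_lt_K : card_lt [set: nat] [set: K].
Proof.
have [[h1 h2] _ _ _] := hC.
have h : [set: nat] #<= [set: {n : nat & formula L n}].
  apply: (@inj_le _ _ _ _ (fun n => existT (formula L) n Bot)) => // x y _ _.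
  by move=> /(congr1 (@projT1 _ _)).
split; first exact: card_le_trans h h1.
by move=> h3; apply: h2; exact: card_le_trans h3 h.
Qed.

Definition directed (F : set (set C)) := F !=set0 /\
  forall X Y, F X -> F Y -> exists2 Z, F Z & Z `<=` X `&` Y.

(** The directed family generates a proper filter; the [A]-formulas in an ultrafilter above it form
    a complete type, which saturation realizes. *)
Lemma SAT A F : small K A -> (forall X, F X -> D1 A X) -> directed F ->
  (forall X, F X -> X !=set0) -> exists x, forall X, F X -> X x.
Proof.
move=> sA hF [[X0 FX0] hd] hne.
have filF : Filter (filter_from F id).
  by apply: filter_from_filter; [exists X0 | move=> X Y FX FY; apply: hd].
have pF : ProperFilter (filter_from F id) by apply: filter_from_proper.
have [G [uG FG]] := ultraFilterLemma pF.
pose p := [set phi : pformula C 1 | Defs.over A phi /\ G (psat1 phi)].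
have cp : complete_type A p.
  split=> [phi []//|k f hf|phi ho].
    have : G [set x | forall i, psat1 (f i) x].
      by apply: filter_forall => i; have [] := hf i.
    by move=> /filter_ex.
  by have [|] := in_ultra_setVsetC (psat1 phi) uG; [left|right].
have [_ _ hs _] := hC.
have [x hx] := hs A p sA cp; exists x => X FX.
have [phi [ho h]] := D1_pformula (hF X FX).
apply/h/hx; split=> //; apply: FG; exists X => // y; exact: (h y).1.
Qed.
End Saturation.

Definition scons (D : Type) (x : D) (v : nat -> D) (k : nat) : D :=
  if k is j.+1 then v j else x.

(** * Separating parameters from variables *)

Section SplittingConstants.
Context (L : language) (C : structure L).
Implicit Types (A B : set C).

(** Presents the set as a fibre of an [A]-definable relation, so that the parameters [a] can be
    moved by automorphisms or replaced. *)
Lemma D1_split A (a : nat -> C) X : D1 (A `|` range a) X ->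
  exists2 Y, Def A Y & forall z, X z <-> Y (scons z a).
Proof.
move=> [n [phi [u [hu h]]]].
have ht c : exists t : nat + C, (A `|` range a) c -> okp A t /\
    forall z, tmv (scons z a) t = c.
  case: (pselect (A c)) => Ac; first by exists (inr c).
  case: (pselect (range a c)) => [[k _ <-]|na]; first by exists (inl k.+1).
  by exists (inl 0) => -[].
have [t {}ht] := choice ht.
pose u' i := match u i with inl k => inl 0 | inr c => t c end.
exists (fun v => sat phi (tmv v \o u')).
  exists n, phi, u'; split=> // i; rewrite /u'; have := hu i.
  by case: (u i) => //= c /ht[].
move=> z; have := h (fun=> z) => /= ->.
suff -> : tmv (fun=> z) \o u = tmv (scons z a) \o u' by [].
apply/funext => i; rewrite /u' /=; have := hu i.
by case: (u i) => //= c /ht[_ ->].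
Qed.

Lemma D1_split1 A a X : D1 (A `|` [set a]) X ->
  exists2 R, D2 A R & forall z, X z <-> R z a.
Proof.
move=> hX; have [|Y hY h] := @D1_split A (fun=> a) X.
  by apply: Def_mono hX => c [|/= ->]; [left | right; exists 0].
exists (fun x y => Y (scons x (fun=> y))) => //.
apply: (@Def_subst _ _ _ _ (fun k v => scons (v 0) (fun=> v 1) k)) hY => -[|k];
  exact: is_tm_var.
Qed.

Lemma D2_at1 A R c : D2 A R -> D1 (A `|` [set c]) (R^~ c).
Proof. by move=> hR; dtac; right. Qed.

(** Coordinates beyond the support are irrelevant, so only the first [N] of the substituted
    functions have to be terms over [A]. *)
Lemma Def_support_subst A X N (t : nat -> (nat -> C) -> C) :
  (forall v w, (forall k, k < N -> v k = w k) -> X v <-> X w) ->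
  (forall k, k < N -> is_tm A (t k)) -> Def A X ->
  Def A (fun v => X (fun k => t k v)).
Proof.
move=> hN ht hX.
have : Def A (fun v => X (fun k => (if k < N then t k else (@^~ 0)) v)).
  apply: (@Def_subst _ _ _ _ (fun k => if k < N then t k else @^~ 0)) hX => k.
  by case: ifP => [/ht//|_]; exact: is_tm_var.
by move=> /Def_ext; apply=> v; apply: hN => k ->.
Qed.

Definition locus A (x : C) : set (set C) := [set X | D1 A X /\ X x].

Lemma locus_directed A x : directed (locus A x).
Proof.
split; first by exists setT; split=> //; exact: Def_True.
move=> X Y [hX Xx] [hY Yx]; exists (X `&` Y) => //; split=> //.
exact: Def_and.
Qed.

Lemma locusP A x y : (forall X, locus A x X -> X y) <-> same A x y.
Proof. by split=> [h X hX Xx|h X []]; [apply: h | apply: h]. Qed.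

End SplittingConstants.

(** * Homogeneity, compactness, and definability from invariance *)

Section Homogeneity.
Context (L : language) (T : theory L) (K : Type) (C : structure L).
Context (hC : monster K T C).
Implicit Types (A B : set C) (F : set (set C)).

Lemma AUTgen A v w : small K (A `|` range v) -> sameT A v w ->
  exists2 g, aut A g & g \o v = w.
Proof.
move=> sA vw; pose hit x := exists k, v k = x.
pose idx x := if pselect (hit x) is left h then projT1 (cid h) else 0.
have idxP x : hit x -> v (idx x) = x.
  by rewrite /idx => h; case: pselect => // h'; case: (cid h').
pose f x := if pselect (hit x) then w (idx x) else x.
(* Entries of [v] may repeat; a coincidence is definable, hence shared by [w], and [f] does not
   depend on the index chosen by [idx]. *)
have eqw i j : v i = v j -> w i = w j.
  have : Def A (fun u : nat -> C => u i = u j) by dtac.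
  by move=> /vw.
have fv k : f (v k) = w k.
  rewrite /f; case: pselect => [h|[]]; last by exists k.
  by apply: eqw; exact: idxP.
have fA x : A x -> f x = x.
  move=> Ax; rewrite /f; case: pselect => // h.
  have : Def A (fun u : nat -> C => u (idx x) = x) by dtac.
  by move=> /vw H; have := H (idxP _ h).
have el : elementary_on (A `|` range v) f.
  move=> n phi y hy.
  pose u i := if pselect (hit (y i)) then inl (idx (y i)) else inr (y i).
  have hX : Def A (fun v => sat phi (tmv v \o u)).
    exists n, phi, u; split=> // i; rewrite /u; case: pselect => //= h.
    by have [//|[k _ e]] := hy i; case: h; exists k.
  have ev : tmv v \o u = y.
    apply/funext => i; rewrite /= /u; case: pselect => //= h; exact: (idxP _ h).
  have ew : tmv w \o u = f \o y.
    apply/funext => i; rewrite /= /u; case: pselect => /= h.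
      by rewrite -{2}(idxP _ h) fv.
    by rewrite /f; case: pselect.
  rewrite -{1}ev -ew; split; first exact: (vw _ hX).
  exact: (sameT_sym vw hX).
have [_ _ _ hh] := hC; have [g [ig gf]] := hh _ f sA el.
exists g; first by split=> // x Ax; rewrite gf ?fA //; left.
by apply/funext => k /=; rewrite gf ?fv //; right; exists k.
Qed.

Lemma AUT A b b' : small K A -> same A b b' -> exists2 g, aut A g & g b = b'.
Proof.
move=> sA bb'; have [||g gA e] := @AUTgen A (fun=> b) (fun=> b').
- apply: small_sub (small_add1 (nat_lt_K hC) b sA) => x [|[_ _ <-]];
    by [left | right].
- move=> X hX Xb; apply: (bb' (fun z => X (fun=> z))) => //.
  by apply: (@Def_subst _ _ _ _ (fun _ v => v 0)) hX => k; exact: is_tm_var.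
by exists g => //; have /= := congr1 (@^~ 0) e.
Qed.

Lemma AUTw A v w : countable A -> sameT A v w -> exists2 g, aut A g & g \o v = w.
Proof.
move=> cA; apply: AUTgen; apply: (small_countable (nat_lt_K hC)).
by apply: countableU => //; exact: countable_range.
Qed.

Lemma small_addl A l : small K A -> small K (A `|` (fun x => List.In x l)).
Proof.
move=> sA; elim: l => [|b l IH].
  by apply: small_sub sA => x [].
apply: small_sub (small_add1 (nat_lt_K hC) b IH) => x [Ax|[<-|h]].
- by left; left.
- by right.
- by left; right.
Qed.

Lemma COMPACT A F Y : small K A -> (forall X, F X -> D1 A X) -> directed F ->
  D1 A Y -> (forall x, (forall X, F X -> X x) -> Y x) ->
  exists2 X, F X & X `<=` Y.
Proof.
move=> sA hF [[X0 FX0] hd] hY h; apply: contrapT => no.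
have [|||x hx] := @SAT _ _ _ _ hC A [set Z | exists2 X, F X & Z = X `&` ~` Y] sA.
- by move=> _ [X FX ->]; apply: Def_and; [exact: hF | exact: Def_not].
- split; first by exists (X0 `&` ~` Y); exists X0.
  move=> _ _ [X FX ->] [X' FX' ->]; have [Z FZ ZXX'] := hd _ _ FX FX'.
  by exists (Z `&` ~` Y); [exists Z | move=> x [/ZXX'[? ?] ?]].
- move=> _ [X FX ->]; apply/set0P/negP => /eqP e; apply: no; exists X => // x Xx.
  by apply: contrapT => nY; have : (set0 : set C) x by rewrite -e.
have [//|] := hx (X0 `&` ~` Y); first by exists X0.
move=> _; apply; apply: h => X FX; by have [] := hx (X `&` ~` Y) (ex_intro2 _ _ X FX erefl).
Qed.

Lemma D1_small A (Y : C -> Prop) : small K A -> D1 setT Y ->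
  exists B, [/\ small K B, A `<=` B & D1 B Y].
Proof.
move=> sA /Def_params[l [_ hl]].
exists (A `|` (fun x => List.In x l)); split; first exact: small_addl.
  by move=> x; left.
by apply: Def_mono hl => x; right.
Qed.

(* Compactness twice: once for each point of [Y], to get a definable neighbourhood
   inside [Y], and once to cover [Y] by finitely many of them. *)
Lemma DINV A F (Y : C -> Prop) : small K A -> (forall X, F X -> D1 A X) ->
  directed F -> D1 setT Y ->
  (forall g x, aut A g -> (forall X, F X -> X x) -> Y x -> Y (g x)) ->
  exists2 Y', D1 A Y' & forall x, (forall X, F X -> X x) -> Y x <-> Y' x.
Proof.
move=> sA hF dF hY0 inv.
have [B [sB AB hY]] := D1_small sA hY0.
have hFB X : F X -> D1 B X by move=> /hF; exact: Def_mono.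
have [[X0 FX0] hd] := dF.
have st1 y : (forall X, F X -> X y) -> Y y ->
    exists X, [/\ D1 A X, X y & forall z, (forall X, F X -> X z) -> X z -> Y z].
  move=> Py Yy.
  have [||||Z] := @COMPACT B [set Z | exists X, exists2 P,
      locus A y X & F P /\ Z = X `&` P] Y sB.
  - move=> _ [X [P [hX _] [FP ->]]]; apply: Def_and; last exact: hFB.
    exact: Def_mono hX.
  - have [[S0 LS0] hl] := locus_directed A y; split.
      by exists (S0 `&` X0), S0, X0.
    move=> _ _ [S [P LS [FP ->]]] [S' [P' LS' [FP' ->]]].
    have [S1 LS1 s1] := hl _ _ LS LS'; have [P1 FP1 p1] := hd _ _ FP FP'.
    exists (S1 `&` P1); first by exists S1, P1.
    by move=> x [/s1[? ?] /p1[? ?]].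
  - exact: hY.
  - move=> x hx; have sx : same A y x.
      by apply/locusP => X LX; have [] := hx (X `&` X0) (ex_intro _ X
        (ex_intro2 _ _ X0 LX (conj FX0 erefl))).
    by have [g gA <-] := AUT sA sx; apply: inv.
  move=> [X [P [hX Xy] [FP ->]]] sub; exists X; split=> // z Pz Xz.
  by apply: sub; split=> //; exact: Pz.
pose I := [set X | D1 A X /\ forall z, (forall X, F X -> X z) -> X z -> Y z].
apply: contrapT => no.
have [|||x hx] := @SAT _ _ _ _ hC B [set Z | exists X, exists2 P, I X &
    F P /\ Z = (P `&` Y) `&` ~` X] sB.
- move=> _ [X [P [hX _] [FP ->]]]; apply: Def_and.
    by apply: Def_and; [exact: hFB | exact: hY].
  by apply: Def_not; exact: Def_mono hX.
- split.
    exists ((X0 `&` Y) `&` ~` set0), set0, X0 => //.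
    by split=> //; exact: Def_False.
  move=> _ _ [S [P [h1 h2] [FP ->]]] [S' [P' [h1' h2'] [FP' ->]]].
  have [P1 FP1 p1] := hd _ _ FP FP'.
  exists ((P1 `&` Y) `&` ~` (S `|` S')).
    exists (S `|` S'), P1 => //; split; first exact: Def_or.
    by move=> z Pz [] ?; [exact: h2 | exact: h2'].
  move=> x [[/p1[? ?] ?] ns]; split; split=> // ?; apply: ns; by [left|right].
- move=> _ [X [P [hX IX] [FP ->]]]; apply/set0P/negP => /eqP e; apply: no.
  exists X => // x Px; split=> [Yx|]; last exact: IX.
  apply: contrapT => nX; have : (set0 : set C) x by rewrite -e; split=> //; split=> //; exact: Px.
  by [].
have I0 : I set0 by split=> //; exact: Def_False.
have Px X : F X -> X x.
  by move=> FX; have [[]] := hx _ (ex_intro _ set0 (ex_intro2 _ _ X I0 (conj FX erefl))).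
have Yx : Y x.
  by have [[]] := hx _ (ex_intro _ set0 (ex_intro2 _ _ X0 I0 (conj FX0 erefl))).
have [X [hX Xx IX]] := st1 x Px Yx.
by have [_] := hx _ (ex_intro _ X (ex_intro2 _ _ X0 (conj hX IX) (conj FX0 erefl))).
Qed.

(** An invariant relation on a locus is determined by its fibre at [x0], to which [DINV] applies
    over [A] and [x0]. *)
Lemma DINV2 A x0 (R : C -> C -> Prop) : small K A ->
  (forall x y g, same A x0 x -> same A x0 y -> aut A g -> R x y -> R (g x) (g y)) ->
  (exists2 Y, D1 setT Y & forall x, same A x0 x -> R x x0 <-> Y x) ->
  exists2 Q, D2 A Q & forall x y, same A x0 x -> same A x0 y -> R x y <-> Q x y.
Proof.
move=> sA inv [Y hY e].
have aA : A `<=` A `|` [set x0] by move=> ?; left.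
have x0x0 := @same_refl _ _ A x0.
have [|||||Y' hY' e'] := @DINV (A `|` [set x0]) (locus A x0) Y.
- exact: (small_add1 (nat_lt_K hC) x0 sA).
- by move=> X [hX _]; exact: Def_mono hX.
- exact: locus_directed.
- exact: hY.
- move=> g x ga /locusP Px /(e x Px) Rx.
  have gx : same A x (g x) := same_aut (aut_mono aA ga).
  apply/(e (g x) (same_trans Px gx)).
  have gx0 : g x0 = x0 by have [_ ->] := ga; last right.
  by rewrite -gx0; apply: inv => //; exact: aut_mono ga.
have [Q hQ eQ] := D1_split1 hY'.
exists Q => // x y Px Py.
have [g ga gy] := AUT sA Py.
have [h ha [gh hg]] := aut_inv ga.
have hPx : same A x0 (h x) := same_trans Px (same_aut ha).
have hy : h y = x0 by rewrite -gy gh.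
rewrite (D2_aut x y hQ ha) hy -eQ -e' ?locusP // -e //.
split=> [Rxy|]; first by rewrite -hy; exact: inv.
by move=> /(inv _ _ g hPx x0x0 ga); rewrite hg gy.
Qed.

End Homogeneity.

Definition le (D : Type) (R : D -> D -> Prop) x y := x = y \/ R x y.

(** * Convex sets *)

Section FiniteUnionsOfConvexSets.
Context (D : Type) (P : set D) (R : D -> D -> Prop) (hR : linear_order_on P R).
Implicit Types (S G : set D) (l : seq (set D)).

Definition fconv G := exists l, (forall S, List.In S l -> convex_in P R S) /\
  forall x, G x <-> exists2 S, List.In S l & S x.

Lemma fconv0 : fconv set0.
Proof. by exists [::]; split=> // x; split=> // -[]. Qed.

Lemma fconv_convex S : convex_in P R S -> fconv S.
Proof.
move=> h; exists [:: S]; split=> [_ [<-|//]//|x].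
by split=> [Sx|[_ [<-|//]//]]; exists S => //; left.
Qed.

Lemma fconvU G H : fconv G -> fconv H -> fconv (G `|` H).
Proof.
move=> [l [cl hl]] [m [cm hm]]; exists (l ++ m); split.
  by move=> S /(@List.in_app_or (set D))[]; [exact: cl | exact: cm].
move=> x; split.
  move=> [/hl|/hm] [S iS Sx]; exists S => //; apply: List.in_or_app; by [left|right].
by move=> [S /(@List.in_app_or (set D))[iS|iS] Sx];
  [left; apply/hl | right; apply/hm]; exists S.
Qed.

Lemma convexI S S' : convex_in P R S -> convex_in P R S' -> convex_in P R (S `&` S').
Proof.
move=> [s c] [s' c']; split=> [x [/s]//|x y z [Sx Sx'] Py [Sz Sz'] xy yz].
by split; [apply: c Sx Py Sz xy yz | apply: c' Sx' Py Sz' xy yz].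
Qed.

Lemma fconvI G H : fconv G -> fconv H -> fconv (G `&` H).
Proof.
move=> [l [cl hl]] [m [cm hm]].
exists (List.map (fun p => p.1 `&` p.2) (List.list_prod l m)); split.
  move=> S /List.in_map_iff[[S1 S2] [<- /List.in_prod_iff[i1 i2]]].
  by apply: convexI; [exact: cl | exact: cm].
move=> x; split.
  move=> [/hl[S iS Sx] /hm[S' iS' Sx']]; exists (S `&` S') => //.
  apply/List.in_map_iff; exists (S, S'); split=> //.
  by apply/List.in_prod_iff.
move=> [_ /List.in_map_iff[[S1 S2] [<- /List.in_prod_iff[i1 i2]]] [x1 x2]].
by split; [apply/hl; exists S1 | apply/hm; exists S2].
Qed.

Lemma fconv_ext G H : fconv G -> (forall x, G x <-> H x) -> fconv H.
Proof. by move=> [l [c h]] e; exists l; split=> // x; rewrite -e. Qed.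

Let tr : forall x y z, P x -> P y -> P z -> R x y -> R y z -> R x z.
Proof. by case: hR. Qed.
Let irr x : P x -> ~ R x x. Proof. by case: hR => h _ _; exact: h. Qed.
Let tot : forall x y, P x -> P y -> [\/ R x y, x = y | R y x].
Proof. by case: hR. Qed.

Lemma le_trans_on x y z : P x -> P y -> P z -> le R x y -> le R y z -> le R x z.
Proof.
move=> Px Py Pz [->//|xy] [<-|yz]; right=> //; exact: tr xy yz.
Qed.

Lemma fconv_noalt G (s : nat -> D) : fconv G -> (forall k, P (s k)) ->
  (forall i j, i < j -> R (s i) (s j)) ->
  (forall k, G (s k.*2)) -> (forall k, ~ G (s k.*2.+1)) -> False.
Proof.
move=> [l [cl hl]].
have {hl} : forall x, G x <-> exists2 S, List.In S l & S x by [].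
elim: l G s cl => [|S l IH] G s cl hl Ps mono even odd.
  by have /hl[] := even 0.
have [csub cS] := cl S (or_introl erefl).
have oddS k : ~ S (s k.*2.+1).
  by move=> h; apply: (odd k); apply/hl; exists S => //; left.
case: (pselect (exists k, S (s k.*2))) => [[k Sk]|nS].
  apply: (IH (fun x => exists2 S, List.In S l & S x) (fun j => s (k.+1.*2 + j))) => //.
  - by move=> S' iS'; apply: cl; right.
  - by move=> i j ij; apply: mono; rewrite ltn_add2l.
  - move=> j; rewrite -doubleD; have /hl[S' [<-|iS'] hS'] := even (k.+1 + j).
      case: (oddS k); apply: (cS _ _ _ Sk (Ps _) hS'); apply: mono => //.
      by rewrite doubleD doubleS leq_addr.
    by exists S'.
  - move=> j; rewrite addnS -doubleD => -[S' iS' hS'].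
    by apply: (odd (k.+1 + j)); apply/hl; exists S' => //; right.
apply: (IH (fun x => exists2 S, List.In S l & S x) s) => //.
- by move=> S' iS'; apply: cl; right.
- move=> k; have /hl[S' [<-|iS'] hS'] := even k; first by case: nS; exists k.
  by exists S'.
- by move=> k [S' iS' hS']; apply: (odd k); apply/hl; exists S' => //; right.
Qed.

(** A substitute for the infimum in an order that need not be complete: [y] lies in a leftmost
    piece, so [G] has no hole between [y] and a smaller element of [G]. *)
Lemma fconv_first G : fconv G -> G !=set0 -> exists2 y, G y &
  forall s m, G s -> le R s y -> P m -> le R s m -> le R m y -> G m.
Proof.
move=> [l [cl hl]].
elim: l G cl hl => [|S l IH] G cl hl [x0 Gx0]; first by have /hl[] := Gx0.
pose H x := exists2 S, List.In S l & S x.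
have GE x : G x <-> S x \/ H x.
  rewrite hl; split=> [[S' [<-|i] ?]|[?|[S' i ?]]]; [by left| |by exists S => //; left|].
    by right; exists S'.
  by exists S' => //; right.
have [SP cS] := cl S (or_introl erefl).
have cS' a m b : S a -> P m -> S b -> le R a m -> le R m b -> S m.
  by move=> Sa Pm Sb [<-//|am] [->//|mb]; exact: cS Sa Pm Sb am mb.
have HP : H `<=` P.
  by move=> x [S' i]; have [s _] := cl S' (or_intror i); exact: s.
case: (pselect (exists x, H x)) => [[x1 Hx1]|nH]; last first.
  exists x0 => // s m /GE[Ss|h]; last by case: nH; exists s.
  have /GE[S0|h] := Gx0; last by case: nH; exists x0.
  by move=> _ Pm sm mx; apply/GE; left; exact: cS' Ss Pm S0 sm mx.
have [|//|y1 Hy1 h1] := IH H _ _ (ex_intro _ x1 Hx1).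
  by move=> S' i; apply: cl; right.
have Py1 := HP _ Hy1.
case: (pselect (exists2 s0, S s0 & le R s0 y1)) => [[s0 Ss0 s0y]|nS]; last first.
  exists y1; first by apply/GE; right.
  move=> s m /GE[Ss|Hs] sy Pm sm my; first by case: nS; exists s.
  by apply/GE; right; exact: h1 Hs sy Pm sm my.
have Ps0 := SP _ Ss0.
case: (pselect (exists2 t, H t & le R t s0)) => [[t Ht ts0]|nt].
  have Pt := HP _ Ht.
  exists y1; first by apply/GE; right.
  move=> s m /GE[Ss|Hs] sy Pm sm my; last first.
    by apply/GE; right; exact: h1 Hs sy Pm sm my.
  case: (pselect (le R m s0)) => ms0.
    by apply/GE; left; exact: cS' Ss Pm Ss0 sm ms0.
  have s0m : le R s0 m.
    by case: (tot Ps0 Pm) => [h|h|h]; [right|left|case: ms0; right].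
  apply/GE; right; apply: (h1 t) => //.
    exact: le_trans_on ts0 s0y.
  exact: le_trans_on ts0 s0m.
exists s0; first by apply/GE; left.
move=> s m /GE[Ss|Hs] sy Pm sm my; last by case: nt; exists s.
by apply/GE; left; exact: cS' Ss Pm Ss0 sm my.
Qed.

Lemma fconv_last G x0 : P x0 -> fconv G ->
  (exists2 y0, P y0 & forall y, P y -> le R y0 y -> G y) \/
  (exists2 y0, P y0 & forall y, P y -> le R y0 y -> ~ G y).
Proof.
move=> Px0 [l [cl hl]].
elim: l G cl hl => [|S l IH] G cl hl.
  by right; exists x0 => // y _ _ /hl[].
case: (IH (fun x => exists2 S', List.In S' l & S' x)) => //.
- by move=> S' i; apply: cl; right.
- move=> [y0 P0 h]; left; exists y0 => // y Py y0y; apply/hl.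
  by have [S' i Sy] := h y Py y0y; exists S' => //; right.
move=> [y0 P0 h].
have [SP cS] := cl S (or_introl erefl).
case: (pselect (exists y1, P y1 /\ forall y, P y -> le R y1 y -> ~ S y)) => [[y1 [P1 h']]|no].
  right; have [y2 P2 [l0 l1]] : exists2 y2, P y2 & le R y0 y2 /\ le R y1 y2.
    by case: (tot P0 P1) => [?|->|?]; [exists y1|exists y1|exists y0] => //;
      split; by [left|right].
  exists y2 => // y Py y2y /hl[S' [<-|i] Sy].
    by apply: (h' y) => //; exact: (le_trans_on P1 P2 Py l1 y2y).
  by apply: (h y) => //; [exact: (le_trans_on P0 P2 Py l0 y2y) | exists S'].
have big y : P y -> exists2 y', le R y y' & S y'.
  move=> Py; apply: contrapT => nb; apply: no; exists y; split=> // y' Py' yy' Sy'.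
  by apply: nb; exists y'.
have [y1 _ S1] := big x0 Px0.
left; exists y1; first exact: SP.
move=> y Py [<-|y1y]; first by apply/hl; exists S => //; left.
have [y2 [<-|yy2] S2] := big y Py; first by apply/hl; exists S => //; left.
by apply/hl; exists S; [left | exact: (cS y1 y y2)].
Qed.

End FiniteUnionsOfConvexSets.

Lemma linear_order_rev (D : Type) (P : set D) (R : D -> D -> Prop) :
  linear_order_on P R -> linear_order_on P (fun x y => R y x).
Proof.
move=> [i t c]; split=> // [x y z Px Py Pz xy yz|x y Px Py]; first exact: t yz xy.
by case: (c x y Px Py) => h; [apply: Or33|apply: Or32|apply: Or31].
Qed.

Lemma convex_in_rev (D : Type) (P S : set D) (R : D -> D -> Prop) :
  convex_in P R S -> convex_in P (fun x y => R y x) S.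
Proof.
by move=> [s c]; split=> // x y z Sx Py Sz xy yz; apply: (c z y x).
Qed.

(** * Weakly quasi-o-minimal orders *)

Section WeakQuasiOMinimality.
Context (L : language) (C : structure L).
Implicit Types (A B : set C) (lt : C -> C -> Prop).

Definition wqo_order lt := [/\ D2 set0 lt, linear_order_on setT lt &
  forall X, D1 setT X -> bool_comb [set Y | D1 set0 Y \/ convex_in setT lt Y] X].

Lemma wqo_order_ex : weakly_quasi_o_minimal C -> exists lt, wqo_order lt.
Proof.
move=> [lt [hlt lin h]]; exists lt; split=> //; first exact/definable_binary.
move=> X hX; suff <- : [set Y : set C | definable set0 (unary Y) \/
    convex_in setT lt Y] = [set Y | D1 set0 Y \/ convex_in setT lt Y].
  by apply: h; exact/definable_unary.
by apply/seteqP; split=> Y /= [hY|hY]; [left|right|left|right] => //;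
  exact/definable_unary.
Qed.

Lemma wqo_order_rev lt : wqo_order lt -> wqo_order (fun x y => lt y x).
Proof.
move=> [hlt lin h]; split; [|exact: linear_order_rev|].
  by dtac.
move=> X hX; suff -> : [set Y | D1 set0 Y \/ convex_in setT (fun x y => lt y x) Y]
    = [set Y | D1 set0 Y \/ convex_in setT lt Y] by exact: h.
by apply/seteqP; split=> Y /= [?|/convex_in_rev ?]; [left|right|left|right].
Qed.

Context (lt : C -> C -> Prop) (hlt : wqo_order lt).
Local Notation "x ≺ y" := (lt x y) (at level 70).
Local Notation "x ≼ y" := (le lt x y) (at level 70).

Lemma ltD : D2 set0 lt. Proof. by case: hlt. Qed.
Lemma ltD_ A : D2 A lt. Proof. by apply: Def_mono ltD. Qed.
Lemma lt_irr x : ~ x ≺ x. Proof. by case: hlt => _ [h _ _] _; exact: h. Qed.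
Lemma lt_tr x y z : x ≺ y -> y ≺ z -> x ≺ z.
Proof. by case: hlt => _ [_ h _] _; exact: h. Qed.
Lemma lt_tot x y : [\/ x ≺ y, x = y | y ≺ x].
Proof. by case: hlt => _ [_ _ h] _; exact: h. Qed.
Lemma le_tr x y z : x ≼ y -> y ≼ z -> x ≼ z.
Proof. by move=> [->//|xy] [<-|yz]; right=> //; exact: lt_tr xy yz. Qed.
Lemma lt_le_tr x y z : x ≺ y -> y ≼ z -> x ≺ z.
Proof. by move=> xy [<-//|yz]; exact: lt_tr xy yz. Qed.
Lemma le_lt_tr x y z : x ≼ y -> y ≺ z -> x ≺ z.
Proof. by move=> [->//|xy] yz; exact: lt_tr xy yz. Qed.
Lemma le_gtF x y : x ≼ y -> ~ y ≺ x.
Proof. by move=> xy /(le_lt_tr xy)/lt_irr. Qed.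
Lemma notlt x y : ~ x ≺ y -> y ≼ x.
Proof. by case: (lt_tot x y) => [//|->|h] _; [left|right]. Qed.
Lemma notle x y : ~ x ≼ y -> y ≺ x.
Proof. by case: (lt_tot x y) => [h|->|//] []; [right|left]. Qed.
Lemma le_anti x y : x ≼ y -> y ≼ x -> x = y.
Proof. by move=> [//|xy] /le_gtF. Qed.
Lemma lt_lin P : linear_order_on P lt.
Proof.
by split=> [x _|x y z _ _ _|x y _ _]; [exact: lt_irr|exact: lt_tr|exact: lt_tot].
Qed.
Lemma leD A : D2 A (le lt).
Proof. by have h := ltD_ A; rewrite /le; dtac. Qed.
Lemma aut_lt A g x y : aut A g -> x ≺ y <-> g x ≺ g y.
Proof. by apply: D2_aut; exact: ltD_. Qed.
Lemma aut_le A g x y : aut A g -> x ≼ y <-> g x ≼ g y.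
Proof. by apply: D2_aut; exact: leD. Qed.

(** On such a set every 0-definable set is everything or empty, so that only convex sets contribute
    to Boolean combinations. *)
Definition zhom (P : set C) := forall x y, P x -> P y -> same set0 x y.

Lemma zhom_same A x0 : zhom (same A x0).
Proof.
move=> x y hx hy; apply: (@same_mono _ _ set0 A) => //.
exact: same_trans (same_sym hx) hy.
Qed.

(** The complement is carried through the induction over Boolean combinations. The complement of a
    convex set has two convex pieces, the points below some element of it and the others. *)
Lemma finconv P X : zhom P -> D1 setT X -> fconv P lt (P `&` X).
Proof.
move=> zP /(let: And3 _ _ h := hlt in h X) hX.
suff : fconv P lt (P `&` X) /\ fconv P lt (P `&` ~` X) by case.
elim: hX => {X} [X [hX|[_ cX]]|X _ [h1 h2]|X Y _ [h1 h2] _ [h3 h4]].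
- have cP : fconv P lt P by apply: fconv_convex; split.
  case: (pselect (exists2 x, P x & X x)) => [[x0 Px0 Xx0]|nX].
    have XX x : P x -> X x by move=> Px; exact: (zP x0 x Px0 Px X hX Xx0).
    split; first by apply: fconv_ext cP _ => x; split=> [Px|[]//]; split=> //; exact: XX.
    by apply: fconv_ext (fconv0 _ _) _ => x; split=> // -[/XX].
  have XX x : P x -> ~ X x by move=> Px Xx; apply: nX; exists x.
  split; first by apply: fconv_ext (fconv0 _ _) _ => x; split=> // -[/XX].
  by apply: fconv_ext cP _ => x; split=> [Px|[]//]; split=> //; exact: XX.
- split.
    apply: fconv_convex; split=> [x []//|x y z [_ Xx] Py [_ Xz] xy yz].
    by split=> //; exact: cX Xx I Xz xy yz.
  have h1 : fconv P lt [set x | [/\ P x, ~ X x & exists2 y, X y & x ≺ y]].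
    apply: fconv_convex; split=> [x []//|x m z [Px nx [y Xy xy]] Pm [Pz nz [w Xw zw]] xm mz].
    split=> //; last by exists w => //; exact: lt_tr mz zw.
    by move=> Xm; apply: nz; exact: cX Xm I Xw mz zw.
  have h2 : fconv P lt [set x | [/\ P x, ~ X x & ~ exists2 y, X y & x ≺ y]].
    apply: fconv_convex; split=> [x []//|x m z [Px nx ex] Pm [Pz nz ez] xm mz].
    split=> //; first by move=> Xm; apply: ex; exists m.
    by move=> [y Xy my]; apply: ex; exists y => //; exact: lt_tr xm my.
  apply: fconv_ext (fconvU h1 h2) _ => x; split.
    by move=> [[? ? _]|[? ? _]].
  by move=> [Px nX]; case: (pselect (exists2 y, X y & x ≺ y)) => ?; [left|right].
- split=> //; apply: fconv_ext h1 _ => x.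
  by split=> -[Px]; [move=> Xx; split=> // | move=> /contrapT].
- split.
    apply: fconv_ext (fconvU h1 h3) _ => x; split.
      by move=> [[? ?]|[? ?]]; split=> //; [left|right].
    by move=> [? [?|?]]; [left|right].
  apply: fconv_ext (fconvI h2 h4) _ => x; split.
    by move=> [[Px nX] [_ nY]]; split=> // -[].
  by move=> [Px n]; split; split=> // ?; apply: n; [left|right].
Qed.

(** The images of [b] and [s] under the iterates of [g] interlace to an increasing sequence along
    which [Y] alternates. This is the source of all invariance arguments. *)
Lemma alternation A P Y g b s : zhom P -> D1 A Y -> aut A g ->
  (forall x, P x -> P (g x)) -> P b -> P s -> b ≺ s -> s ≺ g b ->
  Y b -> ~ Y s -> False.
Proof.
move=> zP hY ga Pg Pb Ps bs sgb Yb nYs.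
pose t k := iter k./2 g (if odd k then s else b).
have aut_iter k : aut A (iter k g).
  by elim: k => [|k IH]; [exact: aut_id | exact: (aut_comp ga IH)].
have t0 k : t k.*2 = iter k g b by rewrite /t odd_double doubleK.
have t1 k : t k.*2.+1 = iter k g s.
  by rewrite /t /= odd_double uphalf_double.
have step k : t k ≺ t k.+1.
  rewrite -[k]odd_double_half; case: (odd k) => /=.
    by rewrite add1n -doubleS t1 t0 iterSr -(aut_lt _ _ (aut_iter _)).
  by rewrite add0n t0 t1 -(aut_lt _ _ (aut_iter _)).
have mono i j : i < j -> t i ≺ t j.
  elim: j => // j IH; rewrite ltnS leq_eqVlt => /orP[/eqP->//|/IH h].
  exact: lt_tr h (step j).
apply: (@fconv_noalt _ P lt _ t (finconv (X := Y) zP _)) => //.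
- by apply: Def_mono hY.
- by move=> k; rewrite /t; elim: k./2 => [|n IH]; [case: ifP | exact: Pg].
- move=> k; rewrite t0; split; last by rewrite -(D1_aut b hY (aut_iter k)).
  by elim: k => // k IH; exact: Pg.
- by move=> k; rewrite t1 => -[_]; rewrite -(D1_aut s hY (aut_iter k)).
Qed.

End WeakQuasiOMinimality.

(** * Semiintervals *)

Section Semiintervals.
Context (L : language) (T : theory L) (K : Type) (C : structure L).
Context (hC : monster K T C).
Implicit Types (A B : set C) (R F E : C -> C -> Prop).

(** A weakly o-minimal pair whose type is that of [x0] over [A], with a definition of the order
    extended to the whole structure. *)
Definition wo_order A x0 R := [/\ D2 A R, linear_order_on (same A x0) R &
  forall X, D1 setT X -> fconv (same A x0) R (same A x0 `&` X)].

Definition mono_rel A x0 R F := [/\ D2 A F,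
  forall x y, same A x0 x -> same A x0 y -> F x y -> le R x y,
  forall x, same A x0 x -> F x x
  & forall x x1 y1 y, same A x0 x -> same A x0 x1 -> same A x0 y1 -> same A x0 y ->
      F x y -> le R x x1 -> le R x1 y1 -> le R y1 y -> F x1 y1].

Definition trans_on (P : set C) F :=
  forall x y z, P x -> P y -> P z -> F x y -> F y z -> F x z.

Definition semi A x0 R a (Y : C -> Prop) := [/\ same A x0 a, D1 (A `|` [set a]) Y,
  convex_in (same A x0) R (same A x0 `&` Y), Y a
  & forall x, same A x0 x -> Y x -> le R a x].

Definition det A x0 R a (Y : C -> Prop) := exists E,
  [/\ D2 A E, equivalence_on (same A x0) E
    & forall x, same A x0 x -> Y x <-> E a x /\ le R a x].

(* With [S x] the translate of the semiinterval to [x], the relation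
   [F x z := exists s <= x, S s z] is definable and monotone; when it is transitive,
   [F] or its converse is the required equivalence relation. *)
Lemma semi_det A x0 R a Y : small K A -> wo_order A x0 R -> semi A x0 R a Y ->
  (forall F, mono_rel A x0 R F -> trans_on (same A x0) F) -> det A x0 R a Y.
Proof.
move=> sA [hR lin hfin] [Pa hY cY Ya geY] htr.
have [Psi hPsi ePsi] := D1_split1 hY.
set P := same A x0.
have hle : D2 A (le R) by rewrite /le; dtac.
have Paut g x : aut A g -> P x -> P (g x).
  by move=> ga Px; exact: same_trans Px (same_aut ga).
have P0 : P x0 := @same_refl _ _ A x0.
have [irr tr tot] := lin.
have letr x y z : P x -> P y -> P z -> le R x y -> le R y z -> le R x z.
  exact: le_trans_on lin x y z.
have cnj s : P s -> exists2 g, aut A g & g a = s /\ exists2 h, aut A h &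
    cancel g h /\ cancel h g.
  move=> Ps; have [g ga gs] := AUT hC sA (same_trans (same_sym Pa) Ps).
  by have [h ha gh] := aut_inv ga; exists g => //; split=> //; exists h.
have Psi_refl s : P s -> Psi s s.
  move=> Ps; have [g ga [gs _]] := cnj s Ps.
  by rewrite -gs -(D2_aut a a hPsi ga) -ePsi.
have Psi_le s x : P s -> P x -> Psi x s -> le R s x.
  move=> Ps Px; have [g ga [gs [h ha [gh hg]]]] := cnj s Ps.
  rewrite -gs -(hg x) -(D2_aut (h x) a hPsi ga) -ePsi -(D2_aut a (h x) hle ga).
  exact: geY (Paut _ _ ha Px).
have Psi_conv s x m z : P s -> P x -> P m -> P z -> Psi x s -> le R x m ->
    le R m z -> Psi z s -> Psi m s.
  move=> Ps Px Pm Pz; have [g ga [gs [h ha [gh hg]]]] := cnj s Ps.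
  rewrite -gs -(hg x) -(hg m) -(hg z) -!(D2_aut _ a hPsi ga) -!ePsi.
  rewrite -!(D2_aut _ _ hle ga) => Yx [<-//|xm] [->//|mz] Yz.
  have [_ c] := cY.
  by have [] := c (h x) (h m) (h z) (conj (Paut _ _ ha Px) Yx) (Paut _ _ ha Pm)
    (conj (Paut _ _ ha Pz) Yz) xm mz.
pose F x z := le R x z /\ exists2 s, P s & le R s x /\ Psi z s.
have Fle x y : F x y -> le R x y by case.
have Fmono x x1 y1 y : P x -> P x1 -> P y1 -> P y ->
    F x y -> le R x x1 -> le R x1 y1 -> le R y1 y -> F x1 y1.
  move=> Px Px1 Py1 Py [xy [s Ps [sx sy]]] xx1 x1y1 y1y; split=> //.
  exists s => //; split; first exact: letr Ps Px Px1 sx xx1.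
  apply: (Psi_conv s s y1 y) => //; first exact: Psi_refl.
  exact: letr Ps Px Py1 sx (letr _ _ _ Px Px1 Py1 xx1 x1y1).
have Frefl x : P x -> F x x.
  by move=> Px; split; [left | exists x => //; split; [left | exact: Psi_refl]].
have Faut g x y : P x -> P y -> aut A g -> F x y -> F (g x) (g y).
  move=> Px Py ga [xy [s Ps [sx sy]]]; split; first by rewrite -(D2_aut x y hle ga).
  exists (g s); first exact: Paut.
  by rewrite -(D2_aut s x hle ga) -(D2_aut y s hPsi ga).
(* The starting points of translates containing [z] form a finite union of convex sets; a point [s1]
   of its first piece absorbs the quantifier over [P], and [F] becomes definable. *)
have first z : P z -> exists s1, [/\ P s1, Psi z s1 &
    forall x, P x -> F x z <-> le R x z /\ (le R s1 x \/ Psi z x)].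
  move=> Pz.
  have [||s1 [Ps1 Gs1] hs1] := fconv_first lin (hfin (Psi z) _).
  - by dtac.
  - by exists z; split=> //; exact: Psi_refl.
  exists s1; split=> // x Px; split.
    move=> [xz [s Ps [sx sz]]]; split=> //.
    case: (pselect (le R s1 x)) => h; first by left.
    right; have xs1 : le R x s1.
      by case: (tot s1 x Ps1 Px) => [h'|h'|h']; [case: h; right|case: h; left|right].
    by have [] := hs1 s x (conj Ps sz) (letr _ _ _ Ps Px Ps1 sx xs1) Px sx xs1.
  by move=> [xz [h|h]]; split=> //; [exists s1 | exists x => //; split=> //; left].
have [Phi hPhi ePhi] : exists2 Q, D2 A Q & forall x y, P x -> P y -> F x y <-> Q x y.
  apply: (DINV2 hC sA) => //.
    by move=> x y g Px Py ga; exact: Faut.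
  have [s1 [Ps1 _ hs1]] := first x0 P0.
  exists (fun x => le R x x0 /\ (le R s1 x \/ Psi x0 x)).
    by dtac.
  by move=> x Px; exact: hs1.
have mF : mono_rel A x0 R Phi.
  split=> //.
  - by move=> x y Px Py /(ePhi _ _ Px Py)/Fle.
  - by move=> x Px; apply/ePhi => //; exact: Frefl.
  - move=> x x1 y1 y Px Px1 Py1 Py /(ePhi _ _ Px Py) Fxy h1 h2 h3.
    by apply/(ePhi _ _ Px1 Py1); exact: Fmono Fxy h1 h2 h3.
have Ftr x y z : P x -> P y -> P z -> F x y -> F y z -> F x z.
  move=> Px Py Pz /(ePhi _ _ Px Py) h1 /(ePhi _ _ Py Pz) h2.
  by apply/(ePhi _ _ Px Pz); exact: htr mF x y z Px Py Pz h1 h2.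
have [s1 [Ps1 Gs1 hs1]] := first x0 P0.
(* Since [x0] lies in the translate at [s1], transitivity gives [F x x0]. So either [x = s1], or
   [x0] lies in the translate at [x], and by convexity [s1] does. *)
have key x : P x -> F x s1 -> Psi s1 x.
  move=> Px Fx; have xs1 := Fle _ _ Fx.
  have s1z : F s1 x0.
    by split; [exact: Psi_le | exists s1 => //; split=> //; left].
  have /(hs1 x Px)[_ [s1x|zx]] := Ftr _ _ _ Px Ps1 P0 Fx s1z.
    have -> : x = s1.
      case: xs1 s1x => // h [->//|h']; case: (irr s1 Ps1); exact: tr h' h.
    exact: Psi_refl.
  apply: (Psi_conv x x s1 x0) => //; first exact: Psi_refl.
  exact: Fle.
have key2 x y : P x -> P y -> F x y -> Psi y x.
  move=> Px Py Fxy; have [g ga gy] := AUT hC sA (same_trans (same_sym Py) Ps1).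
  rewrite (D2_aut y x hPsi ga) gy; apply: key; first exact: Paut.
  by rewrite -gy; exact: Faut.
exists (fun x y => Phi x y \/ Phi y x); split.
- by dtac.
- split.
  + by move=> x Px; left; apply/ePhi => //; exact: Frefl.
  + by move=> x y _ _ [?|?]; [right|left].
  + move=> x y z Px Py Pz.
    rewrite -!ePhi //.
    have lt_or u v : P u -> P v -> le R u v \/ le R v u.
      by move=> Pu Pv; case: (tot u v Pu Pv) => h; [left; right|left; left|right; right].
    move=> [xy|yx] [yz|zy].
    * by left; exact: Ftr xy yz.
    * case: (lt_or x z Px Pz) => h; [left|right].
        by apply: (Fmono x x z y) => //; [left | exact: Fle].
      by apply: (Fmono z z x y) => //; [left | exact: Fle].
    * case: (lt_or x z Px Pz) => h; [left|right].
        by apply: (Fmono y x z z) => //; [exact: Fle | left].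
      by apply: (Fmono y z x x) => //; [exact: Fle | left].
    * by right; exact: Ftr zy yx.
- move=> x Px; rewrite ePsi -!ePhi //; split.
    move=> h; have ax := Psi_le _ _ Pa Px h.
    by split=> //; left; split=> //; exists a => //; split=> //; left.
  move=> [[Fax|Fxa] ax]; first exact: key2.
  have -> : x = a.
    case: ax (Fle _ _ Fxa) => [->//|h] [//|h']; case: (irr a Pa); exact: tr h h'.
  exact: Psi_refl.
Qed.


Section OrderSemiintervals.
Context (lt : C -> C -> Prop) (hlt : wqo_order lt).

Lemma wo_lt A x0 : wo_order A x0 lt.
Proof.
split; [exact: ltD_ | exact: lt_lin | move=> X hX].
by apply: (finconv hlt) hX; exact: zhom_same.
Qed.

(* Invariance under automorphisms fixing [A] and [a]: otherwise [Y] and its complement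
   would alternate along the iterates of [b]. *)
Lemma semi_ex A x0 a b Y : small K A -> same A x0 a -> same A x0 b -> le lt a b ->
  D1 (A `|` [set a]) Y -> Y b -> exists2 S, semi A x0 lt a S &
  forall x, same A x0 x -> S x <-> le lt a x /\ (le lt x b \/
    forall s, same A x0 s -> le lt b s -> le lt s x -> Y s).
Proof.
move=> sA Pa Pb ab hY Yb; set P := same A x0.
pose S x := le lt a x /\ (le lt x b \/
    forall s, P s -> le lt b s -> le lt s x -> Y s).
have Sb : S b by split=> //; left; left.
have hYT : D1 setT Y by apply: Def_mono hY.
have hle := leD hlt setT; have hltT := ltD_ hlt setT.
have zP : zhom P := @zhom_same _ _ A x0.
have AA : A `<=` A `|` [set a] by move=> ?; left.
have sAa := small_add1 (nat_lt_K hC) a sA.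
(* The quantifier over [P] in [S] is avoided with a point [s1] in the first convex piece of the
   complement of [Y] beyond [b]. *)
have [S1 hS1 eS1] : exists2 S1, D1 setT S1 & forall x, P x -> S x <-> S1 x.
  case: (pselect (exists s, [/\ P s, le lt b s & ~ Y s])) => [[s2 [Ps2 bs2 Ns2]]|no].
    have [||s1 [Ps1 [bs1 Ns1]] hs1] := fconv_first (lt_lin hlt P)
      (finconv hlt (X := fun s => le lt b s /\ ~ Y s) zP _).
    - by dtac.
    - by exists s2.
    exists (fun t => le lt a t /\ (le lt t b \/ (lt t s1 /\ Y t))).
      by dtac.
    move=> t Pt; split=> -[at_ ht]; split=> //; case: ht => [|h]; [by left| |by left|right].
      case: (pselect (le lt t b)) => [tb|/(notle hlt) bt]; [by left|right].
      split; last by apply: h => //; [right | left].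
      by apply: (notle hlt) => s1t; apply: Ns1; exact: h.
    move=> s Ps bs st; apply: contrapT => nYs; case: h => ts1 Yt.
    by have [_ [_ /(_ Yt)]] := hs1 s t (conj Ps (conj bs nYs))
      (or_intror (le_lt_tr hlt st ts1)) Pt st (or_intror ts1).
  exists (le lt a); first by dtac.
  move=> t Pt; split=> [[]//|at_]; split=> //; right=> s Ps bs _.
  by apply: contrapT => nYs; apply: no; exists s.
have SconvP x y : P x -> P y -> le lt a x -> le lt x y -> S y -> S x.
  move=> Px Py ax xy [_ [yb|h]]; split=> //; first by left; exact: le_tr xy yb.
  by right=> s Ps bs sx; apply: h => //; exact: le_tr sx xy.
have Sinv g x : aut (A `|` [set a]) g -> P x -> S x -> S (g x).
  move=> ga Px Sx; have gA := aut_mono AA ga.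
  have Paut z : P z -> P (g z) by move=> Pz; exact: same_trans Pz (same_aut gA).
  have ga_ : g a = a by have [_ ->] := ga; last right.
  have agx : le lt a (g x) by rewrite -ga_ -(aut_le hlt _ _ ga); case: Sx.
  split=> //; apply: contrapT => /not_orP[/(notle hlt) bgx /existsNP[s]].
  move=> /not_implyP[Ps /not_implyP[bs /not_implyP[sgx nYs]]].
  have {}bs : lt b s by case: bs => // e; case: nYs; rewrite -e.
  case: (pselect (le lt (g b) s)) => [gbs|/(notle hlt) sgb]; last first.
    exact: (alternation hlt zP hY ga Paut Pb Ps bs sgb).
  have [h ha [gh hg]] := aut_inv ga.
  have Phs : P (h s) by exact: same_trans Ps (same_aut (aut_mono AA ha)).
  have bhs : le lt b (h s) by rewrite (aut_le hlt _ _ ga) hg.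
  have hsx : le lt (h s) x by rewrite (aut_le hlt _ _ ga) hg.
  apply: nYs; rewrite -(hg s) -(D1_aut (h s) hY ga).
  case: Sx => _ [xb|]; last by apply.
  by rewrite (le_anti hlt (le_tr hlt hsx xb) bhs).
have [||||S2 hS2 eS2] := @DINV _ _ _ _ hC (A `|` [set a]) (locus A x0) S1 sAa.
- by move=> X [hX _]; exact: Def_mono hX.
- exact: locus_directed.
- exact: hS1.
- move=> g x ga /locusP Px /(eS1 _ Px) Sx.
  by apply/eS1; [exact: same_trans Px (same_aut (aut_mono AA ga)) | exact: Sinv].
have eS x : P x -> S2 x <-> S x by move=> Px; rewrite eS1 // -eS2 //; exact/locusP.
exists S2 => //; split=> //.
- split=> [x []//|x y z [Px Sx] Py [Pz Sz] xy yz]; split=> //.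
  apply/eS => //; move/(eS x Px): Sx => [ax _]; move/(eS z Pz): Sz.
  by apply: SconvP => //; [exact: le_tr ax (or_intror xy) | right].
- by apply/eS => //; apply: SconvP Sb => //; left.
- by move=> x Px /(eS x Px)[].
Qed.

Definition ceq A x0 E := [/\ D2 A E, equivalence_on (same A x0) E &
  forall x y z, same A x0 x -> same A x0 y -> same A x0 z -> E x z ->
    le lt x y -> le lt y z -> E x y].

Lemma ceq_inv A x0 E x y : ceq A x0 E -> forall g, aut A g -> E x y <-> E (g x) (g y).
Proof. by move=> [hE _ _] g; exact: D2_aut. Qed.

(** Conjugation brings two witnesses of incomparability to a common point [a]. If their other ends
    [b] and [d] are on the same side, the nearer one lies in both classes of [a]. If not, the pair
    for [E] is moved to start at [d], where it points back towards [a]. *)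
Lemma ceq_chain A x0 E E' : small K A -> ceq A x0 E -> ceq A x0 E' ->
  (forall x y, same A x0 x -> same A x0 y -> E x y -> E' x y) \/
  (forall x y, same A x0 x -> same A x0 y -> E' x y -> E x y).
Proof.
move=> sA cE cE'; have [_ [_ sy tr] conv] := cE; have [_ [_ sy' tr'] conv'] := cE'.
set P := same A x0.
apply: contrapT => /not_orP[/existsNP[a /existsNP[b]]].
move=> /not_implyP[Pa /not_implyP[Pb /not_implyP[Eab nE'ab]]].
move=> /existsNP[c /existsNP[d]].
move=> /not_implyP[Pc /not_implyP[Pd /not_implyP[E'cd nEcd]]].
have [g ga gc] := AUT hC sA (same_trans (same_sym Pc) Pa).
have Pgd : P (g d) := same_trans Pd (same_aut ga).
move: E'cd nEcd; rewrite (ceq_inv c d cE' ga) (ceq_inv c d cE ga) gc.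
move: (g d) Pgd => {g ga gc c d Pc Pd} d Pd E'ad nEad.
have [h ha hd] := AUT hC sA (same_trans (same_sym Pa) Pd).
have Phb : P (h b) := same_trans Pb (same_aut ha).
have Edhb : E d (h b) by rewrite -hd -(ceq_inv a b cE ha).
have nE'dhb : ~ E' d (h b) by rewrite -hd -(ceq_inv a b cE' ha).
have cE_ x y z : P x -> P y -> P z -> E x z -> le lt x y -> le lt y z -> E z y.
  by move=> Px Py Pz xz xy yz; apply: (tr z x y) => //; [exact: sy | exact: conv xz xy yz].
have cE'_ x y z : P x -> P y -> P z -> E' x z -> le lt x y -> le lt y z -> E' z y.
  by move=> Px Py Pz xz xy yz; apply: (tr' z x y) => //; [exact: sy' | exact: conv' xz xy yz].
have Eba := sy _ _ Pa Pb Eab; have E'da := sy' _ _ Pa Pd E'ad.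
have Ehbd := sy _ _ Pd Phb Edhb.
case: (lt_tot hlt a b) => [ab|e|ba]; last 2 first.
- by case: nE'ab; rewrite -e; have [_ [rf _ _] _] := cE'; exact: rf.
- have had : lt (h b) d by rewrite -hd -(aut_lt hlt _ _ ha).
  case: (lt_tot hlt d a) => [da|e|ad].
  + case: (pselect (le lt b d)) => [bd|/(notle hlt) db].
      by apply: nEad; exact: (cE_ b d a Pb Pd Pa Eba bd (or_intror da)).
    by apply: nE'ab; exact: (cE'_ d b a Pd Pb Pa E'da (or_intror db) (or_intror ba)).
  + by apply: nEad; rewrite e; have [_ [rf _ _] _] := cE; exact: rf.
  + case: (pselect (le lt a (h b))) => [ahb|/(notle hlt) hba].
      by apply: nE'dhb; exact: (cE'_ a (h b) d Pa Phb Pd E'ad ahb (or_intror had)).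
    apply: nEad; apply: (sy _ _ Pd Pa).
    exact: (cE_ (h b) a d Phb Pa Pd Ehbd (or_intror hba) (or_intror ad)).
have had : lt d (h b) by rewrite -{1}hd -(aut_lt hlt _ _ ha).
case: (lt_tot hlt d a) => [da|e|ad].
- case: (pselect (le lt (h b) a)) => [hba|/(notle hlt) ahb].
    by apply: nE'dhb; exact: (conv' d (h b) a Pd Phb Pa E'da (or_intror had) hba).
  apply: nEad; apply: (sy _ _ Pd Pa).
  exact: (conv d a (h b) Pd Pa Phb Edhb (or_intror da) (or_intror ahb)).
- by apply: nEad; rewrite e; have [_ [rf _ _] _] := cE; exact: rf.
- case: (pselect (le lt d b)) => [db|/(notle hlt) bd].
    by apply: nEad; exact: (conv a d b Pa Pd Pb Eab (or_intror ad) db).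
  by apply: nE'ab; exact: (conv' a b d Pa Pb Pd E'ad (or_intror ab) (or_intror bd)).
Qed.

Definition nobad A x0 R := forall F, mono_rel A x0 R F -> trans_on (same A x0) F.

Lemma det_ceq A x0 a Y E : small K A -> semi A x0 lt a Y -> D2 A E ->
  equivalence_on (same A x0) E ->
  (forall x, same A x0 x -> Y x <-> E a x /\ le lt a x) -> ceq A x0 E.
Proof.
move=> sA [Pa hY [_ cY] Ya geY] hE eE h; split=> // x y z Px Py Pz Exz xy yz.
have [g ga gx] := AUT hC sA (same_trans (same_sym Px) Pa).
have Pg u : same A x0 u -> same A x0 (g u).
  by move=> Pu; exact: same_trans Pu (same_aut ga).
have le_g u v : le lt u v -> le lt (g u) (g v) by rewrite (aut_le hlt _ _ ga).
case: xy => [<-|xy]; first by have [rf _ _] := eE; exact: rf.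
case: yz => [->//|yz].
have lt_g u v : lt u v -> lt (g u) (g v) by rewrite (aut_lt hlt _ _ ga).
rewrite (D2_aut x y hE ga) gx; apply: (proj1 (iffLR (h (g y) (Pg _ Py)) _)).
have Yz : Y (g z).
  apply/(h (g z) (Pg _ Pz)); rewrite -gx -(D2_aut x z hE ga); split=> //.
  by right; apply: lt_g; exact: lt_tr xy yz.
have agy : lt a (g y) by rewrite -gx; exact: lt_g.
by have [] := cY a (g y) (g z) (conj Pa Ya) (Pg _ Py) (conj (Pg _ Pz) Yz) agy (lt_g _ _ yz).
Qed.

(** For [u] below [v], the part of [W] adjacent to [u] on the right, filled up down to [a], is a
    semiinterval that does not reach [v], and [nobad] makes it determined by an equivalence
    relation. *)
Lemma separate A x0 a u v W : small K A -> nobad A x0 lt ->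
  same A x0 a -> same A x0 u -> same A x0 v -> lt a u -> lt a v ->
  D1 (A `|` [set a]) W -> W u -> ~ W v ->
  exists2 E, ceq A x0 E & (E a u /\ ~ E a v) \/ (~ E a u /\ E a v).
Proof.
move=> sA nb Pa; wlog : u v W / lt u v.
  move=> H Pu Pv au av hW Wu nWv; case: (lt_tot hlt u v) => [uv|e|vu].
  - exact: (H u v W).
  - by case: nWv; rewrite -e.
  - have [|//|E cE h] := H v u (fun x => ~ W x) vu Pv Pu av au _ nWv.
      exact: Def_not.
    by exists E => //; case: h => -[? ?]; [right|left].
move=> uv Pu Pv au av hW Wu nWv.
have [S sS eS] := semi_ex sA Pa Pu (or_intror au) hW Wu.
have [E [hE eE h]] := semi_det sA (wo_lt A x0) sS nb.
exists E; first exact: det_ceq sA sS hE eE h.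
left; split.
  by apply: (proj1 (iffLR (h u Pu) _)); apply/eS => //; split; [right|left; left].
move=> Eav; have /(eS v Pv)[_ [vu|]] : S v by apply/h => //; split=> //; right.
  exact: (le_gtF hlt vu uv).
by move=> /(_ v Pv (or_intror uv) (or_introl erefl)).
Qed.

End OrderSemiintervals.

End Semiintervals.

(** * From the given order to all weakly o-minimal pairs *)

Section Reduction.
Context (L : language) (T : theory L) (K : Type) (C : structure L).
Context (hC : monster K T C).
Implicit Types (A B : set C) (R F E : C -> C -> Prop).
Context (lt : C -> C -> Prop) (hlt : wqo_order lt).
Local Notation gt := (fun x y => lt y x).
Let hgt : wqo_order gt := wqo_order_rev hlt.

Lemma le_rev x y : le gt x y <-> le lt y x.
Proof. by split=> -[->|?]; [left|right|left|right]. Qed.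

Lemma ceq_rev A x0 E : ceq gt A x0 E -> ceq lt A x0 E.
Proof.
move=> [hE [rf sy tr] cv]; split=> // x y z Px Py Pz xz xy yz.
have zy : E z y by apply: (cv z y x) => //; [exact: sy | exact/le_rev | exact/le_rev].
exact: tr xz zy.
Qed.

Definition same_side a u v := (lt a u /\ lt a v) \/ (lt u a /\ lt v a).

Lemma separate_side A x0 a u v W : small K A -> nobad A x0 lt -> nobad A x0 gt ->
  same A x0 a -> same A x0 u -> same A x0 v -> same_side a u v ->
  D1 (A `|` [set a]) W -> W u -> ~ W v ->
  exists2 E, ceq lt A x0 E & (E a u /\ ~ E a v) \/ (~ E a u /\ E a v).
Proof.
move=> sA nl ng Pa Pu Pv [[au av]|[ua va]] hW Wu nWv.
  exact: (separate hC hlt sA nl Pa Pu Pv au av hW Wu nWv).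
have [E cE h] := separate hC hgt sA ng Pa Pu Pv ua va hW Wu nWv.
by exists E => //; exact: ceq_rev.
Qed.

(* If [F x y], [F y z] and not [F x z], then each of the three points is separated
   from another one by a convex equivalence relation; convex equivalence relations
   form a chain, which is impossible. *)
Lemma nobad_any A x0 R : small K A -> nobad A x0 lt -> nobad A x0 gt ->
  wo_order A x0 R -> nobad A x0 R.
Proof.
move=> sA nl ng [hR [irr tr tot] _] F [hF Fle Frf Fmono] x y z Px Py Pz xy yz.
apply: contrapT => nxz.
have Rxy := Fle x y Px Py xy; have Ryz := Fle y z Py Pz yz.
have {Rxy}Rxy : R x y by case: Rxy => // e; case: nxz; rewrite e.
have {Ryz}Ryz : R y z by case: Ryz => // e; case: nxz; rewrite -e.
have sub c : A `<=` A `|` [set c] by move=> ?; left.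
have rf E (cE : ceq lt A x0 E) u : same A x0 u -> E u u.
  by have [_ [h _ _] _] := cE; exact: h.
have sy E (cE : ceq lt A x0 E) u v : same A x0 u -> same A x0 v -> E u v -> E v u.
  by have [_ [_ h _] _] := cE; exact: h.
have tr' E (cE : ceq lt A x0 E) u v w : same A x0 u -> same A x0 v -> same A x0 w ->
    E u v -> E v w -> E u w.
  by have [_ [_ _ h] _] := cE; exact: h.
have cv E (cE : ceq lt A x0 E) u v w : same A x0 u -> same A x0 v -> same A x0 w ->
    E u w -> le lt u v -> le lt v w -> E u v.
  by have [_ _ h] := cE; exact: h.
(* a class containing [u] and [v] but not [w] lies on one side of [w] *)
have side E u v w : ceq lt A x0 E -> same A x0 u -> same A x0 v -> same A x0 w ->
    E u v -> ~ E u w -> same_side w u v.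
  move=> cE Pu Pv Pw uv nuw.
  have nwv : ~ E v w by move=> vw; apply: nuw; exact: (tr' E cE u v w).
  have vu := sy E cE u v Pu Pv uv.
  case: (lt_tot hlt u w) => [h|e|h]; [right|by case: nuw; rewrite e; exact: rf|left];
    split=> //; apply: (notle hlt) => h'.
    by apply: nuw; apply: (cv E cE u w v) => //; right.
  by apply: nwv; apply: (cv E cE v w u) => //; right.
(* A relation separating [u] from [v] at [w] is comparable with [E]: if coarser, it cannot
   distinguish [u] from [v]; if finer, it puts [w] into their class. *)
have inner E u v w : ceq lt A x0 E -> same A x0 u -> same A x0 v -> same A x0 w ->
    E u v -> ~ E u w -> forall W, D1 (A `|` [set w]) W -> W u -> ~ W v -> False.
  move=> cE Pu Pv Pw uv nuw W hW Wu nWv.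
  have nwv : ~ E v w by move=> vw; apply: nuw; exact: (tr' E cE u v w).
  have vu := sy E cE u v Pu Pv uv.
  have [E' cE' h] := separate_side sA nl ng Pw Pu Pv (side E u v w cE Pu Pv Pw uv nuw)
    hW Wu nWv.
  have [EE'|E'E] := ceq_chain hC hlt sA cE cE'.
    have uv' := EE' u v Pu Pv uv; have vu' := EE' v u Pv Pu vu.
    case: h => -[h1 h2].
      by apply: h2; exact: (tr' E' cE' w u v).
    by apply: h1; exact: (tr' E' cE' w v u).
  case: h => -[h1 h2].
    by apply: nuw; apply: (sy E cE w u) => //; exact: E'E.
  by apply: nwv; apply: (sy E cE w v) => //; exact: E'E.
have A1 E : ceq lt A x0 E -> E x y -> ~ E x z -> False.
  move=> cE Exy nExz.
  apply: (inner E y x z cE Py Px Pz (sy _ cE _ _ Px Py Exy) _ (F^~ z)) => //.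
  - by move=> yz'; apply: nExz; exact: tr' cE _ _ _ Px Py Pz Exy yz'.
  - exact: D2_at1.
have A2 E : ceq lt A x0 E -> E y z -> ~ E y x -> False.
  move=> cE Eyz nEyx.
  apply: (inner E y z x cE Py Pz Px Eyz nEyx (F x)) => //.
  by dtac; right.
case: (pselect (same_side y x z)) => [s|ns].
  have [|//||E cE [[yx nyz]|[nyx yz']]] := separate_side (W := R^~ y) sA nl ng Py Px Pz s.
  - exact: D2_at1.
  - by move=> zy; apply: (irr z Pz); exact: tr zy Ryz.
  - have xy' := sy _ cE _ _ Py Px yx.
    by apply: (A1 E cE xy') => xz; apply: nyz; exact: tr' cE _ _ _ Py Px Pz yx xz.
  - exact: A2 E cE yz' nyx.
have neq u v : same A x0 u -> R u v -> u <> v by move=> Pu uv e; apply: (irr u Pu); rewrite {2}e.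
have s : same_side x y z.
  case: (lt_tot hlt x y) => [h|e|h]; last 2 first.
  - by case: (neq x y Px Rxy).
  - right; split=> //; case: (lt_tot hlt z y) => [h'|e|h'].
    + exact: (lt_tr hlt h' h).
    + by case: (neq y z Py Ryz).
    + by case: ns; left.
  left; split=> //; case: (lt_tot hlt y z) => [h'|e|h'].
  + exact: (lt_tr hlt h h').
  + by case: (neq y z Py Ryz).
  + by case: ns; right.
have [|//|//|E cE [[xy' nxz']|[nxy xz]]] := separate_side (W := F x) sA nl ng Px Py Pz s.
- by dtac; right.
- exact: A1 E cE xy' nxz'.
- have [yz_|zy_] : same_side y x z \/ (lt x y /\ lt y z) \/ (lt z y /\ lt y x).
    case: (lt_tot hlt x y) => [h|e|h]; [|by case: (neq x y Px Rxy)|];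
    case: (lt_tot hlt y z) => [h'|e|h'].
    + by right; left.
    + by case: (neq y z Py Ryz).
    + by left; right.
    + by left; left.
    + by case: (neq y z Py Ryz).
    + by right; right.
  + by case: ns.
  case: zy_ => -[h1 h2].
    by apply: nxy; apply: (cv E cE x y z) => //; right.
  apply: nxy; apply: (tr' E cE x z y) => //.
  by apply: (cv E cE z y x) => //; [exact: sy | right | right].
Qed.

(** Simplicity quantifies over all orders on the type; [nobad_any] reduces them to [lt] and its
    reverse, and [semi_det] applies to each. *)
Lemma simple_of_nobad :
  (forall A x0, small K A -> nobad A x0 lt /\ nobad A x0 gt) ->
  has_simple_semiintervals K C.
Proof.
move=> nb p _ B q sB _ cq _ R [_ /rel_definable_binary[Q hQ eQ] [irr tr tot] hfin].
move=> a S [[SP cS] Sa geS /rel_definable_unary[Y hY eS]].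
have qa : realizations q a by exact: SP.
have PE := complete_type_locus cq qa.
have RQ x y : same B a x -> same B a y -> R x y <-> Q x y.
  by move=> /PE Px /PE Py; rewrite eQ; split=> [[]|].
have Q_le x y : same B a x -> same B a y -> (x = y \/ R x y) <-> le Q x y.
  by move=> Px Py; rewrite /le RQ.
have lin : linear_order_on (same B a) Q.
  split=> [x Px|x y z Px Py Pz|x y Px Py].
  - by rewrite -RQ //; apply: irr; exact/PE.
  - by rewrite -!RQ // ; apply: tr; exact/PE.
  - have [||h|h|h] := tot x y; try exact/PE.
    + by apply: Or31; rewrite -RQ.
    + exact: Or32.
    + by apply: Or33; rewrite -RQ.
have cvx S' : convex_in (realizations q) R S' -> convex_in (same B a) Q S'.
  move=> [s c]; split=> [x /s/PE//|x y z Sx Py Sz].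
  have Px : same B a x by exact/PE/s.
  have Pz : same B a z by exact/PE/s.
  by rewrite -!RQ //; apply: c => //; exact/PE.
have wo : wo_order B a Q.
  split=> // X hX.
  have [|n [f [cf ef]]] := hfin (realizations q `&` X).
    by apply/rel_definable_unary; exists X.
  exists [seq f i | i <- enum 'I_n]; split.
    by move=> S' /List.in_map_iff[i [<- _]]; apply: cvx; exact: cf.
  move=> x; split.
    move=> [/PE qx Xx]; have : (realizations q `&` X) x by [].
    rewrite ef => -[i _ fx]; exists (f i) => //; apply/List.in_map_iff.
    exists i; split=> //; have := mem_enum 'I_n i; rewrite inE.
    elim: (enum 'I_n) => //= j s IH; rewrite inE => /orP[/eqP->|/IH]; by [left|right].
  move=> [S' /List.in_map_iff[i [<- _]] fx].
  have : (realizations q `&` X) x by rewrite ef; exists i.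
  by move=> [/PE].
have sm : semi B a Q a Y.
  have PY x : (same B a `&` Y) x <-> S x.
    by rewrite eS; split=> -[/PE].
  split=> //.
  - have -> : same B a `&` Y = S by apply/seteqP; split=> x /PY.
    exact: cvx.
  - by move: Sa; rewrite eS => -[].
  - move=> x Px Yx; apply/Q_le => //.
    by apply: geS; apply/PY.
have [nl ng] := nb B a sB.
have [E [hE [rf sy tr_] eE]] := semi_det hC sB wo sm (nobad_any sB nl ng wo).
exists (fun x y => [/\ same B a x, same B a y & E x y]).
  split.
    apply/rel_definable_binary; exists E => // x y.
    by split=> -[/PE ? /PE ? ?].
  split=> [x /PE Px|x y /PE Px /PE Py [_ _ xy]|x y z /PE Px /PE Py /PE Pz [_ _ xy] [_ _ yz]].
  - by split=> //; exact: rf.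
  - by split=> //; exact: sy.
  - by split=> //; exact: tr_ xy yz.
apply/seteqP; split=> x /=.
  rewrite eS => -[/PE Px Yx]; have [Eax ax] := iffLR (eE x Px) Yx.
  by split; [split=> // | apply/(Q_le a x (@same_refl _ _ B a) Px)].
move=> [[_ Px Eax] ax]; rewrite eS; split; first exact/PE.
by apply/eE => //; split=> //; apply/(Q_le a x (@same_refl _ _ B a) Px).
Qed.

End Reduction.

(** * Counting countable models *)

Lemma countable_injfun (D : Type) (A : set D) : countable A ->
  exists f : D -> nat, forall x y, A x -> A y -> f x = f y -> x = y.
Proof. by move=> /(le_inj 0)[f _ fi]; exists f. Qed.

Lemma map_enum_inj (n : nat) (D D' : Type) (e : D -> D') (f g : 'I_n -> D) :
  [seq e (f i) | i <- enum 'I_n] = [seq e (g i) | i <- enum 'I_n] ->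
  forall i, e (f i) = e (g i).
Proof.
by move=> /eq_in_map h i; apply: h; rewrite mem_enum.
Qed.

Section CountableLanguage.
Context (L : language) (hL : countable_language L).
Local Notation tree := (GenTree.tree nat).

Lemma term_code : exists c : forall n, term L n -> tree, forall n, injective (@c n).
Proof.
have [/countable_injfun[cf fi] _] := hL.
pose fix c n (t : term L n) : tree := match t with
  | Var i => GenTree.Leaf (i : nat)
  | App f ts => GenTree.Node (cf f) [seq c n (ts j) | j <- enum 'I_(fun_arity f)]
  end.
exists c => n; elim=> [i|f ts IH] [j|g us] //=.
  by move=> [/val_inj->].
move=> [/(fi f g I I) e]; case: g / e us => us /(@map_enum_inj _ _ _ (c n)) h.
by congr App; apply/funext => j; apply: IH.
Qed.

Lemma formula_code : exists c : forall n, formula L n -> tree,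
  forall n, injective (@c n).
Proof.
have [_ /countable_injfun[cr ri]] := hL; have [ct ti] := term_code.
pose fix c n (phi : formula L n) : tree := match phi with
  | Bot => GenTree.Node 0 [::]
  | Eq t u => GenTree.Node 1 [:: ct n t; ct n u]
  | Rel r ts => GenTree.Node 2 (GenTree.Leaf (cr r) ::
      [seq ct n (ts j) | j <- enum 'I_(rel_arity r)])
  | Imp a b => GenTree.Node 3 [:: c n a; c n b]
  | All a => GenTree.Node 4 [:: c n.+1 a]
  end.
exists c => n; elim=> {n} [n|n t u|n r ts|n a IHa b IHb|n a IHa] [|t' u'|r' ts'|a' b'|a'] //=.
- by move=> [/ti-> /ti->].
- move=> [/(ri r r' I I) e]; case: r' / e ts' => ts' /(@map_enum_inj _ _ _ (ct n)) h.
  by congr Rel; apply/funext => j; apply: ti.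
- by move=> [/IHa-> /IHb->].
- by move=> [/IHa->].
Qed.

Lemma Def_countable (C : structure L) (E : set C) : countable E ->
  countable [set X | Def E X].
Proof.
move=> /countable_injfun[ce ei]; have [c ci] := formula_code.
pose cu (s : nat + C) : nat + nat := match s with inl k => inl k | inr x => inr (ce x) end.
have cui s s' : okp E s -> okp E s' -> cu s = cu s' -> s = s'.
  by case: s s' => [k|x] [k'|x'] //= ? ? [] => [->//|/ei->].
pose code X (k : nat) := exists n (phi : formula L n) (u : 'I_n -> nat + C),
  [/\ forall i, okp E (u i), forall v, X v <-> sat phi (tmv v \o u)
    & k = pickle (n, c n phi, [seq cu (u i) | i <- enum 'I_n])].
have [f hf] : exists f : ((nat -> C) -> Prop) -> nat, forall X, Def E X -> code X (f X).
  suff : forall X, exists k, Def E X -> code X k by move=> /choice[f hf]; exists f.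
  move=> X; case: (pselect (Def E X)) => [|]; last by exists 0.
  by move=> [n [phi [u [hu h]]]]; eexists=> _; exists n, phi, u; split.
apply: (@inj_le _ _ _ _ f) => // X Y hX hY e.
have [n [phi [u [hu h ek]]]] := hf X hX; have [n' [phi' [u' [hu' h' ek']]]] := hf Y hY.
move: e; rewrite ek ek' => /(pcan_inj pickleK_inv)[].
move=> en; case: n' / en phi' u' hu' h' {ek'} => phi' u' hu' h' /ci e.
rewrite -{phi'}e in h' *; move=> /(@map_enum_inj _ _ _ cu) eu.
have {}eu : u = u' by apply/funext => i; apply: cui.
by apply/funext => v; apply/propext; rewrite h h' eu.
Qed.

Lemma interp_card : [set: interp L nat] #<= [set: set nat].
Proof.
have [/countable_injfun[cf fi] /countable_injfun[cr ri]] := hL.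
pose code (I : interp L nat) (k : nat) :=
  (exists (f : funs L) (v : 'I_(fun_arity f) -> nat),
    k = pickle (true, cf f, [seq v i | i <- enum 'I_(fun_arity f)], fun_interp I v)) \/
  (exists (r : rels L) (v : 'I_(rel_arity r) -> nat), rel_interp I v /\
    k = pickle (false, cr r, [seq v i | i <- enum 'I_(rel_arity r)], 0)).
apply: (@inj_le _ _ _ _ code) => // -[fI rI] [fJ rJ] _ _ e.
have subr I J (r : rels L) (v : 'I_(rel_arity r) -> nat) : code I = code J ->
    rel_interp I v -> rel_interp J v.
  move=> eIJ h.
  have : code J (pickle (false, cr r, [seq v i | i <- enum 'I_(rel_arity r)], 0)).
    by rewrite -eIJ; right; exists r, v.
  case=> [[f [w /(pcan_inj pickleK_inv)//]]|[r' [w [hw /(pcan_inj pickleK_inv)[]]]]].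
  move=> /(ri r r' Logic.I Logic.I) er; case: r' / er w hw => w hw.
  by move=> /(@map_enum_inj _ _ _ id) ew; rewrite (_ : v = w) //; exact/funext.
have eF : fI = fJ.
  apply: functional_extensionality_dep => f; apply/funext => v.
  have : code (Interp fJ rJ) (pickle (true, cf f,
      [seq v i | i <- enum 'I_(fun_arity f)], fI f v)).
    by rewrite -e; left; exists f, v.
  case=> [[f' [w /(pcan_inj pickleK_inv)[]]]|[r' [w [hw /(pcan_inj pickleK_inv)//]]]].
  move=> /(fi f f' Logic.I Logic.I) ef; case: f' / ef w => w.
  by move=> /(@map_enum_inj _ _ _ id) ew /= ->; rewrite (_ : v = w) //; exact/funext.
have -> : rI = rJ; last by rewrite eF.
apply: functional_extensionality_dep => r; apply/funext => v; apply/propext.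
split; [exact: (subr (Interp fI rI) (Interp fJ rJ)) |
  exact: (subr (Interp fJ rJ) (Interp fI rI) _ _ (esym e))].
Qed.

End CountableLanguage.

(* Koenig: the Cantor space is its own countable power, so among countably many pieces
   covering it one surjects onto it. *)
Lemma cantor_split (D : Type) (A : set D) (j : (nat -> bool) -> D) (n : (nat -> bool) -> nat) :
  (forall x, A (j x)) -> (forall x y, j x = j y -> n x = n y -> x = y) ->
  [set: set nat] #<= A.
Proof.
move=> Aj inj.
pose proj (m : nat) (x : nat -> bool) (k : nat) := x (pickle (m, k)).
have [m hm] : exists m, forall y, exists2 x, n x = m & proj m x = y.
  apply: contrapT => no.
  have {}no (m : nat) : exists y, forall x, n x = m -> proj m x <> y.
    apply: contrapT => ny; apply: no; exists m => y; apply: contrapT => nx; apply: ny.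
    by exists y => x xm xy; apply: nx; exists x.
  have [y hy] := choice no.
  pose x (i : nat) := if unpickle i is Some (m, k) then y m k else false.
  apply: (hy (n x) x erefl); apply/funext => k.
  by rewrite /proj /x pickleK.
have [s hs] := choice (fun y => let: ex_intro2 x a b := hm y in
  ex_intro (fun x => n x = m /\ proj m x = y) x (conj a b)).
apply: (@inj_le _ _ _ _ (fun S : set nat => j (s (fun i => `[< S i >])))) => // S S' _ _.
have [s1 s2] := hs (fun i => `[< S i >]); have [s1' s2'] := hs (fun i => `[< S' i >]).
move=> /inj; rewrite s1 s1' => /(_ erefl) e.
move: s2 s2'; rewrite e => -> e'; apply/funext => i; apply/propext.
have ei : `[< S i >] = `[< S' i >] := congr1 (@^~ i) e'.
by split=> /asboolP; [rewrite ei | rewrite -ei] => /asboolP.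
Qed.

Section Submodels.
Context (L : language) (C : structure L).
Implicit Types (M : set C).

(** The Tarski-Vaught criterion. *)
Definition elem_sub M := forall X, D1 M X -> (exists x, X x) -> exists2 x, M x & X x.

Lemma submodel (f : nat -> C) : injective f -> elem_sub (range f) ->
  exists I : interp L nat, forall n (phi : formula L n) (v : 'I_n -> nat),
    @sat L (nat_structure I) n phi v <-> sat phi (f \o v).
Proof.
move=> fi tv.
have hF (g : funs L) (v : 'I_(fun_arity g) -> nat) :
    exists k, f k = fun_interp (dom_interp C) (f \o v).
  have [||x [k _ <-] e] := tv (fun x => x = fun_interp (dom_interp C) (f \o v)).
  - exists (fun_arity g).+1, (Eq (Var ord0) (App (fun j => Var (lift ord0 j)))),
      (fun i => if unlift ord0 i is Some j then inr (f (v j)) else inl 0).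
    split=> [i|w]; first by case: unliftP => //= j _; exists (v j).
    rewrite /= unlift_none /= (_ : (fun j => _) = f \o v) //.
    by apply/funext => j; rewrite /= liftK.
  - by eexists.
  - by exists k.
have [F eF] : exists F : forall g : funs L, ('I_(fun_arity g) -> nat) -> nat,
    forall g v, f (F g v) = fun_interp (dom_interp C) (f \o v).
  exists (fun g v => projT1 (cid (hF g v))) => g v.
  by case: (cid _).
pose I := Interp F (fun r v => rel_interp (dom_interp C) (f \o v)).
exists I.
have ev n (v : 'I_n -> nat) t : f (@eval L (nat_structure I) n v t) = eval (f \o v) t.
  elim: t => //= g ts IH; rewrite eF; congr fun_interp; exact/funext.
move=> n; elim=> {n} //=.
- move=> n t u v; rewrite -!ev; split=> [->//|]; exact: (@fi _ _).
- move=> n r ts v; rewrite (_ : f \o (fun j => _) = fun j => eval (f \o v) (ts j)) //.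
  by apply/funext => j /=; rewrite ev.
- by move=> n a IHa b IHb v; rewrite IHa IHb.
- move=> n a IH v; split=> H; last by move=> x; rewrite IH vcons_comp.
  move=> x; apply: contrapT => nx.
  have [||y [k _ <-]] := tv (fun x => ~ sat a (vcons x (f \o v))).
  + exists n.+1, (Neg a), (fun i => if unlift ord0 i is Some j then inr (f (v j)) else inl 0).
    split=> [i|w]; first by case: unliftP => //= j _; exists (v j).
    suff -> : vcons (w 0) (f \o v) = tmv w \o
      (fun i => if unlift ord0 i is Some j then inr (f (v j)) else inl 0) by [].
    by apply/funext => i; rewrite /vcons /=; case: unlift.
  + by exists x.
  + by apply; have := H k; rewrite IH vcons_comp.
Qed.

(** Seen inside the monster, an isomorphism of the two models preserves types, hence is induced by
    an automorphism. *)
Lemma sat_Def (I J : interp L nat) (f g : nat -> C) :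
  (forall n (phi : formula L n) (v : 'I_n -> nat),
    @sat L (nat_structure I) n phi v <-> sat phi (f \o v)) ->
  (forall n (phi : formula L n) (v : 'I_n -> nat),
    @sat L (nat_structure J) n phi v <-> sat phi (g \o v)) ->
  forall h, isomorphism (h : nat_structure I -> nat_structure J) ->
  sameT set0 f (g \o h).
Proof.
move=> hf hg h ih X [n [phi [u [hu hX]]]].
pose w i := if u i is inl k then k else 0.
have e t : tmv t \o u = t \o w.
  by apply/funext => i; have := hu i; rewrite /w /=; case: (u i).
by rewrite !hX !e -hf (@sat_iso L (nat_structure I) _ h n phi w ih) hg.
Qed.

End Submodels.

Section Counting.
Context (L : language) (T : theory L) (K : Type) (C : structure L).
Context (hL : countable_language L) (hC : monster K T C).

Lemma isomorphic_refl (M : structure L) : isomorphic M M.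
Proof. by exists id; exact: isomorphism_id. Qed.
Definition iso_class (I : interp L nat) : set (interp L nat) :=
  [set J | model T (nat_structure J) /\ isomorphic (nat_structure I) (nat_structure J)].

Lemma classes_le : countable_model_classes T #<= [set: set nat].
Proof.
apply: card_le_trans (interp_card hL).
have [f hf] : exists f : set (interp L nat) -> interp L nat,
    forall c, countable_model_classes T c -> c (f c) /\ c = iso_class (f c).
  suff H : forall c, exists I, countable_model_classes T c -> c I /\ c = iso_class I.
    by have [f hf] := choice H; exists f.
  move=> c; case: (pselect (countable_model_classes T c)) => [[I mI ->]|nc].
    by exists I => _; split=> //; split=> //; exact: isomorphic_refl.
  by exists (Interp (fun _ _ => 0) (fun _ _ => False)).
apply: (@inj_le _ _ _ _ f) => // c d hc hd e.
by have [_ ->] := hf c hc; have [_ ->] := hf d hd; rewrite e.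
Qed.

(** The isomorphism class alone need not determine [x]; the class together with the image of the
    named points in a chosen representative does, and for each class there are only countably many
    such images. *)
Lemma count_models (M : (nat -> bool) -> set C) (N : nat)
    (t : (nat -> bool) -> nat -> C) :
  (forall x, countable (M x)) -> (forall x, elem_sub (M x)) ->
  (forall x, exists2 s : nat -> C, injective s & forall k, M x (s k)) ->
  (forall x k, k < N -> M x (t x k)) ->
  (forall x y g, aut set0 g -> (forall z, M x z <-> M y (g z)) ->
     (forall k, k < N -> g (t x k) = t y k) -> x = y) ->
  countable_model_classes T #= [set: set nat].
Proof.
move=> cM eM iM tM hg.
have [f hf] : exists f : (nat -> bool) -> nat -> C, forall x, injective (f x) /\ range (f x) = M x.
  suff H : forall x, exists f : nat -> C, injective f /\ range f = M x.
    by have [f hf] := choice H; exists f.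
  move=> x; have [s si sM] := iM x.
  have : M x #= [set: nat].
    rewrite card_eqPle; split; first exact: cM.
    by apply: (@inj_le _ _ _ _ s) => // i j _ _ /si.
  move=> /pcard_eqP/bijPex[b [_ bi bs]].
  have H n : exists z, M x z /\ b z = n.
    by have [z Mz e] := bs n Logic.I; exists z.
  have [f hf] := choice H; exists f; split.
    by move=> i j e; have [_ <-] := hf i; have [_ <-] := hf j; rewrite e.
  apply/seteqP; split=> z; first by move=> [i _ <-]; have [] := hf i.
  move=> Mz; exists (b z) => //; have [Mf bf] := hf (b z).
  by apply: bi => //; exact: mem_set.
have [I hI] : exists I : (nat -> bool) -> interp L nat,
    forall x n (phi : formula L n) (v : 'I_n -> nat),
    @sat L (nat_structure (I x)) n phi v <-> sat phi (f x \o v).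
  suff H x : exists I : interp L nat, forall n (phi : formula L n) (v : 'I_n -> nat),
      @sat L (nat_structure I) n phi v <-> sat phi (f x \o v).
    by have [I hI] := choice H; exists I.
  by have [fi fr] := hf x; apply: submodel => //; rewrite fr.
have mI x : model T (nat_structure (I x)).
  have [_ mC _ _] := hC; move=> s Ts v; apply/hI; exact: mC.
pose cl x := iso_class (I x).
have clP x : countable_model_classes T (cl x) by exists (I x).
have [rep hrep] : exists rep : set (interp L nat) -> interp L nat,
    forall c, countable_model_classes T c -> c (rep c).
  suff H : forall c, exists J, countable_model_classes T c -> c J.
    by have [g hgr] := choice H; exists g.
  move=> c; case: (pselect (countable_model_classes T c)) => [[J mJ ->]|nc].
    by exists J => _; split=> //; exact: isomorphic_refl.
  by exists (I (fun=> false)).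
have [h ih] : exists h : (nat -> bool) -> nat -> nat,
    forall x, isomorphism (h x : nat_structure (I x) -> nat_structure (rep (cl x))).
  suff H x : exists h : nat -> nat,
      isomorphism (h : nat_structure (I x) -> nat_structure (rep (cl x))).
    by have [h ih] := choice H; exists h.
  by have [_ [h ih]] := hrep _ (clP x); exists h.
have [c hc] : exists c : (nat -> bool) -> nat -> nat, forall x k, k < N -> f x (c x k) = t x k.
  suff H x : exists c : nat -> nat, forall k, k < N -> f x (c k) = t x k.
    by have [c hc] := choice H; exists c.
  have H k : exists i, k < N -> f x i = t x k.
    case: (ltnP k N) => kN; last by exists 0.
    by have := tM x k kN; have [_ <-] := hf x; move=> [i _ e]; exists i.
  by have [c hc] := choice H; exists c.
rewrite card_eqPle; split; first exact: classes_le.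
apply: (@cantor_split _ _ cl (fun x => pickle [seq h x (c x k) | k <- iota 0 N])) => //.
move=> x y exy /(pcan_inj pickleK) /eq_in_map etu.
have [k ik [hk kh]] := isomorphism_inv (ih y).
have ih' := ih x; rewrite exy in ih'.
have ikh := isomorphism_comp ih' ik.
have sm := sat_Def (hI x) (hI y) ikh.
have [g ga gf] := AUTw hC (countable0 _) sm.
have gf' i : g (f x i) = f y (k (h x i)) by have := congr1 (@^~ i) gf.
have [k' ik' [kk' k'k]] := isomorphism_inv ikh.
apply: (hg x y g ga) => [z|i iN].
  have [gi _] := ga; have [bg _ _] := gi.
  have [_ <-] := hf x; have [_ <-] := hf y; split.
    by move=> [i _ <-]; exists (k (h x i)); rewrite ?gf'.
  move=> [i _ e]; exists (k' i) => //; apply: (bij_inj bg).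
  by rewrite gf' -e -[in RHS](k'k i).
rewrite -!hc // gf'; congr (f y _).
by rewrite etu ?mem_iota // hk.
Qed.
End Counting.

(** * Omitting types *)

Definition upd (D : Type) (v : nat -> D) (n : nat) (c : D) (k : nat) : D :=
  if k == n then c else v k.

Lemma dependent_choice_nat (S : Type) (Q : nat -> S -> Prop) (R : nat -> S -> S -> Prop) s0 :
  Q 0 s0 -> (forall n s, Q n s -> exists s', R n s s' /\ Q n.+1 s') ->
  exists s : nat -> S, [/\ s 0 = s0, forall n, Q n (s n) & forall n, R n (s n) (s n.+1)].
Proof.
move=> Q0 step.
have H p : exists s', Q p.1 p.2 -> R p.1 p.2 s' /\ Q p.1.+1 s'.
  case: (pselect (Q p.1 p.2)) => [/step[s' h]|nq]; first by exists s'.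
  by exists s0.
have [f hf] := choice H.
pose s := fix s n := if n is m.+1 then f (m, s m) else s0.
have hQ n : Q n (s n) by elim: n => // n /(hf (n, _))[].
by exists s; split=> // n; have [] := hf (n, s n) (hQ n).
Qed.

Section OmegaSaturation.
Context (L : language) (T : theory L) (K : Type) (C : structure L).
Context (hC : monster K T C).
Implicit Types (E M : set C) (X Y : (nat -> C) -> Prop).

Lemma Def_upd E X n : Def E X -> Def E (fun v => exists x, X (upd v n x)).
Proof.
move=> hX; refine (@Def_ex _ _ _ (fun v x => X (upd v n x)) _).
apply: (@Def_subst _ _ _ _ (fun k w => if k == n then w 0 else w k.+1)) hX => k.
by case: (k == n); exact: is_tm_var.
Qed.

(** By [Def_support] only finitely many coordinates beyond [n] matter; they are projected away one
    at a time. *)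
Lemma Def_proj E X n : Def E X ->
  Def E (fun v => exists w, (forall k, k < n -> w k = v k) /\ X w).
Proof.
move=> hX; have [N hN] := Def_support hX.
pose Q m v := exists w, (forall k, ~~ (n <= k < n + m) -> w k = v k) /\ X w.
have hQ m : Def E (Q m).
  elim: m => [|m IH].
    apply: Def_ext hX _ => v; split=> [Xv|[w [wv Xw]]]; first by exists v.
    rewrite (_ : v = w) //; apply/funext => k; rewrite wv // addn0.
    by apply/negP => /andP[h1 h2]; have := leq_trans h2 h1; rewrite ltnn.
  apply: Def_ext (Def_upd (n + m) IH) _ => v; split=> [[x [w [wv Xw]]]|[w [wv Xw]]].
    exists w; split=> // k hk; rewrite wv; last first.
      by apply: contra hk => /andP[-> h]; rewrite addnS ltnS ltnW.
    rewrite /upd; case: eqP => // e; move: hk.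
    by rewrite e leq_addr addnS ltnSn.
  exists (w (n + m)), w; split=> // k hk; rewrite /upd; case: eqP => [->//|ne].
  apply: wv; apply: contra hk => /andP[->]; rewrite addnS ltnS leq_eqVlt => /orP[/eqP//|//].
apply: Def_ext (hQ N) _ => v; split=> [[w [wv Xw]]|[w [wv Xw]]].
  by exists w; split=> // k kn; apply: wv; rewrite leqNgt kn.
exists (fun k => if k < n + N then w k else v k); split.
  move=> k; case: ifP => // h; rewrite andbT => hk; apply: wv; by rewrite ltnNge.
apply/(hN _ w) => // k kN; rewrite ifT //; exact: leq_trans kN (leq_addl _ _).
Qed.

Definition vdirected (F : set ((nat -> C) -> Prop)) := F !=set0 /\
  forall X Y, F X -> F Y -> exists2 Z, F Z & forall v, Z v -> X v /\ Y v.

(** Coordinates are chosen successively so that every member of [F] remains satisfiable by a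
    sequence with the coordinates chosen so far. *)
Lemma omega_saturation E F : countable E -> (forall X, F X -> Def E X) ->
  vdirected F -> (forall X, F X -> exists v, X v) -> exists v, forall X, F X -> X v.
Proof.
move=> cE hF [[X0 FX0] hd] hne.
pose ok n v := forall X, F X -> exists w, (forall k, k < n -> w k = v k) /\ X w.
have [v0 _] := hne X0 FX0.
have [||s [_ sok sR]] := @dependent_choice_nat _ ok
  (fun n v v' => forall k, k < n -> v' k = v k) v0.
- by move=> X /hne[w Xw]; exists w.
- move=> n v okv.
  pose D X (c : C) := exists w, (forall k, k < n.+1 -> w k = upd v n c k) /\ X w.
  have sEv : small K (E `|` range v).
    apply: (small_countable (nat_lt_K hC)).
    by apply: countableU => //; exact: countable_range.
  have [|||c hc] := @SAT _ _ _ _ hC (E `|` range v) [set Y | exists2 X, F X & Y = D X] sEv.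
  + move=> _ [X FX ->]; have hX := hF X FX.
    apply: (@Def_support_subst _ _ _ (fun v => exists w,
      (forall k, k < n.+1 -> w k = v k) /\ X w) n.+1
      (fun k u => if k == n then u 0 else v k)).
    * move=> u u' uu'; split=> -[w [wu Xw]]; exists w; split=> // k kn;
      by rewrite wu // uu'.
    * move=> k _; case: (k == n); first exact: is_tm_var.
      by apply: is_tm_par; right; exists k.
    * by apply: Def_proj; apply: Def_mono hX; move=> ?; left.
  + split; first by exists (D X0), X0.
    move=> _ _ [X FX ->] [Y FY ->]; have [Z FZ ZXY] := hd X Y FX FY.
    exists (D Z); first by exists Z.
    by move=> c [w [wu /ZXY[Xw Yw]]]; split; exists w.
  + move=> _ [X FX ->]; have [w [wv Xw]] := okv X FX.
    exists (w n), w; split=> // k; rewrite ltnS leq_eqVlt /upd => /orP[/eqP->|kn].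
      by rewrite eqxx.
    by rewrite ltn_eqF // wv.
  exists (upd v n c); split; first by move=> k kn; rewrite /upd ltn_eqF.
  by move=> X FX; apply: (hc (D X)); exists X.
pose v k := s k.+1 k.
have vs n k : k < n -> s n k = v k.
  elim: n => // n IH; rewrite ltnS leq_eqVlt => /orP[/eqP->//|kn].
  by rewrite sR // IH.
exists v => X FX; have [N hN] := Def_support (hF X FX).
have [w [ws Xw]] := sok N X FX.
by apply/(hN v w) => // k kN; rewrite ws // vs.
Qed.

Lemma enumerate (D : Type) (A : set D) (x0 : D) : countable A -> A x0 ->
  exists e : nat -> D, (forall n, A (e n)) /\ forall x, A x -> exists n, e n = x.
Proof.
move=> /countable_injfun[f fi] Ax0.
have H n : exists x, A x /\ ((exists2 y, A y & f y = n) -> f x = n).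
  case: (pselect (exists2 y, A y & f y = n)) => [[y Ay <-]|ny]; first by exists y.
  by exists x0.
have [e he] := choice H; exists e; split=> [n|x Ax]; first by have [] := he n.
exists (f x); have [Ae h] := he (f x); apply: fi => //; apply: h; by exists x.
Qed.

Context (hL : countable_language L).

(** A Henkin construction inside the monster. The conditions are [E]-definable sets of environments;
    a decreasing sequence of them is realized by [omega_saturation], and the model is the range of
    the realization. *)
Lemma omitting_types E (Sg : set C) : countable E ->
  (forall x, ~ Sg x -> exists Y : C -> Prop, [/\ D1 E Y, Sg `<=` Y & ~ Y x]) ->
  (forall Y : C -> Prop, D1 E Y -> (exists x, Y x) -> exists2 x, Y x & ~ Sg x) ->
  exists M, [/\ countable M, E `<=` M, elem_sub M & forall x, M x -> ~ Sg x].
Proof.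
move=> cE sep noiso.
have [e [hDe he]] := enumerate (Def_countable hL cE) (Def_True E).
(* The Henkin axiom for [X] with witness at coordinate [n]. Even steps enforce one such axiom, odd
   steps keep one coordinate out of [Sg]. *)
pose W X n v := (exists z, X (scons z v)) -> X (scons (v n) v).
pose Q (n : nat) S := Def E S /\ exists v, S v.
pose R k S S' := (forall v, S' v -> S v) /\
  (if odd k then exists2 Y, Sg `<=` Y & forall v, S' v -> ~ Y (v k./2)
   else exists n, forall v, S' v -> W (e k./2) n v).
have hW X n : Def E X -> Def E (W X n).
  have sub t : is_tm E t -> Def E X -> Def E (fun v => X (scons (t v) v)).
    move=> ht; apply: (@Def_subst _ _ _ _ (fun k v => scons (t v) v k)) => -[|k] //.
    exact: is_tm_var.
  move=> hX; apply: Def_imp; last by apply: sub hX; exact: is_tm_var.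
  refine (@Def_ex _ _ _ (fun v z => X (scons z v)) _).
  apply: (@Def_subst _ _ _ _ (fun k v => scons (v 0) (fun k => v k.+1) k)) hX => -[|k];
    exact: is_tm_var.
have [||S [_ SQ SR]] := @dependent_choice_nat _ Q R (fun=> True).
- split; first exact: Def_True.
  by have [x0] := dom_inhabited C; exists (fun=> x0).
- move=> k S [hS [v Sv]]; rewrite /R; case: (odd k).
    have hY0 : D1 E (fun x => exists w, S w /\ w k./2 = x).
      have hX : Def E (fun w => S (fun i => w i.+1) /\ w (k./2).+1 = w 0).
        apply: Def_and; last by dtac.
        by apply: (@Def_subst _ _ _ _ (fun i w => w i.+1)) hS => i; exact: is_tm_var.
      apply: Def_ext (Def_proj 1 hX) _ => u; split.
        by move=> [w [w0 [Sw e1]]]; exists (fun i => w i.+1); rewrite -(w0 0).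
      move=> [w [Sw e1]]; exists (scons (u 0) w); split=> //.
      by case.
    have [|x [w [Sw wx]] nSg] := noiso _ hY0; first by exists (v k./2), v.
    have [Y [hY SgY nYx]] := sep x nSg.
    exists (fun w => S w /\ ~ Y (w k./2)); split; last first.
      by split; [apply: Def_and => //; dtac | exists w; rewrite wx].
    by split=> [u []//|]; exists Y => // u [].
  have [N hN] := Def_support hS; have [N' hN'] := Def_support (hDe k./2).
  (* A coordinate on which neither the condition nor [X] depends, free to become the witness. *)
  pose n := maxn N N'.
  exists (fun w => S w /\ W (e k./2) n w); split.
    split; [by move=> u [h _] | exists n => u [_ h]; exact h].
  split; first by apply: Def_and => //; exact: (hW _ _ (hDe _)).
  case: (pselect (exists z, e k./2 (scons z v))) => [[z hz]|nz]; last first.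
    by exists v; split=> // /nz.
  exists (upd v n z); split.
    apply/(hN _ v) => // i iN; rewrite /upd ltn_eqF //; exact: leq_trans iN (leq_maxl _ _).
  move=> _; apply/(hN' _ (scons z v)) => // -[|i] iN /=; rewrite /upd ?eqxx // ltn_eqF //.
  exact: leq_trans (ltnW iN) (leq_maxr _ _).
have Sdec i j : i <= j -> forall v, S j v -> S i v.
  elim: j => [|j IH]; first by rewrite leqn0 => /eqP->.
  rewrite leq_eqVlt => /orP[/eqP->//|ij] v /(proj1 (SR j)); exact: IH.
have [|||v hv] := @omega_saturation E (range S) cE.
- by move=> _ [i _ <-]; have [] := SQ i.
- split; first by exists (S 0), 0.
  move=> _ _ [i _ <-] [j _ <-]; exists (S (maxn i j)); first by exists (maxn i j).
  by move=> v h; split; apply: Sdec h; [exact: leq_maxl | exact: leq_maxr].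
- by move=> _ [i _ <-]; have [] := SQ i.
have Sv k : S k v by apply: hv; exists k.
have wit X : Def E X -> (exists z, X (scons z v)) -> exists n, X (scons (v n) v).
  move=> /he[j <-] hz; have [_] := SR j.*2; rewrite odd_double doubleK => -[n h].
  by exists n; exact: h (Sv _) hz.
exists (range v); split; first exact: countable_range.
- move=> c Ec; have [||n /= <-] := wit (fun u => u 0 = c).
  + by dtac.
  + by exists c.
  + by exists n.
- move=> X hX [x Xx].
  have [Y hY eY] : exists2 Y, Def set0 Y & forall z, X z <-> Y (scons z v).
    by apply: D1_split; apply: Def_mono hX => c; right.
  have [||n hn] := wit Y; first exact: Def_mono hY.
    by exists x; apply/eY.
  by exists (v n); [exists n | apply/eY].
- move=> _ [j _ <-] Sgv; have [_] := SR j.*2.+1.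
  rewrite /= odd_double /= uphalf_double => -[Y SgY h].
  exact: h (Sv _) (SgY _ Sgv).
Qed.

Lemma lowenheim E : countable E -> exists M, [/\ countable M, E `<=` M & elem_sub M].
Proof.
move=> cE; have [||M [cM EM eM _]] := @omitting_types E set0 cE.
- by move=> x _; exists set0; split=> //; exact: Def_False.
- by move=> Y _ [x Yx]; exists x => //.
- by exists M.
Qed.

(** * Continuum many types over a finite set *)

Lemma many_types A (a : nat -> C) N (x : (nat -> bool) -> C) :
  (forall k, k < N -> A (a k)) -> (forall c, A c -> exists2 k, k < N & a k = c) ->
  (forall e e', same A (x e) (x e') -> e = e') ->
  countable_model_classes T #= [set: set nat].
Proof.
move=> aA Aa xinj.
have cA : countable A.
  have: countable (range a) by exact: countable_range.
  by apply: sub_countable; apply: subset_card_le => c /Aa[k _ <-]; exists k.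
pose s (n : nat) := x (fun k => k == n).
have si : injective s.
  move=> i j e; have : same A (s i) (s j) by rewrite e.
  by move=> /xinj/(congr1 (@^~ i)); rewrite /= eqxx => /esym/eqP.
pose E e := (A `|` [set x e]) `|` range s.
have [M hM] : exists M : (nat -> bool) -> set C, forall e,
    [/\ countable (M e), E e `<=` M e & elem_sub (M e)].
  suff H e : exists M, [/\ countable M, E e `<=` M & elem_sub M].
    by have [M hM] := choice H; exists M.
  apply: lowenheim; apply: countableU; last exact: countable_range.
  by apply: countableU => //; exact: countable1.
pose t e k := if k < N then a k else x e.
apply: (@count_models _ _ _ _ hL hC M N.+1 t).
- by move=> e; have [] := hM e.
- by move=> e; have [] := hM e.
- move=> e; exists s => // k; have [_ h _] := hM e; apply: h; right; by exists k.
- move=> e k _; have [_ h _] := hM e; apply: h; left; rewrite /t.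
  by case: ifP => [/aA|]; [left | right].
- move=> e e' g ga _ gt; apply: xinj.
  have gA : aut A g.
    have [ig _] := ga; split=> // c Ac; have [k kN <-] := Aa c Ac.
    by have := gt k (ltnW kN); rewrite /t kN.
  have := gt N (ltnSn N); rewrite /t ltnn => <-.
  exact: same_aut.
Qed.

(** Nodes are abstract so that they can carry more than a definable set, for example the two sides
    of an interval. *)
Lemma binary_tree A (a : nat -> C) N (G : Type) (good : G -> Prop) (f : G -> C -> Prop) r :
  (forall k, k < N -> A (a k)) -> (forall c, A c -> exists2 k, k < N & a k = c) ->
  good r -> (forall n, good n -> D1 A (f n) /\ exists x, f n x) ->
  (forall n, good n -> exists n1 n2, [/\ good n1, good n2, forall x, f n1 x -> f n x,
     forall x, f n2 x -> f n x & forall x, f n1 x -> ~ f n2 x]) ->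
  countable_model_classes T #= [set: set nat].
Proof.
move=> aA Aa gr hf hs.
have cA : countable A.
  have: countable (range a) by exact: countable_range.
  by apply: sub_countable; apply: subset_card_le => c /Aa[k _ <-]; exists k.
have [c hc] : exists c : bool -> G -> G, forall n, good n ->
    [/\ good (c true n), good (c false n), forall x, f (c true n) x -> f n x,
     forall x, f (c false n) x -> f n x & forall x, f (c true n) x -> ~ f (c false n) x].
  suff H : forall n, exists p : G * G, good n -> [/\ good p.1, good p.2, forall x, f p.1 x -> f n x,
     forall x, f p.2 x -> f n x & forall x, f p.1 x -> ~ f p.2 x].
    by have [p hp] := choice H; exists (fun b n => if b then (p n).1 else (p n).2).
  move=> n; case: (pselect (good n)) => [/hs[n1 [n2 h]]|ng]; first by exists (n1, n2).
  by exists (n, n).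
pose nd (e : nat -> bool) := fix nd k := if k is j.+1 then c (e j) (nd j) else r.
have gnd e k : good (nd e k).
  by elim: k => //= k /hc[h1 h2 _ _ _]; case: (e k).
have decS e k x : f (nd e k.+1) x -> f (nd e k) x.
  by move=> /=; have [_ _ h1 h2 _] := hc _ (gnd e k); case: (e k); [exact: h1 | exact: h2].
have dec e i j x : i <= j -> f (nd e j) x -> f (nd e i) x.
  elim: j => [|j IH]; first by rewrite leqn0 => /eqP->.
  by rewrite leq_eqVlt => /orP[/eqP->//|ij] /decS; exact: IH.
have [x hx] : exists x : (nat -> bool) -> C, forall e k, f (nd e k) (x e).
  suff H e : exists x, forall k, f (nd e k) x.
    by have [x hx] := choice H; exists x.
  have sA := small_countable (nat_lt_K hC) cA.
  have [|||x hx] := @SAT _ _ _ _ hC A (range (fun k => f (nd e k))) sA.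
  - by move=> _ [k _ <-]; have [] := hf _ (gnd e k).
  - split; first by exists (f (nd e 0)), 0.
    move=> _ _ [i _ <-] [j _ <-]; exists (f (nd e (maxn i j))); first by exists (maxn i j).
    by move=> y h; split; apply: dec h; [exact: leq_maxl | exact: leq_maxr].
  - by move=> _ [k _ <-]; have [] := hf _ (gnd e k).
  by exists x => k; apply: hx; exists k.
apply: (many_types aA Aa (x := x)) => e e' see'.
have stepE k : nd e k = nd e' k -> e k = e' k.
  move=> ek; have h1 := hx e k.+1.
  have {h1} : f (nd e k.+1) (x e').
    by apply: see' h1; have [] := hf _ (gnd e k.+1).
  have := hx e' k.+1 => /=; rewrite ek.
  have [_ _ _ _ h] := hc _ (gnd e' k).
  case: (e k); case: (e' k) => // h2 h3; first by case: (h _ h3 h2).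
  by case: (h _ h2 h3).
apply/funext => k; apply: (stepE k).
by elim: k => //= k IH; rewrite IH (stepE k IH).
Qed.
End OmegaSaturation.

(** * A family of countable orders *)

(* The order of [x] is the sum over [n] of a copy of the negative rationals followed
   by two points ([1] and [3]), or three if [x n] holds. *)
Definition slot := (nat * rat)%type.

Definition ltp (i j : slot) : Prop :=
  i.1 < j.1 \/ (i.1 = j.1 /\ (i.2 < j.2)%R).

Lemma ltp_irr i : ~ ltp i i.
Proof. by case: i => n q [] /=; [rewrite ltnn | case=> _; rewrite Order.POrderTheory.ltxx]. Qed.

Lemma ltp_trans i j k : ltp i j -> ltp j k -> ltp i k.
Proof.
case: i j k => n q [m r] [p s] [nm|[/= <- qr]] [/= mp|/= [<- rs]].
- by left; exact: ltn_trans nm mp.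
- by left.
- by left.
- by right; split=> //=; lra.
Qed.

Lemma ltp_total i j : [\/ ltp i j, i = j | ltp j i].
Proof.
case: i j => n q [m r]; case: (ltngtP n m) => [h|h|<-].
- by apply: Or31; left.
- by apply: Or33; left.
- case: (Order.TotalTheory.ltgtP q r) => [h|h|->].
  + by apply: Or31; right.
  + by apply: Or33; right.
  + by apply: Or32.
Qed.

Definition block (x : nat -> bool) (i : slot) : Prop :=
  [\/ (i.2 < 0)%R, i.2 = 1%R, i.2 = 2%:R%R /\ x i.1 | i.2 = 3%:R%R].

Definition succ_in (I : set slot) i j :=
  [/\ I i, I j, ltp i j & forall k, I k -> ltp i k -> ltp k j -> False].

Definition start_in (I : set slot) i :=
  (exists j, succ_in I i j) /\ ~ exists j, succ_in I j i.

Lemma block_neg_no_succ x n q j : (q < 0)%R -> ~ succ_in (block x) (n, q) j.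
Proof.
move=> q0 [_ Ij + no]; case: j Ij no => m r Ij no ij.
have hq : block x (n, q / 2%:R)%R by apply: Or41 => /=; lra.
apply: (no _ hq); first by right; split=> //=; lra.
case: ij => [h|[/= e qr]]; first by left.
case: Ij => /= [r0|r1|[r2 _]|r3]; try (by right; split=> //=; lra).
suff : False by [].
have hm : block x (n, (q + r) / 2%:R)%R by apply: Or41 => /=; lra.
by apply: (no _ hm); right; split=> //=; lra.
Qed.

Lemma block3_no_succ x n j : ~ succ_in (block x) (n, 3%:R%R) j.
Proof.
move=> [_ Ij + no]; case: j Ij no => m r Ij no [/= nm|[/= e r3]]; last first.
  by case: Ij => /= [|||]; lra.
(* A negative rational below [r]: no block has a first point. *)
have hm : block x (m, Order.min (r - 1) (-1))%R.
  by apply: Or41 => /=; rewrite /Order.min; case: ifP => h; lra.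
apply: (no _ hm); first by left.
by right; split=> //=; rewrite /Order.min; case: ifP => h; lra.
Qed.

Lemma block1_no_pred x n j : ~ succ_in (block x) j (n, 1%R).
Proof.
move=> [Ij _ + no]; case: j Ij no => m r Ij no [/= mn|[/= e r3]]; last first.
  apply: (@block_neg_no_succ x m r (n, 1%R)); last by split=> //; [apply: Or42 | right].
  by case: Ij => /= [|||]; lra.
have hm : block x (n, -1)%R by apply: Or41 => /=; lra.
by apply: (no _ hm); [left | right; split=> //=; lra].
Qed.

Lemma block_succ1 x n j : succ_in (block x) (n, 1%R) j <->
  j = (n, if x n then 2%:R else 3%:R)%R.
Proof.
have hj : block x (n, if x n then 2%:R else 3%:R)%R.
  by case: (boolP (x n)) => xn; [apply: Or43 | apply: Or44].
have between k : block x k -> ltp (n, 1%R) k ->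
    ltp k (n, if x n then 2%:R else 3%:R)%R -> False.
  case: k => m r Ik [/= nm|[/= e r1]] [/= mn|[/= e' r2]].
  - by have := ltn_trans nm mn; rewrite ltnn.
  - by move: nm; rewrite e' ltnn.
  - by move: mn; rewrite e ltnn.
  - by move: Ik r2; rewrite -e => -[/= r0|/= r0|[/= r0 ->]|/= r0]; try case: (x n); lra.
have lt1 : ltp (n, 1%R) (n, if x n then 2%:R else 3%:R)%R.
  by right; split=> //=; case: (x n); lra.
split=> [[_ Ij ij no]|->]; last by split=> //; apply: Or42.
case: (ltp_total j (n, if x n then 2%:R else 3%:R)%R) => // h.
  by case: (between j Ij ij h).
by case: (no _ hj lt1 h).
Qed.

(** Having a successor but no predecessor singles out the points where finite parts begin, so the
    blocks can be counted in the bare order. *)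
Lemma startP x i : start_in (block x) i <-> exists n, i = (n, 1%R).
Proof.
split=> [[[j ij] np]|[n ->]]; last first.
  split; last by move=> [j]; exact: block1_no_pred.
  by eexists; exact/block_succ1.
case: i ij np => n q ij np; have [Ii _ _ _] := ij; exists n.
case: Ii => /= [q0|->//|[q2 xn]|q3].
- by case: (block_neg_no_succ q0 ij).
- by case: np; exists (n, 1%R); apply/block_succ1; rewrite xn q2.
- by rewrite q3 in ij; case: (block3_no_succ ij).
Qed.

Lemma block_ex (x : nat -> bool) n : x n <-> exists j k, succ_in (block x) (n, 1%R) j /\ succ_in (block x) j k.
Proof.
split=> [xn|[j [k [/block_succ1 ->]]]]; last first.
  by case: (x n) => // /block3_no_succ.
exists (n, 2%:R%R), (n, 3%:R%R); split; first by apply/block_succ1; rewrite xn.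
split; [by apply: Or43|by apply: Or44|by right; split=> //=; lra|].
move=> [m r] Ik [/= nm|[/= e r1]] [/= mn|[/= e' r2]].
- by have := ltn_trans nm mn; rewrite ltnn.
- by move: nm; rewrite e' ltnn.
- by move: mn; rewrite e ltnn.
- by clear e e'; case: Ik => /= [r0|r0|[r0 _]|r0]; lra.
Qed.

(** The map respects starting points, hence induces a strictly increasing surjection of [nat], the
    identity; then [x n] is read off from the two successors following the start of block [n]. *)
Lemma block_rigid x y (h : slot -> slot) :
  (forall i, block x i -> block y (h i)) ->
  (forall j, block y j -> exists2 i, block x i & h i = j) ->
  (forall i j, block x i -> block x j -> ltp i j <-> ltp (h i) (h j)) ->
  x = y.
Proof.
move=> hI hs ho.
have hsucc i j : block x i -> block x j -> succ_in (block x) i j <-> succ_in (block y) (h i) (h j).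
  move=> Ii Ij; split=> -[_ _ ij no].
    split; [exact: hI|exact: hI|by rewrite -ho|].
    by move=> k' /hs[k Ik <-] h1 h2; apply: (no k Ik); rewrite ho.
  split=> //; first by rewrite ho.
  by move=> k Ik h1 h2; apply: (no (h k)); [exact: hI | rewrite -ho | rewrite -ho].
have hsucc' i j : block x i -> succ_in (block y) (h i) j -> exists2 k, h k = j & succ_in (block x) i k.
  move=> Ii s; have [_ Ij _ _] := s; have [k Ik e] := hs j Ij.
  by exists k => //; apply/hsucc => //; rewrite e.
have I1 z n : block z (n, 1%R) by apply: Or42.
have hstart i : block x i -> start_in (block x) i <-> start_in (block y) (h i).
  move=> Ii; split=> -[[j s] np]; split.
  - by exists (h j); apply/hsucc => //; have [] := s.
  - move=> [k s']; have [Ik _ _ _] := s'; have [k' Ik' e] := hs k Ik.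
    by apply: np; exists k'; apply/hsucc => //; rewrite e.
  - by have [k _ sk] := hsucc' i j Ii s; exists k.
  - move=> [k s']; apply: np; exists (h k); apply/hsucc => //; by have [] := s'.
have [s hs1] : exists s : nat -> nat, forall n, h (n, 1%R) = (s n, 1%R).
  have H n : exists m, h (n, 1%R) = (m, 1%R).
    by apply/(startP y); apply/hstart => //; apply/startP; exists n.
  by have [s hs1] := choice H; exists s.
have smono n m : n < m -> s n < s m.
  move=> nm; have : ltp (h (n, 1%R)) (h (m, 1%R)) by rewrite -ho //; left.
  by rewrite !hs1 => -[//|/= [_]]; rewrite Order.POrderTheory.ltxx.
have ssurj n : exists m, s m = n.
  have [i Ii e] := hs (n, 1%R) (I1 y n).
  have : start_in (block x) i by apply/hstart => //; rewrite e; apply/startP; exists n.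
  by move=> /startP[m em]; exists m; move: e; rewrite em hs1 => -[].
have sid n : s n = n.
  elim/ltn_ind: n => n IH; have [m em] := ssurj n.
  case: (ltngtP m n) => [mn|nm|e]; last by rewrite -{1}e.
    by move: em; rewrite IH // => e; move: mn; rewrite e ltnn.
  have h1 : s n < n by rewrite -{2}em smono.
  by have := smono _ _ h1; rewrite (IH _ h1) ltnn.
apply/funext => n; apply/idP/idP => [/block_ex[j [k [s1 s2]]]|/block_ex[j [k [s1 s2]]]].
  apply/block_ex; exists (h j), (h k).
  have [_ Ij _ _] := s1; have [_ Ik _ _] := s2.
  by rewrite -{1}(sid n) -hs1; split; apply/hsucc.
apply/block_ex; move: s1; rewrite -{1}(sid n) -hs1 => /(hsucc' _ _ (I1 x n))[j' ej s1'].
have [_ Ij' _ _] := s1'.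
by move: s2; rewrite -ej => /(hsucc' _ _ Ij')[k' _ s2']; exists j', k'.
Qed.

(** * Types of tuples *)

Definition supp (D : Type) (n : nat) (Y : (nat -> D) -> Prop) :=
  forall v w, (forall k, k < n -> v k = w k) -> Y v -> Y w.

Lemma ord_rank (ord : nat -> nat -> Prop) : (forall i, ~ ord i i) ->
  (forall i j k, ord i j -> ord j k -> ord i k) -> forall N, exists r : nat -> nat,
  forall i j, i < N -> j < N -> ord i j -> r j < r i.
Proof.
move=> irr tr N; exists (fun i => count (fun k => `[< ord i k >]) (iota 0 N)) => i j iN jN ij.
have hj : j \in iota 0 N by rewrite mem_iota.
elim: (iota 0 N) hj => //= k s IH; rewrite inE => /orP[/eqP <-|js].
  rewrite (asboolT ij) asboolF; last exact: irr.
  rewrite add0n add1n ltnS; apply: sub_count => l /asboolP jl; apply/asboolP.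
  exact: tr ij jl.
rewrite -addnS; apply: leq_add; last exact: IH.
case: (asboolP (ord j k)) => // jk; rewrite (asboolT (tr _ _ _ ij jk)) //.
Qed.

Section Tuples.
Context (L : language) (C : structure L).

Definition initial (D : Type) (v : nat -> D) n : set D := [set x | exists2 k, k < n & v k = x].

Lemma suppW (D : Type) n (Y : (nat -> D) -> Prop) : supp n Y ->
  forall v w, (forall k, k < n -> v k = w k) -> Y v <-> Y w.
Proof. by move=> sY v w e; split; apply: sY => k kn; rewrite e. Qed.

(** Clamping the index at [n.-1] turns any condition on sequences into one on the first [n]
    entries. *)
Lemma supp_min (D : Type) n (Y : (nat -> D) -> Prop) : 0 < n ->
  supp n (fun w => Y (fun k => w (minn k n.-1))).
Proof.
move=> n0 v w e; suff -> : (fun k => v (minn k n.-1)) = fun k => w (minn k n.-1) by [].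
by apply/funext => k; apply: e; rewrite (leq_ltn_trans (geq_minr _ _)) // prednK.
Qed.

Lemma D1_split_initial (A : set C) v n (S : C -> Prop) : 0 < n ->
  D1 (A `|` initial v n) S -> exists Y, [/\ Def A Y, supp n.+1 Y
    & forall z, S z <-> Y (scons z v)].
Proof.
move=> n0 hS; have [|Y hY e] := @D1_split _ _ A (fun k => v (minn k n.-1)) S.
  apply: Def_mono hS => x [?|[k kn <-]]; [by left | right; exists k => //].
  by congr v; apply/minn_idPl; rewrite -ltnS prednK.
exists (fun w => Y (scons (w 0) (fun k => w (minn k n.-1).+1))); split=> //.
  apply: (@Def_subst _ _ _ _ (fun k w => scons (w 0) (fun k => w (minn k n.-1).+1) k)) hY => -[|k];
    exact: is_tm_var.
move=> w w' ww'; suff -> : scons (w 0) (fun k => w (minn k n.-1).+1) =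
    scons (w' 0) (fun k => w' (minn k n.-1).+1) by [].
apply/funext => -[|k] /=; first exact: ww'.
by apply: ww'; rewrite ltnS (leq_ltn_trans (geq_minr _ _)) // prednK.
Qed.

End Tuples.

Lemma initial_ext (D : Type) (v w : nat -> D) k :
  (forall i, i < k -> v i = w i) -> initial v k = initial w k.
Proof. by move=> e; apply/seteqP; split=> x [i ik <-]; exists i => //; rewrite e. Qed.

Lemma initial_countable (D : Type) (v : nat -> D) k : countable (initial v k).
Proof.
have: countable (range v) by exact: countable_range.
by apply: sub_countable; apply: subset_card_le => x [i _ <-]; exists i.
Qed.

Lemma greedy_seq (D : Type) (Q : set D -> D -> Prop) (x0 : D) :
  (forall v k, exists x, Q (initial v k) x) ->
  exists v, forall k, Q (initial v k) (v k).
Proof.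
move=> hQ; have [||s [_ sQ sR]] := @dependent_choice_nat _
  (fun n v => forall k, k < n -> Q (initial v k) (v k))
  (fun n v v' => forall k, k < n -> v' k = v k) (fun=> x0).
- by [].
- move=> n v Qv; have [x Qx] := hQ v n.
  have e k : k < n -> upd v n x k = v k by move=> kn; rewrite /upd ltn_eqF.
  exists (upd v n x); split=> // k; rewrite ltnS leq_eqVlt => /orP[/eqP->|kn].
    by rewrite (initial_ext e) /upd eqxx.
  rewrite (@initial_ext _ _ v) ?e //; first exact: Qv.
  by move=> i ik; apply: e; exact: ltn_trans ik kn.
have vs m i : i < m -> s m i = s i.+1 i.
  elim: m => // m IH; rewrite ltnS leq_eqVlt => /orP[/eqP->//|im].
  by rewrite sR // IH.
exists (fun k => s k.+1 k) => k; have := sQ k.+1 k (ltnSn k).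
rewrite (@initial_ext _ _ (fun k => s k.+1 k)) // => i ik.
by apply: vs; exact: ltn_trans ik (ltnSn k).
Qed.

Lemma sort_strict (U : eqType) (lt : U -> U -> Prop) (s : seq U) :
  (forall p, ~ lt p p) -> (forall p q r, lt p q -> lt q r -> lt p r) ->
  (forall p q, [\/ lt p q, p = q | lt q p]) ->
  exists s', s' =i s /\ pairwise (fun p q => `[< lt p q >]) s'.
Proof.
move=> irr tr tot; pose le p q := `[< ~ lt q p >].
have le_total : total le.
  move=> p q; apply/orP; case: (pselect (lt q p)) => h; [right|left]; apply/asboolP => //.
  by move=> h'; exact: (irr p (tr _ _ _ h' h)).
have le_tr : transitive le.
  move=> q p r /asboolP npq /asboolP nqr; apply/asboolP => pr.
  case: (tot p q) => [pq|e|//]; last by apply: nqr; rewrite -e.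
  by apply: nqr; exact: tr pr pq.
exists (sort le (undup s)); split; first by move=> p; rewrite mem_sort mem_undup.
have := sort_sorted le_total (undup s); rewrite sorted_pairwise // => h1.
have := undup_uniq s; rewrite -(sort_uniq le) uniq_pairwise => h2.
have : pairwise [rel x y | le x y && (x != y)] (sort le (undup s)).
  by rewrite pairwise_relI h1.
apply: sub_pairwise => p q /= /andP[/asboolP npq /eqP ne]; apply/asboolP.
by case: (tot p q).
Qed.

Lemma finite_params (D : Type) (U : eqType) (A : set D) (a : U -> D) (I : set U) l :
  (forall x, List.In x l -> (A `|` a @` I) x) ->
  exists s : seq U, (forall p, p \in s -> I p) /\
    forall x, List.In x l -> A x \/ exists2 p, p \in s & a p = x.
Proof.
elim: l => [|x l IH] h; first by exists [::].
have [y yl|s [sI ls]] := IH; first by apply: h; right.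
have [Ax|[p Ip pe]] := h x (or_introl erefl).
  by exists s; split=> // y [<-|/ls]; [left|].
exists (p :: s); split=> [q|y]; first by rewrite inE => /orP[/eqP->|/sI].
move=> [<-|/ls[?|[q qs <-]]]; [right; exists p => //; exact: mem_head|by left|right].
by exists q => //; rewrite inE qs orbT.
Qed.

Section Replacement.
Context (L : language) (C : structure L).

Lemma replace_same (A : set C) m (t : nat -> C) i y : 1 < m -> i < m ->
  (forall Y, Def A Y -> supp m Y -> Y t -> Y (upd t i y)) ->
  same (A `|` [set x | exists k, [/\ k < m, k != i & t k = x]]) (t i) y.
Proof.
move=> m1 im h psi hpsi pt; have m0 : 0 < m by exact: ltnW.
(* Maps every index below [m] and away from [i]: indices are clamped, and [i] itself goes to 0, or
   to 1 if [i] is 0. *)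
pose sg k := let j := minn k m.-1 in if j == i then (i == 0) : nat else j.
have sgm k : sg k < m.
  rewrite /sg; case: ifP => _; first by case: (i == 0).
  by rewrite (leq_ltn_trans (geq_minr _ _)) // prednK.
have sgi k : sg k != i.
  rewrite /sg; case: ifP => [_|->//].
  by case: (eqVneq i 0) => [->|] //=; rewrite eq_sym.
have [Y hY eY] : exists2 Y, Def A Y & forall z, psi z <-> Y (scons z (t \o sg)).
  apply: D1_split; apply: Def_mono hpsi => x [?|[k [km ki <-]]]; [by left | right].
  by exists k => //=; rewrite /sg (minn_idPl _) ?(negbTE ki) // -ltnS prednK.
rewrite eY; have := h (fun w => Y (scons (w i) (w \o sg))).
have -> : upd t i y \o sg = t \o sg.
  by apply/funext => k /=; rewrite /upd (negbTE (sgi k)).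
rewrite {1}/upd eqxx -eY; apply => //.
- by apply: (@Def_subst _ _ _ _ (fun k w => scons (w i) (w \o sg) k)) hY => -[|k];
    exact: is_tm_var.
- move=> w w' ww'; suff -> : scons (w i) (w \o sg) = scons (w' i) (w' \o sg) by [].
  by apply/funext => -[|k] /=; apply: ww'.
Qed.

End Replacement.

Section Spreading.
Context (L : language) (T : theory L) (K : Type) (C : structure L).
Context (hC : monster K T C).

Lemma tuple_conj (A : set C) n (t u : nat -> C) : countable A ->
  (forall Y, Def A Y -> supp n Y -> Y t -> Y u) ->
  exists2 g, aut A g & forall k, k < n -> g (t k) = u k.
Proof.
move=> cA tu; case: (ltnP 0 n) => n0; last first.
  by exists id; [exact: aut_id | move=> k kn; have := leq_trans kn n0].
have [|g ga e] := @AUTw _ _ _ _ hC A (fun k => t (minn k n.-1)) (fun k => u (minn k n.-1)) cA.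
  move=> Y hY Yt; apply: (tu (fun w => Y (fun k => w (minn k n.-1)))) => //.
    apply: (@Def_subst _ _ _ _ (fun k w => w (minn k n.-1))) hY => k; exact: is_tm_var.
  exact: supp_min.
exists g => // k kn; have := congr1 (@^~ k) e => /=.
by rewrite (minn_idPl _) // -ltnS prednK.
Qed.

(* Stretching an indiscernible sequence along a countable order. *)
Lemma spread (A : set C) (v : nat -> C) (ord : nat -> nat -> Prop) : countable A ->
  (forall i, ~ ord i i) -> (forall i j k, ord i j -> ord j k -> ord i k) ->
  (forall t : nat -> nat, (forall i j, i < j -> t i < t j) -> sameT A v (v \o t)) ->
  exists a : nat -> C, forall n s, (forall k l, k < l -> l < n -> ord (s l) (s k)) ->
    forall Y, Def A Y -> supp n Y -> Y v -> Y (a \o s).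
Proof.
move=> cA irr tr hsub.
pose good N (w : nat -> C) (r : nat -> nat) :=
  (forall i j, i < N -> j < N -> ord i j -> r j < r i) /\ forall i, i < N -> w i = v (r i).
pose F X := Def A X /\ exists N, forall w r, good N w r -> X w.
have goodS N N' w r : N <= N' -> good N' w r -> good N w r.
  move=> NN [h1 h2]; split=> [i j iN jN|i iN]; [apply: h1|apply: h2];
    exact: leq_trans NN.
have [|||a ha] := @omega_saturation _ _ _ _ hC A F cA.
- by move=> X [].
- split; first by exists (fun=> True); split; [exact: Def_True | exists 0].
  move=> X Y [hX [N hN]] [hY [N' hN']]; exists (fun w => X w /\ Y w); last by [].
  split; first exact: Def_and.
  exists (maxn N N') => w r g; split.
    by apply: (hN w r); apply: goodS g; exact: leq_maxl.
  by apply: (hN' w r); apply: goodS g; exact: leq_maxr.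
- move=> X [_ [N hN]]; have [r hr] := ord_rank irr tr N.
  by exists (v \o r); apply: (hN _ r).
exists a => n s hs Y hY sY Yv.
apply: (ha (fun w => Y (w \o s))); split.
  by apply: (@Def_subst _ _ _ _ (fun k w => w (s k))) hY => k; exact: is_tm_var.
exists (\max_(k < n) (s k).+1) => w r [h1 h2].
have sN k : k < n -> s k < \max_(k < n) (s k).+1.
  by move=> kn; exact: (@leq_bigmax _ (fun k : 'I_n => (s k).+1) (Ordinal kn)).
have rs k l : k < l -> l < n -> r (s k) < r (s l).
  by move=> kl ln; apply: h1; [exact: sN|apply: sN; exact: ltn_trans kl ln|exact: hs].
(* The values from [n] on are arbitrary but must keep [t] strictly increasing. *)
pose t k := if k < n then r (s k) else r (s n.-1) + k.
apply: (sY (v \o t)).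
  by move=> k kn /=; rewrite h2 ?sN // /t kn.
apply: hsub hY Yv => i j ij; rewrite /t.
case: (ltnP j n) => jn; first by rewrite (ltn_trans ij jn) rs.
case: (ltnP i n) => iN; last by rewrite ltn_add2l.
have n0 : 0 < n by exact: leq_ltn_trans iN.
apply: (@leq_ltn_trans (r (s n.-1))); last first.
  by rewrite -[X in X < _]addn0 ltn_add2l; exact: leq_trans n0 jn.
have : i <= n.-1 by rewrite -ltnS prednK.
by rewrite leq_eqVlt => /orP[/eqP->//|h]; apply/ltnW/rs => //; rewrite prednK.
Qed.

End Spreading.

(** * Theories without simple semiintervals *)

Section Tower.
Context (L : language) (T : theory L) (K : Type) (C : structure L).
Context (hC : monster K T C).
Implicit Types (A B : set C).
Context (lt : C -> C -> Prop) (hlt : wqo_order lt).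

(** Compactness for pairs from saturation for points: a bad [u] is realized first, then a bad [v]
    over [u]. *)
Lemma COMPACT2 B B' x0 (W : C -> C -> Prop) : small K B' -> B `<=` B' -> D2 B' W ->
  (forall u v, same B x0 u -> same B x0 v -> W u v) ->
  exists2 X, locus B x0 X & forall u v, X u -> X v -> W u v.
Proof.
move=> sB BB hW h; apply: contrapT => no.
pose G X := [set u | X u /\ exists2 v, X v & ~ W u v].
have [S0 [hl1 hl2]] : exists S0, locus B x0 S0 /\
    forall X Y, locus B x0 X -> locus B x0 Y -> exists2 Z, locus B x0 Z & Z `<=` X `&` Y.
  by have [[S0 h0] h1] := locus_directed B x0; exists S0.
have [|||u hu] := @SAT _ _ _ _ hC B' [set Z | exists2 X, locus B x0 X & Z = G X] sB.
- move=> _ [X [hX Xx] ->]; have {}hX : D1 B' X := Def_mono BB hX.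
  by rewrite /G; dtac.
- split; first by exists (G S0), S0.
  move=> _ _ [X lX ->] [Y lY ->]; have [Z lZ ZXY] := hl2 X Y lX lY.
  exists (G Z); first by exists Z.
  move=> u [/ZXY[Xu Yu] [v /ZXY[Xv Yv] nW]]; split; split=> //; by exists v.
- move=> _ [X lX ->]; apply: contrapT => ne; apply: no; exists X => // u v Xu Xv.
  by apply: contrapT => nW; apply: ne; exists u; split=> //; exists v.
have Pu : same B x0 u.
  by apply/locusP => X lX; have [] := hu (G X) (ex_intro2 _ _ X lX erefl).
have [||||v hv] := @SAT _ _ _ _ hC (B' `|` [set u])
  [set Z | exists2 X, locus B x0 X & Z = X `&` ~` (W u)].
- exact: (small_add1 (nat_lt_K hC) u sB).
- move=> _ [X [hX Xx] ->].
  have {}hX : D1 (B' `|` [set u]) X by apply: Def_mono hX => z /BB; left.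
  apply: Def_and => //; apply: Def_not.
  by dtac; right.
- split; first by exists (S0 `&` ~` (W u)), S0.
  move=> _ _ [X lX ->] [Y lY ->]; have [Z lZ ZXY] := hl2 X Y lX lY.
  exists (Z `&` ~` (W u)); first by exists Z.
  by move=> v [/ZXY[Xv Yv] nW].
- move=> _ [X lX ->]; have [_ [v Xv nW]] := hu (G X) (ex_intro2 _ _ X lX erefl).
  by exists v.
have [] := hv (S0 `&` ~` (W u)) (ex_intro2 _ _ S0 hl1 erefl).
move=> _; apply; apply: h => //; apply/locusP => X lX.
by have [] := hv (X `&` ~` (W u)) (ex_intro2 _ _ X lX erefl).
Qed.

(* [E n] is the initial segment reached from [c] in [n] steps of [G]. *)
Record tower (A : set C) (c : C) (E : nat -> set C) (G : C -> C -> Prop) : Prop := Tower {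
  tower_fin : exists l, forall x, A x <-> List.In x l;
  tower_c : A c;
  tower_E : forall n, D1 A (E n);
  tower_G : D2 A G;
  tower_down : forall n x y, E n y -> le lt x y -> E n x;
  tower_inc : forall n x, E n x -> E n.+1 x;
  tower_proper : forall n, exists2 y, (exists m, E m y) & ~ E n y;
  tower_G_le : forall x y, G x y -> le lt x y;
  tower_G_mono : forall x x1 y1 y, G x y -> le lt x x1 -> le lt x1 y1 -> le lt y1 y -> G x1 y1;
  tower_step : forall n x y, E n x -> G x y -> E n.+1 y;
  tower_back : forall n x w, E n.+1 w -> lt x w -> ~ G x w -> E n x;
  tower_0 : forall y, E 0 y <-> le lt y c
}.

(** [F] is controlled only on the locus, so by compactness a definable [X] around it replaces the
    locus, and [G], defined from [X], is monotone everywhere. Iterating an automorphism that takes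
    [x1] to [z1] gives points [c n]: each is reached in [n.*2] steps of [G], but [c n.+1] is not
    reached in [n] steps, so the levels never stop growing. *)
Lemma tower_ex B x0 : small K B -> ~ nobad B x0 lt ->
  exists A c E G, tower A c E G.
Proof.
move=> sB /existsNP[F /not_implyP[[hF Fle Frf Fmono] /existsNP[x1 /existsNP[y1 /existsNP[z1]]]]].
move=> /not_implyP[Px /not_implyP[Py /not_implyP[Pz /not_implyP[Fxy /not_implyP[Fyz nFxz]]]]].
set P := same B x0.
have hle B' := leD hlt B'; have hlt' B' := ltD_ hlt B'.
pose inn p q u v := le lt p u -> lt u v -> le lt v q -> F u v.
have cpt p q : P p -> P q -> F p q -> exists2 X, locus B x0 X &
    forall u v, X u -> X v -> inn p q u v.
  move=> Pp Pq Fpq.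
  apply: (@COMPACT2 B ((B `|` [set p]) `|` [set q])).
  - exact: (small_add1 (nat_lt_K hC) q (small_add1 (nat_lt_K hC) p sB)).
  - by move=> z; left; left.
  - have hl := hle ((B `|` [set p]) `|` [set q]).
    have hl' := hlt' ((B `|` [set p]) `|` [set q]).
    rewrite /inn; dtac; try (by right); try (by left; right).
    by move=> z; left; left.
  - move=> u v Pu Pv pu uv vq; apply: (Fmono p u v q) => //; by right.
have [X1 l1 h1] := cpt x1 y1 Px Py Fxy; have [X2 l2 h2] := cpt y1 z1 Py Pz Fyz.
pose X := X1 `&` X2.
have hX : D1 B X by have [? _] := l1; have [? _] := l2; exact: Def_and.
have PX p : P p -> X p.
  by move=> Pp; split; [exact: (iffRL (locusP B x0 p) Pp) | exact: (iffRL (locusP B x0 p) Pp)].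
pose G x y := le lt x y /\ forall u v, X u -> X v -> le lt x u -> lt u v -> le lt v y -> F u v.
have hG : D2 B G by have := hle B; have := hlt' B => hl1 hl2; rewrite /G; dtac.
have Gxy : G x1 y1.
  by split; [exact: Fle | move=> u v [? _] [? _]; exact: h1].
have Gyz : G y1 z1.
  by split; [exact: Fle | move=> u v [_ ?] [_ ?]; exact: h2].
have GF p q : P p -> P q -> G p q -> F p q.
  move=> Pp Pq [[<-|pq] h]; first exact: Frf.
  by apply: h => //; [exact: PX|exact: PX|left|left].
have nGxz : ~ G x1 z1 by move=> /(GF _ _ Px Pz).
have Gmono x x' y' y : G x y -> le lt x x' -> le lt x' y' -> le lt y' y -> G x' y'.
  move=> [xy h] xx' x'y' y'y; split=> // u v Xu Xv x'u uv vy'; apply: h => //.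
    exact: (le_tr hlt xx' x'u).
  exact: (le_tr hlt vy' y'y).
have [g ga gx] := AUT hC sB (same_trans (same_sym Px) Pz).
pose c n := iter n g x1.
pose chain := fix chain n x y := if n is m.+1 then exists2 z, chain m x z & G z y else x = y.
pose E n y := le lt y x1 \/ chain n x1 y.
have hchain n B' : D2 B' G -> D2 B' (chain n).
  move=> hG'; elim: n => [|n IH] /=; first exact: D2_eq.
  suff : D2 B' (fun x y => exists z, chain n x z /\ G z y).
    move=> /Def_ext; apply=> v; split; first by move=> [z [? ?]]; exists z.
    by move=> [z ? ?]; exists z.
  by dtac.
have aut_iter n : aut B (iter n g).
  by elim: n => [|n IH]; [exact: aut_id | exact: (aut_comp ga IH)].
have cS n : G (c n) (iter n g y1) /\ G (iter n g y1) (c n.+1) /\ ~ G (c n) (c n.+1).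
  rewrite /c iterSr gx -!(D2_aut _ _ hG (aut_iter n)); by split.
have Grf p : G p p.
  split; first by left.
  by move=> u v _ _ a b d; case: (lt_irr hlt (x := u)); exact: (lt_le_tr hlt b (le_tr hlt d a)).
have c_lt n : lt (c n) (c n.+1).
  have [[h3 _] [[h4 _] h5]] := cS n.
  by case: (le_tr hlt h3 h4) => // e; case: h5; rewrite -e; exact: Grf.
have Gle p q : G p q -> le lt p q by case.
have chain_le n p q : chain n p q -> le lt p q.
  elim: n q => [|n IH] q /=; first by left.
  by move=> [z /IH h /Gle h']; exact: (le_tr hlt h h').
have chain_c n w : chain n x1 w -> le lt w (c n).
  elim: n w => [|n IH] w /=; first by left.
  move=> [z /IH zc Gzw]; apply: contrapT => /(notle hlt) cw.
  have [_ [_]] := cS n; apply; apply: Gmono Gzw zc _ _; right=> //; exact: c_lt.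
have chainS n p q : chain n p q -> chain n.+1 p q by move=> h; exists q.
have chain2 n : chain n.*2 x1 (c n).
  elim: n => // n IH; rewrite doubleS /=; have [a [b _]] := cS n.
  by exists (iter n g y1) => //; exists (c n).
have chain_mono n p q q' : chain n p q -> le lt p q' -> le lt q' q -> chain n p q'.
  elim: n q q' => [|n IH] q q' /=.
    by move=> <- pq' q'p; exact: (le_anti hlt pq' q'p).
  move=> [z hz zq] pq' q'q; case: (pselect (le lt q' z)) => [q'z|/(notle hlt) zq'].
    by exists q' => //; exact: IH hz pq' q'z.
  by exists z => //; apply: Gmono zq _ _ _ => //; [left | right].
(* Only the parameters of [G] and the starting point are kept, because trees are counted over a
   finite set. *)
have [l [lB hGl]] := Def_params hG.
pose A z := List.In z (x1 :: l).
have hGA : D2 A G by apply: Def_mono hGl => z ?; right.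
have Ac : A x1 by left.
exists A, x1, E, G; split=> //.
- by exists (x1 :: l).
- move=> n; have hl := hle A; have hch := hchain n A hGA.
  by rewrite /E; dtac.
- move=> n x y [yc|cy] xy; first by left; exact: (le_tr hlt xy yc).
  case: (pselect (le lt x x1)) => [?|/(notle hlt) h]; [by left | right].
  by apply: chain_mono cy _ xy; right.
- by move=> n x [h|h]; [left | right; exact: chainS].
- move=> n; exists (c n.+1); first by exists n.+1.*2; right; exact: chain2.
  move=> [h|/chain_c h]; last exact: (le_gtF hlt h (c_lt n)).
  have : lt x1 (c n.+1).
    by elim: {h} n => [|n IH]; [exact: (c_lt 0) | exact: (lt_tr hlt IH (c_lt n.+1))].
  exact: (le_gtF hlt h).
- move=> n x y [xc|cx] xy; last by right; exists x.
  case: (pselect (le lt y x1)) => [?|/(notle hlt) h]; [by left | right].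
  exists x1; last by apply: Gmono xy xc _ _; [right | left].
  by elim: n => //= n IH; exists x1.
- move=> n x w [wc|/= [z hz zw]] xw nG.
    by left; right; exact: (lt_le_tr hlt xw wc).
  case: (pselect (le lt x x1)) => [?|/(notle hlt) h]; [by left | right].
  apply: chain_mono hz _ _; first by right.
  apply: contrapT => /(notle hlt) zx; apply: nG; apply: Gmono zw _ _ _; by [right | left].
- by move=> y; split=> [[//|/= <-]|h]; left.
Qed.

End Tower.

(** * The type just above the cut, and the relation [ll] *)

Section NonSimple.
Context (L : language) (T : theory L) (K : Type) (C : structure L).
Context (hL : countable_language L) (hC : monster K T C).
Context (lt : C -> C -> Prop) (hlt : wqo_order lt).
Context (A : set C) (c : C) (E : nat -> set C) (G : C -> C -> Prop).
Context (tw : tower lt A c E G).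
Implicit Types (B D : set C) (psi : C -> Prop).

Definition Lam y := exists n, E n y.

Definition cof D := forall x, Lam x -> exists y, [/\ D y, Lam y & lt x y].

Definition complete_cof D := [/\ D1 A D, forall x, D x -> le lt c x, cof D
  & forall psi, D1 A psi -> ~ (cof (D `&` psi) /\ cof (D `&` ~` psi))].

Lemma E_mono m n x : m <= n -> E m x -> E n x.
Proof.
elim: n => [|n IH]; first by rewrite leqn0 => /eqP->.
rewrite leq_eqVlt => /orP[/eqP->//|mn h]; exact: (tower_inc tw) (IH mn h).
Qed.

Lemma E_lt n x y : E n x -> ~ E n y -> lt x y.
Proof.
by move=> Ex nEy; apply: (notle hlt) => yx; apply: nEy; exact: (tower_down tw Ex yx).
Qed.

Lemma Lam_down x y : Lam y -> le lt x y -> Lam x.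
Proof. by move=> [n Ey] xy; exists n; exact: (tower_down tw Ey xy). Qed.

Lemma Lam_lt x y : Lam x -> ~ Lam y -> lt x y.
Proof. by move=> [n Ex] nLy; apply: (E_lt Ex) => Ey; apply: nLy; exists n. Qed.

Lemma E_c n : E n c.
Proof. by apply: (@E_mono 0) => //; rewrite (tower_0 tw); left. Qed.

Lemma Lam_proper n : exists2 y, Lam y & ~ E n y.
Proof. exact: (tower_proper tw). Qed.

Lemma cof_E D n : cof D -> exists y, [/\ D y, Lam y & ~ E n y].
Proof.
move=> cD; have [y Ly nEy] := Lam_proper n; have [z [Dz Lz yz]] := cD y Ly.
by exists z; split=> // Ez; apply: nEy; apply: (tower_down tw Ez); right.
Qed.

Lemma finite_enum : exists N (a : nat -> C), (forall k, k < N -> A (a k)) /\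
  forall x, A x -> exists2 k, k < N & a k = x.
Proof.
have [l hl] := tower_fin tw; exists (size l), (fun k => nth c l k); split.
  move=> k kl; apply/hl; elim: l k kl {hl} => // x l IH [|k] kl /=; [by left | right].
  exact: IH.
move=> x /hl; elim: l {hl} => //= y l IH [<-|/IH[k kl e]]; first by exists 0.
by exists k.+1.
Qed.

Lemma complete_cof_ex : ~ (countable_model_classes T #= [set: set nat]) ->
  exists D, complete_cof D.
Proof.
move=> nb; apply: contrapT => no; apply: nb.
have [N [a [aA Aa]]] := finite_enum.
pose good D := [/\ D1 A D, forall x, D x -> le lt c x & cof D].
apply: (binary_tree hC hL (A := A) (a := a) (N := N) (good := good)
  (f := fun D : set C => D : C -> Prop) (r := [set y | le lt c y])) => //.
- split=> //.
    by have hle := leD hlt A; have := tower_c tw => Ac; dtac.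
  move=> x [n Ex]; have [y Ly nEy] := Lam_proper n; exists y; split=> //.
    by right; exact: E_lt (E_c n) nEy.
  exact: E_lt Ex nEy.
- move=> D [hD _ cD]; split=> //; have [y [Dy _ _]] := cof_E 0 cD; by exists y.
- move=> D [hD Dc cD].
  have [psi [hpsi [c1 c2]]] : exists psi, D1 A psi /\ (cof (D `&` psi) /\ cof (D `&` ~` psi)).
    apply: contrapT => np; apply: no; exists D; split=> // psi hpsi h.
    by apply: np; exists psi.
  exists (D `&` psi), (D `&` ~` psi); split.
  + by split=> //; [dtac | move=> x [/Dc]].
  + by split=> //; [dtac | move=> x [/Dc]].
  + by move=> x [].
  + by move=> x [].
  + by move=> x [_ px] [_ /(_ px)].
Qed.

Context (D : set C) (cD : complete_cof D).

Lemma D_D1 : D1 A D. Proof. by case: cD. Qed.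
Lemma D_ge x : D x -> le lt c x. Proof. by case: cD => _ h _ _; exact: h. Qed.
Lemma D_cof : cof D. Proof. by case: cD. Qed.

Lemma E_aut g n x : aut A g -> E n x <-> E n (g x).
Proof. by move=> ga; exact: (D1_aut x (tower_E tw n) ga). Qed.
Lemma D_aut g x : aut A g -> D x <-> D (g x).
Proof. by move=> ga; exact: (D1_aut x D_D1 ga). Qed.
Lemma Lam_aut g x : aut A g -> Lam x <-> Lam (g x).
Proof. by move=> ga; split=> -[n h]; exists n; [rewrite -E_aut | rewrite (E_aut _ _ ga)]. Qed.

(* [F x y]: at most one [G]-step beyond the elements of [D] in reach of [x]. *)
Definition F x y := le lt x y /\
  forall w, D w -> lt x w -> ~ G x w -> le lt y w \/ G w y.

Lemma F_D2 : D2 A F.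
Proof.
have h1 := leD hlt A; have h2 := ltD_ hlt A; have h3 := tower_G tw; have h4 := D_D1.
by rewrite /F; dtac.
Qed.

Lemma F_mono x x1 y1 y : F x y -> le lt x x1 -> le lt x1 y1 -> le lt y1 y -> F x1 y1.
Proof.
move=> [xy h] xx1 x1y1 y1y; split=> // w Dw x1w nG.
case: (h w Dw (le_lt_tr hlt xx1 x1w)) => [Gxw|yw|Gwy].
- by apply: nG; apply: (tower_G_mono tw Gxw xx1); [right | left].
- by left; exact: (le_tr hlt y1y yw).
- case: (pselect (le lt y1 w)) => [?|/(notle hlt) wy1]; [by left | right].
  by apply: (tower_G_mono tw Gwy) => //; [left | right].
Qed.

Lemma F_Lam x y : Lam x -> F x y -> Lam y.
Proof.
move=> [n Ex] [xy h]; have [w [Dw [m Ew] nEw]] := cof_E n.+1 D_cof.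
have xw : lt x w by exact: E_lt (tower_inc tw Ex) nEw.
case: (h w Dw xw) => [Gxw|yw|Gwy].
- by apply: nEw; exact: (tower_step tw Ex Gxw).
- by exists m; exact: (tower_down tw Ew yw).
- by exists m.+1; exact: (tower_step tw Ew Gwy).
Qed.

(* Otherwise every element of [D] in [S] would have a successor in [D `&` S] that is
   not within reach of [G]; but the levels [E n] bound the length of such chains. *)
Lemma F_leaves (S : set C) z0 z1 : (forall x y, S y -> le lt x y -> S x) ->
  D z0 -> S z0 -> ~ S z1 -> Lam z1 -> exists z y, [/\ D z, S z, ~ S y & F z y].
Proof.
move=> dS Dz0 Sz0 nSz1 [N Ez1]; apply: contrapT => no.
have Slt x y : S x -> ~ S y -> lt x y.
  by move=> Sx nSy; apply: (notle hlt) => yx; apply: nSy; exact: dS yx.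
(* The failure of [F z y] yields [w]. If [w] is outside [S], it takes the place of [y] one level
   lower, since [G w y] fails. *)
have step n z y : D z -> S z -> ~ S y -> E n y ->
    exists w, [/\ D w, S w, lt z w & ~ G z w].
  elim: n y => [|n IH] y Dz Sz nSy Ey.
    have nF : ~ F z y by move=> h; apply: no; exists z, y.
    have [w [Dw zw nG h]] : exists w, [/\ D w, lt z w, ~ G z w & ~ (le lt y w \/ G w y)].
      apply: contrapT => nw; apply: nF; split; first by right; exact: Slt.
      by move=> w Dw zw nG; apply: contrapT => h; apply: nw; exists w.
    case: (pselect (S w)) => Sw; first by exists w.
    have wy : lt w y by apply: (notle hlt) => yw; apply: h; left.
    have yc : le lt y c by rewrite -(tower_0 tw).
    by case: (le_gtF hlt (D_ge Dw)); exact: (lt_le_tr hlt wy yc).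
  have nF : ~ F z y by move=> h; apply: no; exists z, y.
  have [w [Dw zw nG h]] : exists w, [/\ D w, lt z w, ~ G z w & ~ (le lt y w \/ G w y)].
    apply: contrapT => nw; apply: nF; split; first by right; exact: Slt.
    by move=> w Dw zw nG; apply: contrapT => h; apply: nw; exists w.
  case: (pselect (S w)) => Sw; first by exists w.
  have wy : lt w y by apply: (notle hlt) => yw; apply: h; left.
  apply: (IH w) => //; apply: (tower_back tw Ey wy) => Gwy; apply: h; by right.
have climb n : exists z, [/\ D z, S z & ~ E n z].
  elim: n => [|n [z [Dz Sz nEz]]].
    have [w [Dw Sw z0w _]] := step N z0 z1 Dz0 Sz0 nSz1 Ez1.
    exists w; split=> //; rewrite (tower_0 tw) => wc.
    exact: (le_gtF hlt (D_ge Dz0)) (lt_le_tr hlt z0w wc).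
  have [w [Dw Sw zw nG]] := step N z z1 Dz Sz nSz1 Ez1.
  by exists w; split=> // Ew; apply: nEz; exact: (tower_back tw Ew zw nG).
have [z [Dz Sz nEz]] := climb N.
by apply: nEz; apply: (tower_down tw Ez1); right; exact: Slt.
Qed.

Definition Ev psi := exists n, forall y, D y -> Lam y -> ~ E n y -> psi y.

Lemma Ev_mono psi chi : (forall y, psi y -> chi y) -> Ev psi -> Ev chi.
Proof. by move=> h [n hn]; exists n => y *; apply: h; exact: hn. Qed.

Lemma Ev_and psi chi : Ev psi -> Ev chi -> Ev (fun y => psi y /\ chi y).
Proof.
move=> [m hm] [n hn]; exists (maxn m n) => y Dy Ly nE; split.
  by apply: hm => // h; apply: nE; apply: E_mono h; exact: leq_maxl.
by apply: hn => // h; apply: nE; apply: E_mono h; exact: leq_maxr.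
Qed.

Lemma Ev_ex psi n : Ev psi -> exists y, [/\ D y, Lam y, ~ E n y & psi y].
Proof.
move=> [m hm]; have [y [Dy Ly nE]] := cof_E (maxn m n) D_cof; exists y; split=> //.
  by move=> h; apply: nE; apply: E_mono h; exact: leq_maxr.
by apply: hm => // h; apply: nE; apply: E_mono h; exact: leq_maxl.
Qed.

Lemma Ev_aut psi g : aut A g -> Ev psi -> Ev (fun y => psi (g y)).
Proof.
move=> ga [n hn]; exists n => y Dy Ly nEy.
by apply: hn; rewrite -?(D_aut _ ga) -?(Lam_aut _ ga) -?(E_aut _ _ ga).
Qed.

Lemma not_cof psi : ~ cof (D `&` psi) -> Ev (fun y => ~ psi y).
Proof.
move=> /existsNP[x /not_implyP[[n Ex] no]]; exists n => y Dy Ly nEy py.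
by apply: no; exists y; split=> //; exact: E_lt Ex nEy.
Qed.

(** Completeness of [D] concerns parameters from [A] only. Arbitrary definable sets are Boolean
    combinations of 0-definable and convex ones, and a convex set meeting [D] cofinally in [Lam]
    contains an end of the trace of [D] on [Lam]. *)
Lemma Ev_ultra psi : D1 setT psi -> Ev psi \/ Ev (fun y => ~ psi y).
Proof.
move=> /(let: And3 _ _ h := hlt in h psi); elim=> {psi} [Y [hY|[_ cY]]|Y _ IH|Y Z _ IHY _ IHZ].
- have [_ _ _ h] := cD; have /not_andP[/not_cof|/not_cof] := h Y (Def_mono (@sub0set _ A) hY).
    by right.
  by move=> h'; left; apply: Ev_mono h' => y /contrapT.
- case: (pselect (cof (D `&` Y))) => [cY'|/not_cof]; [left|by right].
  have [x [n Ex] _] := Lam_proper 0; have [y [[Dy Yy] [m Ey] xy]] := cY' x (ex_intro _ n Ex).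
  exists m => z Dz Lz nEz; have [w [[Dw Yw] Lw zw]] := cY' z Lz.
  by apply: (cY y z w) => //; exact: E_lt Ey nEz.
- case: IH => h; [right|by left].
  by apply: Ev_mono h => y Yy; apply.
- case: IHY => h; first by left; apply: Ev_mono h => y; left.
  case: IHZ => h'; first by left; apply: Ev_mono h' => y; right.
  by right; apply: Ev_mono (Ev_and h h') => y [a b] [].
Qed.

(* The type of an element realizing the cut just above [Lam], within [D]. *)
Definition Oc B x := forall psi, D1 B psi -> Ev psi -> psi x.

Lemma Oc_mono B B' x : B `<=` B' -> Oc B' x -> Oc B x.
Proof. by move=> BB h psi hpsi; apply: h; exact: Def_mono hpsi. Qed.

Lemma Oc_ex B : small K B -> exists x, Oc B x.
Proof.
move=> sB; have [|||x hx] := @SAT _ _ _ _ hC B [set psi : set C | D1 B psi /\ Ev psi] sB.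
- by move=> X [].
- split; first by exists setT; split; [exact: Def_True | exists 0].
  move=> X Y [hX eX] [hY eY]; exists (X `&` Y) => //.
  by split; [dtac | exact: Ev_and].
- by move=> X [_ /(Ev_ex 0)[y [_ _ _ Xy]]]; exists y.
by exists x => psi h1 h2; apply: hx; split.
Qed.

Lemma Oc_Ev B x psi : Oc B x -> D1 B psi -> psi x -> Ev psi.
Proof.
move=> ox hpsi px; case: (Ev_ultra (psi := psi)); [exact: Def_mono hpsi|by []|].
by move=> h; case: (ox _ (Def_not hpsi) h).
Qed.

Lemma Oc_same B x y : Oc B x -> Oc B y -> same B x y.
Proof. by move=> ox oy psi hpsi px; apply: oy => //; exact: Oc_Ev ox hpsi px. Qed.

Lemma Oc_closed B x y : Oc B x -> same B x y -> Oc B y.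
Proof. by move=> ox xy psi hpsi epsi; apply: xy => //; exact: ox. Qed.

Lemma Oc_D B x : A `<=` B -> Oc B x -> D x.
Proof. by move=> AB; apply; [exact: Def_mono D_D1 | exists 0]. Qed.

Lemma Oc_Lam B x : A `<=` B -> Oc B x -> ~ Lam x.
Proof.
move=> AB ox [n]; apply: (ox (fun y => ~ E n y)); last by exists n.
by apply: Def_not; exact: Def_mono (tower_E tw n).
Qed.

(** A counterexample to [psi] in [D] below [x] and outside [E n] is visible in the type of [x],
    hence also occurs below a point of [Lam], where [psi] holds on [D] outside [E n]. *)
Lemma Oc_below B x z : A `<=` B -> Oc B x -> D z -> ~ Lam z -> le lt z x -> Oc B z.
Proof.
move=> AB ox Dz nLz zx psi hpsi [n hn]; apply: contrapT => npz.
pose eps y := exists y', [/\ le lt y' y, D y', ~ E n y' & ~ psi y'].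
have heps : D1 B eps.
  have hle := leD hlt B; have hD := D_D1; have hE := tower_E tw n.
  apply: (@Def_ext _ _ _ (fun v => exists y', le lt y' (v 0) /\ D y' /\ ~ E n y' /\ ~ psi y')).
    by dtac.
  by move=> v; split=> [[y' [? [? [? ?]]]]|[y' [? ? ? ?]]]; exists y'.
have epsx : eps x by exists z; split=> // h; apply: nLz; exists n.
have [y [Dy Ly nEy [y' [yy Dy' nE' np]]]] := Ev_ex 0 (Oc_Ev ox heps epsx).
by apply: np; apply: hn => //; exact: Lam_down yy.
Qed.

Definition OA := Oc A.
(* [ll x a]: [x] is infinitely close to [Lam] as seen from [a]. *)
Definition ll x a := OA a /\ Oc (A `|` [set a]) x.

Lemma A_sub1 a : A `<=` A `|` [set a]. Proof. by move=> ?; left. Qed.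

Lemma small_A : small K A.
Proof.
have [N [a [aA Aa]]] := finite_enum; apply: (small_countable (nat_lt_K hC)).
have: countable (range a) by exact: countable_range.
by apply: sub_countable; apply: subset_card_le => x /Aa[k _ <-]; exists k.
Qed.

Lemma ll_X x a : ll x a -> OA x.
Proof. by move=> [_]; apply: Oc_mono; exact: A_sub1. Qed.

Lemma X_same x y : OA x -> OA y -> same A x y.
Proof. exact: Oc_same. Qed.
Lemma X_D x : OA x -> D x.
Proof. exact: Oc_D. Qed.
Lemma X_Lam x : OA x -> ~ Lam x.
Proof. exact: Oc_Lam. Qed.
Lemma X_gt x y : OA x -> Lam y -> lt y x.
Proof. by move=> /X_Lam nL Ly; exact: Lam_lt. Qed.
Lemma X_zhom : zhom OA.
Proof. by move=> x y Xx Xy; apply: (@same_mono _ _ set0 A) => //; exact: X_same. Qed.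

Lemma ll_lt x a : ll x a -> lt x a.
Proof.
move=> [Xa ox]; apply: (ox (fun x => lt x a)).
  by have h := ltD_ hlt (A `|` [set a]); dtac; right.
by exists 0 => y _ Ly _; exact: X_gt.
Qed.

Lemma X_aut g x : aut A g -> OA x -> OA (g x).
Proof. by move=> ga Xx; exact: Oc_closed Xx (same_aut ga). Qed.

Lemma X_conj x y : OA x -> OA y -> exists2 g, aut A g & g x = y.
Proof. by move=> Xx Xy; exact: (AUT hC small_A (X_same Xx Xy)). Qed.

Lemma ll_aut g x a : aut A g -> ll x a -> ll (g x) (g a).
Proof.
move=> ga [Xa ox]; split; first exact: X_aut.
move=> psi /D1_split1[R hR e] ev; rewrite e -(D2_aut x a hR ga).
apply: (ox (R^~ a)); first exact: D2_at1.
by apply: Ev_mono (Ev_aut ga ev) => y; rewrite e -(D2_aut y a hR ga).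
Qed.

Lemma ll_up x : OA x -> exists y, ll x y.
Proof.
move=> Xx; have [z oz] := Oc_ex (small_add1 (nat_lt_K hC) x small_A).
have lzx : ll z x by split.
have [g ga gz] := X_conj (ll_X lzx) Xx.
by exists (g x); rewrite -{1}gz; exact: ll_aut.
Qed.

Lemma ll_down x : OA x -> exists y, ll y x.
Proof. by move=> Xx; have [z oz] := Oc_ex (small_add1 (nat_lt_K hC) x small_A); exists z. Qed.

Definition cutrel (M : C -> C -> Prop) := [/\ D2 A M,
  forall z z' y, M z y -> le lt z' z -> M z' y
  & forall y z, OA y -> Lam z -> M z y].

(** Within [D] the type over [a] is given by initial segments containing [Lam], so [ll] can be
    tested on relations monotone in the first argument. *)
Lemma cutrelP b a : OA b -> OA a -> (ll b a <-> forall M, cutrel M -> M b a).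
Proof.
move=> Xb Xa; split=> [[_ ob] M [hM dM LM]|h].
  by apply: (ob (M^~ a)); [exact: D2_at1 | exists 0 => z _ Lz _; exact: LM].
split=> // psi hpsi0 [n hn]; have [R hR e] := D1_split1 hpsi0.
(* The initial segment of points below which [D], outside [E n], contains no counterexample to
   [psi]. *)
pose M z y := ~ exists y', [/\ le lt y' z, D y', ~ E n y' & ~ R y' y].
have cM : cutrel M.
  split.
  - have hle := leD hlt A; have hD := D_D1; have hE := tower_E tw n.
    apply: (@Def_ext _ _ _ (fun v => ~ exists y', le lt y' (v 0) /\ D y' /\ ~ E n y' /\ ~ R y' (v 1))).
      by dtac.
    by move=> v; split=> k [y' H]; apply: k; exists y'; case: H => ? [? [? ?]] || case: H.
  - move=> z z' y Mz z'z [y' [h1' h2' h3 h4]]; apply: Mz; exists y'; split=> //.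
    exact: (le_tr hlt h1' z'z).
  - move=> y z Xy Lz [y' [y'z Dy' nE nR]].
    have [g ga ge] := X_conj Xy Xa.
    apply: nR; rewrite (D2_aut y' y hR ga) ge -e; apply: hn.
    + by rewrite -(D_aut _ ga).
    + by rewrite -(Lam_aut _ ga); exact: Lam_down y'z.
    + by rewrite -(E_aut _ _ ga).
rewrite e; apply: contrapT => nR; apply: (h M cM); exists b; split=> //; first by left.
- exact: X_D.
- by move=> h'; apply: (X_Lam Xb); exists n.
Qed.

(** Eventual failure is impossible: beyond any point there are [y1] and [y2] with [ll y1 y2], and
    then [M y1 y2] holds. *)
Lemma cutrel_evtl M x0 : cutrel M -> OA x0 ->
  exists2 y0, OA y0 & forall y, OA y -> le lt y0 y -> M x0 y.
Proof.
move=> cM Xx0; have [hM dM LM] := cM.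
have fc : fconv OA lt (OA `&` M x0).
  apply: (finconv hlt) X_zhom _.
  suff : D1 (A `|` [set x0]) (M x0) by apply: Def_mono.
  by dtac; right.
have [[y0 X0 h]|[y0 X0 h]] := fconv_last (lt_lin hlt OA) Xx0 fc.
  by exists y0 => // y Xy y0y; have [] := h y Xy y0y.
have [y1 X1 [l0 l1]] : exists2 y1, OA y1 & le lt y0 y1 /\ le lt x0 y1.
  by case: (lt_tot hlt y0 x0) => [?|->|?]; [exists x0|exists x0|exists y0] => //;
    split; by [left|right].
have [y2 l2] := ll_up X1; have X2 : OA y2 by case: l2.
have M12 : M y1 y2 by apply: (iffLR (cutrelP X1 X2) l2).
case: (h y2 X2 (le_tr hlt l0 (or_intror (ll_lt l2)))); split=> //.
exact: dM M12 l1.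
Qed.

(* By compactness the quantifier over [OA] may be bounded by a formula. *)
Lemma cutrel_bound M x0 y0 : cutrel M -> OA x0 -> OA y0 ->
  (forall y, OA y -> le lt y0 y -> M x0 y) ->
  exists chi, [/\ D1 A chi, forall x, OA x -> chi x
    & forall y, chi y -> le lt y0 y -> M x0 y].
Proof.
move=> [hM dM LM] Xx0 Xy0 h; pose B := (A `|` [set x0]) `|` [set y0].
have AB : A `<=` B by move=> ?; left; left.
have sB : small K B.
  by apply: (small_add1 (nat_lt_K hC)); apply: (small_add1 (nat_lt_K hC)); exact: small_A.
have [||||chi [hchi chi0] sub] := @COMPACT _ _ _ _ hC B (locus A x0) (fun y => le lt y0 y -> M x0 y) sB.
- by move=> X [hX _]; exact: Def_mono hX.
- exact: locus_directed.
- by have hl := leD hlt B; dtac; by [right | left; right].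
- by move=> y /locusP hy; apply: h; exact: Oc_closed Xx0 hy.
exists chi; split=> // x Xx; exact: X_same Xx0 Xx _ hchi chi0.
Qed.

(** Quantifying [M] over all larger second arguments gives [M']. That it still contains [Lam] is
    checked after moving [y] to [y0], since [b] lies above the image of any point of [Lam]. *)
Lemma ll_le_trans b a a' : ll b a -> OA a' -> le lt a a' -> ll b a'.
Proof.
move=> lba Xa' aa'; have Xb := ll_X lba; have [Xa _] := lba.
apply/(cutrelP Xb Xa') => M cM; have [hM dM LM] := cM.
have [y0 X0 hy0] := cutrel_evtl cM Xb.
have [chi [hchi Xchi hc]] := cutrel_bound cM Xb X0 hy0.
pose M' z y := forall y', chi y' -> le lt y y' -> M z y'.
have cM' : cutrel M'.
  split.
  - by have hl := leD hlt A; rewrite /M'; dtac.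
  - by move=> z z' y Mz z'z y' cy yy'; apply: dM z'z; exact: Mz.
  - move=> y z Xy Lz y' cy yy'; have [g ga ge] := X_conj Xy X0.
    rewrite (D2_aut z y' hM ga); apply: (dM b); last first.
      by right; apply: (X_gt Xb); rewrite -(Lam_aut _ ga).
    apply: hc; first by rewrite -(D1_aut y' hchi ga).
    by rewrite -ge -(aut_le hlt _ _ ga).
by apply: (iffLR (cutrelP Xb Xa) lba M' cM') => //; exact: Xchi.
Qed.

(** Makes [ll] a strict weak order. Here [M'] witnesses that [ll y z] fails, and [N] asks for [M] at
    all [y'] for which [M'] fails in the same way. Such [y'] lie above every [w'] with [ll w' w],
    which gives [N] on [Lam]. *)
Lemma ll_exchange x y z : ll x z -> OA y -> ~ ll y z -> ll x y.
Proof.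
move=> lxz Xy nyz; have Xx := ll_X lxz; have [Xz _] := lxz.
have [M' [cM' nM']] : exists M', cutrel M' /\ ~ M' y z.
  apply: contrapT => no; apply: nyz; apply/(cutrelP Xy Xz) => M cM.
  by apply: contrapT => nM; apply: no; exists M.
have [hM' dM' LM'] := cM'.
apply/(cutrelP Xx Xy) => M cM; have [hM dM LM] := cM.
have [y0 X0 hy0] := cutrel_evtl cM Xx.
have [chi [hchi Xchi hc]] := cutrel_bound cM Xx X0 hy0.
pose N u w := forall y', chi y' -> ~ M' y' w -> M u y'.
have cN : cutrel N.
  split.
  - by rewrite /N; dtac.
  - by move=> u u' w Nu u'u y' cy nM; apply: dM u'u; exact: Nu.
  - move=> w u Xw Lu y' cy nM; have [w' lw'] := ll_down Xw.
    have [g ga ge] := X_conj (ll_X lw') X0.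
    rewrite (D2_aut u y' hM ga); apply: (dM x); last first.
      by right; apply: (X_gt Xx); rewrite -(Lam_aut _ ga).
    apply: hc; first by rewrite -(D1_aut y' hchi ga).
    rewrite -ge -(aut_le hlt _ _ ga); apply: contrapT => /(notle hlt) yw.
    apply: nM; apply: (dM' w'); last by right.
    exact: (iffLR (cutrelP (ll_X lw') Xw) lw' M' cM').
apply: (iffLR (cutrelP Xx Xz) lxz N cN) => //; exact: Xchi.
Qed.

(** Otherwise [F z y] would hold for some [z] in [Lam], and [F] never leaves [Lam]. *)
Lemma F_not_ll x y : F x y -> ~ ll x y.
Proof.
move=> Fxy [Xy ox].
have hF : D1 (A `|` [set y]) (F^~ y) by apply: D2_at1; exact: F_D2.
have [z [_ Lz _ Fzy]] := Ev_ex 0 (Oc_Ev ox hF Fxy).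
exact: X_Lam Xy (F_Lam Lz Fzy).
Qed.

Lemma ll_tr x y z : ll x y -> ll y z -> ll x z.
Proof. by move=> xy yz; apply: ll_le_trans xy _ _; [case: yz | right; exact: ll_lt]. Qed.

Lemma ll_irr x : ~ ll x x.
Proof. by move=> /ll_lt /(lt_irr hlt). Qed.

(** * Types of [ll]-decreasing tuples *)

Definition dec n (v : nat -> C) :=
  (forall k, k < n -> OA (v k)) /\ forall k, k.+1 < n -> ll (v k.+1) (v k).

Lemma dec_ll n v i j : dec n v -> i < j -> j < n -> ll (v j) (v i).
Proof.
move=> [_ h]; elim: j => // j IH; rewrite ltnS leq_eqVlt => /orP[/eqP->|ij] jn.
  exact: h.
exact: (ll_tr (h j jn) (IH ij (ltnW jn))).
Qed.

Lemma sub_A (B : set C) : A `<=` A `|` B. Proof. by move=> ?; left. Qed.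

Lemma countable_A : countable A.
Proof.
have [N [a [_ Aa]]] := finite_enum.
have: countable (range a) by exact: countable_range.
by apply: sub_countable; apply: subset_card_le => x /Aa[k _ <-]; exists k.
Qed.

Lemma cofinal_seq : exists d : nat -> C, forall n, [/\ D (d n), Lam (d n) & ~ E n (d n)].
Proof.
by have [d hd] := choice (fun n => cof_E n (D_cof)); exists d.
Qed.

Context (d : nat -> C) (hd : forall n, [/\ D (d n), Lam (d n) & ~ E n (d n)]).

(** The sequence [d] is among the parameters so that entries can be traded for members of [d] one
    after another in [descend]. *)
Definition nice v := forall k, Oc ((A `|` range d) `|` initial v k) (v k).

Lemma nice_ex : exists v, nice v.
Proof.
have [c0] := dom_inhabited C.
apply: (greedy_seq (Q := fun B => Oc ((A `|` range d) `|` B))) => // v k.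
apply: Oc_ex; apply: (small_countable (nat_lt_K hC)).
by do 2?apply: countableU; [exact: countable_A|exact: countable_range|exact: initial_countable].
Qed.

Lemma nice_dec v n : nice v -> dec n v.
Proof.
move=> hv; have XV k : OA (v k) by apply: Oc_mono (hv k) => x Ax; left; left.
split=> // k _; split=> //; apply: Oc_mono (hv k.+1) => x [Ax|->].
  by left; left.
by right; exists k.
Qed.

(** From the last entry backwards, [v j] is replaced by a member of [d]: what it satisfies over [d]
    and the earlier entries holds eventually. The member is taken late enough to exceed the one
    already placed at [j.+1]. *)
Lemma descend v n Y : nice v -> Def A Y -> supp n Y -> Y v ->
  exists y, [/\ Y y, forall k, k < n -> Lam (y k) & forall k, k.+1 < n -> lt (y k.+1) (y k)].
Proof.
move=> hv hY sY Yv.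
have H m : m <= n -> exists w, [/\ forall k, k < n - m -> w k = v k,
    forall k, n - m <= k -> k < n -> range d (w k),
    forall k, n - m <= k -> k.+1 < n -> lt (w k.+1) (w k) & Y w].
  elim: m => [|m IH] mn.
    rewrite subn0; exists v; split=> // k nk; first by rewrite ltnNge nk.
    by move=> /ltnW; rewrite ltnNge nk.
  have [w [w1 w2 w3 Yw]] := IH (ltnW mn); set j := n - m.+1.
  have jS : n - m = j.+1 by rewrite /j subnSK.
  have jn : j < n by rewrite /j ltn_subrL; case: (n) mn.
  rewrite {}jS in w1 w2 w3.
  pose Z t := Y (upd w j t).
  have hZ : D1 ((A `|` range d) `|` initial v j) Z.
    apply: (@Def_support_subst _ _ _ Y n (fun k u => if k == j then u 0 else w k)).
    - exact: suppW.
    - move=> k kn; case: (ltngtP k j) => kj; last exact: is_tm_var.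
        apply: is_tm_par; right; exists k => //; rewrite w1 //.
        exact: ltn_trans kj (ltnSn j).
      by apply: is_tm_par; left; right; apply: w2.
    - by apply: Def_mono hY => x; left; left.
  have Zv : Z (v j).
    apply: (sY w) => // k _; rewrite /upd; case: eqP => // ->; exact: w1.
  have [n0 hn0] := Oc_Ev (hv j) hZ Zv.
  have [m0 hm0] : exists m0, j.+1 < n -> E m0 (w j.+1).
    case: (ltnP j.+1 n) => jn'; last by exists 0.
    have [i _ <-] := w2 j.+1 (leqnn _) jn'; have [_ [m0 h] _] := hd i.
    by exists m0.
  pose i := maxn n0 m0; have [Di Li nEi] := hd i.
  exists (upd w j (d i)); split.
  - move=> k kj; rewrite /upd ltn_eqF //; apply: w1; exact: ltn_trans kj (ltnSn j).
  - move=> k jk kn; rewrite /upd; case: eqP => [_|nk]; first by exists i.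
    by apply: w2 => //; rewrite ltn_neqAle jk andbT; apply/eqP => e; apply: nk.
  - move=> k jk kn; rewrite /upd (gtn_eqF (leq_ltn_trans jk (ltnSn k))).
    case: eqP => [e|nk].
      rewrite e in kn *; apply: (E_lt (hm0 kn)) => h; apply: nEi.
      by apply: (E_mono) h; exact: leq_maxr.
    by apply: w3 => //; rewrite ltn_neqAle jk andbT; apply/eqP => e; apply: nk.
  - apply: hn0 => // h; apply: nEi; apply: (E_mono) h; exact: leq_maxl.
have [y [_ y2 y3 Yy]] := H n (leqnn n); rewrite subnn in y2 y3.
by exists y; split=> // k kn; [have [i _ <-] := y2 k isT kn; have [] := hd i | exact: y3].
Qed.

Definition dec_same n := forall t u, dec n t -> dec n u ->
  forall Y, Def A Y -> supp n Y -> Y t -> Y u.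

Lemma dec_conj n t u : dec_same n -> dec n t -> dec n u ->
  exists2 g, aut A g & forall k, k < n -> g (t k) = u k.
Proof. by move=> Pn dt du; apply: (tuple_conj hC countable_A); exact: Pn. Qed.

Lemma aut_scons n Y g z t u : Def A Y -> supp n.+1 Y -> aut A g ->
  (forall k, k < n -> g (t k) = u k) -> Y (scons z t) <-> Y (scons (g z) u).
Proof.
move=> hY sY ga gt; rewrite (Def_aut _ hY ga); apply: (suppW sY) => -[|k] //= kn.
exact: gt.
Qed.

(** Failure is a first-order statement about [t]; it passes to a nice tuple and then down to a tuple
    in [Lam], against [F_leaves]. The bound [t k0] keeps a point outside the segment within [Lam]
    after the descent. *)
Lemma F_leaves_dec n t (S : C -> Prop) z0 z1 k0 : dec_same n -> dec n t ->
  D1 (A `|` initial t n) S -> (forall x y, S y -> le lt x y -> S x) ->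
  D z0 -> S z0 -> ~ S z1 -> k0 < n -> le lt z1 (t k0) ->
  exists z y, [/\ D z, S z, ~ S y & F z y].
Proof.
move=> Pn dt hS dS Dz0 Sz0 nSz1 k0n z1t; have n0 : 0 < n by apply: leq_trans k0n.
have [Y [hY sY eY]] := D1_split_initial n0 hS.
apply: contrapT => no.
pose Th w := [/\ forall x y, Y (scons y w) -> le lt x y -> Y (scons x w),
  exists z, D z /\ Y (scons z w), exists z, ~ Y (scons z w) /\ le lt z (w k0)
  & ~ exists z y, D z /\ Y (scons z w) /\ ~ Y (scons y w) /\ F z y].
have sTh : supp n Th.
  move=> w w' ww' [t1 [z [Dz Yz]] [z' [nYz' z't]] t4].
  have e x : Y (scons x w) <-> Y (scons x w').
    by apply: (suppW sY) => -[|k] //= kn; rewrite ww'.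
  split.
  - by move=> x y /e Yy xy; apply/e; exact: t1 xy.
  - by exists z; split=> //; apply/e.
  - by exists z'; split; [move/e | rewrite -ww'].
  - move=> [x [y [Dx [Yx [nY Fxy]]]]]; apply: t4; exists x, y; split=> //.
    by split; [apply/e | split=> // /e].
have hTh : Def A Th.
  have hle := leD hlt A; have hD := D_D1; have hF := F_D2.
  have hYs i : Def A (fun w => Y (scons (w i) (fun k => w k.+1))).
    by apply: (@Def_subst _ _ _ _ (fun k w => scons (w i) (fun k => w k.+1) k)) hY => -[|k];
      exact: is_tm_var.
  have hYs2 i : Def A (fun w => Y (scons (w i) (fun k => w k.+2))).
    by apply: (@Def_subst _ _ _ _ (fun k w => scons (w i) (fun k => w k.+2) k)) hY => -[|k];
      exact: is_tm_var.
  apply: (@Def_ext _ _ _ (fun w => (forall x y, Y (scons y w) -> le lt x y -> Y (scons x w)) /\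
     (exists z, D z /\ Y (scons z w)) /\ (exists z, ~ Y (scons z w) /\ le lt z (w k0)) /\
     ~ exists z y, D z /\ Y (scons z w) /\ ~ Y (scons y w) /\ F z y)).
    dtac; try exact: hYs; exact: hYs2.
  by move=> w; split=> [[? [? []]]|[]].
have Tht : Th t.
  split.
  - by move=> x y /eY Sy xy; apply/eY; exact: dS xy.
  - by exists z0; split=> //; apply/eY.
  - by exists z1; split=> // /eY.
  - move=> [z [y [Dz [/eY Sz [nSy Fzy]]]]]; apply: no; exists z, y; split=> // Sy.
    by apply: nSy; apply/eY.
have [v hv] := nice_ex.
have Thv : Th v := Pn t v dt (nice_dec n hv) Th hTh sTh Tht.
have [y [[t1 [a [Da Ya]] [b [nYb by_]] t4] Ly _]] := descend hv hTh sTh Thv.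
have Lb : Lam b := Lam_down (Ly k0 k0n) by_.
have [z [z' [h1 h2 h3 h4]]] := F_leaves t1 Da Ya nYb Lb.
by apply: t4; exists z, z'.
Qed.

Lemma dec_same2 : dec_same 2.
Proof.
move=> t u [Xt lt_] [Xu lu] Y hY sY Yt.
have [g ga gt] := X_conj (Xt 0 isT) (Xu 0 isT).
have l1 := ll_aut ga (lt_ 0 isT); rewrite gt in l1.
have [_ o1] := l1; have [_ o2] := lu 0 isT.
have : Y (fun k => if k is 0 then u 0 else g (t 1)).
  apply: (sY (g \o t)); last by rewrite -(Def_aut _ hY ga).
  by move=> [|[|k]].
move=> h; apply: (sY (fun k => if k is 0 then u 0 else u 1)); first by move=> [|[|k]].
apply: (Oc_same o1 o2 (X := fun x => Y (fun k => if k is 0 then u 0 else x))) h.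
apply: (@Def_subst _ _ _ _ (fun k w => if k is 0 then u 0 else w 0)); last first.
  by apply: Def_mono hY; exact: sub_A.
by move=> [|k]; [apply: is_tm_par; right | exact: is_tm_var].
Qed.

(** As for semiintervals, the initial segment along which [Z] persists on [D] beyond [b] is
    invariant by [alternation], hence definable over the same parameters. *)
Lemma cut_between n v (Z : C -> Prop) b b' : dec n v -> 0 < n ->
  D1 (A `|` initial v n) Z -> OA b -> OA b' -> lt b b' -> Z b -> ~ Z b' ->
  exists2 M : C -> Prop, D1 (A `|` initial v n) M &
    [/\ forall x y, M y -> le lt x y -> M x, M b & ~ M b'].
Proof.
move=> dv n0 hZ Xb Xb' bb' Zb nZb'; set B := A `|` initial v n.
pose M z := le lt z b \/ forall s, D s -> le lt b s -> le lt s z -> Z s.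
have cB : countable B.
  by apply: countableU; [exact: countable_A | exact: initial_countable].
have Mb : M b by left; left.
have nMb' : ~ M b'.
  move=> [h|h]; first exact: (le_gtF hlt h bb').
  by apply: nZb'; apply: h; [exact: (X_D) Xb' | right | left].
have dM x y : M y -> le lt x y -> M x.
  move=> [yb|h] xy; first by left; exact: (le_tr hlt xy yb).
  by right=> s Ds bs sx; apply: h => //; exact: (le_tr hlt sx xy).
have hM : D1 setT M.
  have hl := leD hlt setT; have hD : D1 setT D by apply: Def_mono (D_D1).
  have hZ' : D1 setT Z by apply: Def_mono hZ.
  by rewrite /M; dtac.
have [||||M' hM' eM] := @DINV _ _ _ _ hC B [set setT] M (small_countable (nat_lt_K hC) cB).
- by move=> _ ->; exact: Def_True.
- by split; [exists setT | move=> X Y -> ->; exists setT].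
- exact: hM.
- move=> g x ga _ Mx; apply: contrapT => /not_orP[/(notle hlt) bgx /existsNP[s]].
  move=> /not_implyP[Ds /not_implyP[bs /not_implyP[sgx nZs]]].
  have gA : aut A g := aut_mono (@sub_A _) ga.
  have {}bs : lt b s by case: bs => // e; case: nZs; rewrite -e.
  have nLs : ~ Lam s by move=> /(Lam_down)/(_ (or_intror bs)); exact: (X_Lam Xb).
  case: (pselect (le lt (g b) s)) => [gbs|/(notle hlt) sgb]; last first.
    have Xs : OA s.
      by apply: (Oc_below (@subset_refl _ A) (X_aut gA Xb) Ds nLs); right.
    exact: (alternation hlt (X_zhom) hZ ga (fun x => X_aut gA)
      Xb Xs bs sgb Zb nZs).
  have [h ha [gh hg]] := aut_inv ga.
  have bhs : le lt b (h s) by rewrite (aut_le hlt _ _ ga) hg.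
  have hsx : le lt (h s) x by rewrite (aut_le hlt _ _ ga) hg.
  apply: nZs; rewrite -(hg s) -(D1_aut (h s) hZ ga).
  case: Mx => [xb|]; first by rewrite (le_anti hlt (le_tr hlt hsx xb) bhs).
  by apply=> //; rewrite (D_aut _ gA) hg.
have {}eM x : M x <-> M' x by apply: eM => X ->.
exists M' => //; split; [|by apply/eM|by move/eM].
by move=> x y /eM My xy; apply/eM; exact: dM My xy.
Qed.

(** Remove entry 1 from two tuples of different type and conjugate what remains to the same [v]. The
    removed entries become two points between [v 1] and [v 0] separated over [v], hence separated by
    a cut, which is transported to all decreasing tuples. *)
Lemma cut_family n : dec_same n -> 2 <= n -> ~ dec_same n.+1 ->
  exists Y, [/\ Def A Y, supp n.+1 Y & forall t, dec n t ->
    [/\ forall x y, Y (scons y t) -> le lt x y -> Y (scons x t),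
      exists2 b, ll (t 1) b & Y (scons b t)
      & exists2 b, ll b (t 0) & ~ Y (scons b t)]].
Proof.
move=> Pn n2 /existsNP[t /existsNP[u /not_implyP[dt /not_implyP[du /existsNP[Y]]]]].
move=> /not_implyP[hY /not_implyP[sY /not_implyP[Yt nYu]]].
have n0 : 0 < n by exact: ltnW.
have [v hv] := nice_ex; have dv := nice_dec n hv.
pose del (t : nat -> C) k := if k is 0 then t 0 else t k.+1.
have ddel w : dec n.+1 w -> dec n (del w).
  move=> dw; have [Xw lw] := dw; split=> [[|k] kn /=|[|k] kn /=].
  - exact: Xw.
  - exact: Xw.
  - exact: (dec_ll dw).
  - exact: lw.
have [g ga gt] := dec_conj Pn (ddel t dt) dv; have [h ha hu] := dec_conj Pn (ddel u du) dv.
pose Z z := Y (fun k => if k is k'.+1 then if k' is k''.+1 then v k''.+1 else z else v 0).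
have hZ : D1 (A `|` initial v n) Z.
  apply: (@Def_support_subst _ _ _ Y n.+1 (fun k w =>
    if k is k'.+1 then if k' is k''.+1 then v k''.+1 else w 0 else v 0)).
  - exact: suppW.
  - move=> [|[|k]] kn.
    + by apply: is_tm_par; right; exists 0.
    + exact: is_tm_var.
    + by apply: is_tm_par; right; exists k.+1.
  - by apply: Def_mono hY; exact: sub_A.
have Zg w f : aut A f -> (forall k, k < n -> f (del w k) = v k) -> Y w <-> Z (f (w 1)).
  move=> fa fw; rewrite (Def_aut _ hY fa); apply: (suppW sY) => -[|[|k]] kn //=.
    exact: (fw 0).
  exact: (fw k.+1).
have Zb : Z (g (t 1)) by apply/(Zg t g ga gt).
have nZb : ~ Z (h (u 1)) by move/(Zg u h ha hu).
have pos w f : aut A f -> dec n.+1 w -> (forall k, k < n -> f (del w k) = v k) ->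
    ll (v 1) (f (w 1)) /\ ll (f (w 1)) (v 0).
  move=> fa [Xw lw] fw; rewrite -(fw 1 n2) -(fw 0 n0) /=; split; apply: (ll_aut fa).
    exact: lw.
  by apply: lw.
have [l1 l2] := pos t g ga dt gt; have [l3 l4] := pos u h ha du hu.
have Xb := ll_X l2; have Xb' := ll_X l4.
have [M hM [b [b' [dM lb Mb lb' nMb']]]] : exists2 M : C -> Prop, D1 (A `|` initial v n) M &
    exists b b', [/\ forall x y, M y -> le lt x y -> M x, ll (v 1) b, M b, ll b' (v 0) & ~ M b'].
  case: (lt_tot hlt (g (t 1)) (h (u 1))) => [bb|e|bb].
  - have [M hM [d1 d2 d3]] := cut_between dv n0 hZ Xb Xb' bb Zb nZb.
    by exists M => //; exists (g (t 1)), (h (u 1)).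
  - by case: nZb; rewrite -e.
  - have nnZ : ~ ~ Z (g (t 1)) by [].
    have [M hM [d1 d2 d3]] := cut_between (Z := fun z => ~ Z z) dv n0 (Def_not hZ) Xb' Xb bb nZb nnZ.
    by exists M => //; exists (h (u 1)), (g (t 1)).
have [W [hW sW eW]] := D1_split_initial n0 hM.
exists W; split=> // w dw; have [f fa fv] := dec_conj Pn dv dw.
have eWf z : W (scons z v) <-> W (scons (f z) w) by exact: (aut_scons z hW sW fa fv).
have [f' fa' [ff' f'f]] := aut_inv fa.
split.
- move=> x y; rewrite -(f'f x) -(f'f y) -!eWf -!eW -(aut_le hlt _ _ fa); exact: dM.
- exists (f b); last by rewrite -eWf -eW.
  by rewrite -(fv 1 n2); exact: (ll_aut fa).
- exists (f b'); last by rewrite -eWf -eW.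
  by rewrite -(fv 0 n0); exact: (ll_aut fa).
Qed.


Context (few : ~ (countable_model_classes T #= [set: set nat])).

Section Tree.
Context (n : nat) (Pn : dec_same n) (n2 : 2 <= n).
Context (v : nat -> C) (dv : dec n v).
Context (Y : (nat -> C) -> Prop) (hY : Def A Y) (sY : supp n.+1 Y).
Context (cY : forall t, dec n t ->
    [/\ forall x y, Y (scons y t) -> le lt x y -> Y (scons x t),
      exists2 b, ll (t 1) b & Y (scons b t)
      & exists2 b, ll b (t 0) & ~ Y (scons b t)]).
Let B := A `|` initial v n.

(** The entries of [v] at 0 and 1 give way to [w] and [u], so the cut given by [Y] over this tuple
    lies between [u] and [w]. *)
Definition tup (u w : C) (k : nat) :=
  if k is k'.+1 then if k' is k''.+1 then v k''.+2 else u else w.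

(* A node [(U, V)] is a pair of short sets delimiting an interval of [OA]. *)
Definition node (p : (C -> Prop) * (C -> Prop)) := [/\ D1 B p.1 /\ D1 B p.2,
  (exists u, p.1 u) /\ (exists w, p.2 w),
  forall u, p.1 u -> OA u /\ le lt (v 1) u,
  forall w, p.2 w -> OA w /\ le lt w (v 0)
  & (forall u w, p.1 u -> p.2 w -> ll u w) /\
    forall w w', p.2 w -> p.2 w' -> le lt w w' -> F w w'].

Lemma dec_tup u w : OA u -> le lt (v 1) u -> ll u w -> dec n (tup u w).
Proof.
move=> Xu v1u luw; have [Xv lv] := dv; have [Xw _] := luw.
split=> [[|[|k]] kn //=|[|[|k]] kn //=].
- exact: Xv.
- by apply: (ll_le_trans _ Xu v1u); exact: lv.
- exact: lv.
Qed.

(** [Ms] is the union of the cuts between elements of [U] and [V], and [W] consists of the points of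
    [D] in [Ms] from which one step of [F] leaves [Ms]; therefore [W] is short. Shortness and
    [ll_exchange] carry [ll] from one element of a side to all others. *)
Lemma node_split p : node p -> exists W, [/\ node (p.1, W), node (W, p.2) & exists z, W z].
Proof.
case: p => U V [/= [hU hV] [[u0 Uu0] [w0 Vw0]] Uv Vv [UV shV]].
have [Xv lv] := dv.
have dt u w : U u -> V w -> dec n (tup u w).
  move=> Uu Vw; have [Xu vu] := Uv u Uu; apply: dec_tup => //; exact: UV.
pose Ms z := exists u, U u /\ exists w, V w /\ Y (scons z (tup u w)).
have hMs : D1 B Ms.
  have hYt : Def B (fun x => Y (scons (x 2) (tup (x 1) (x 0)))).
    apply: (@Def_support_subst _ _ _ Y n.+1 (fun k x => scons (x 2) (tup (x 1) (x 0)) k)).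
    - exact: suppW.
    - move=> [|[|[|k]]] kn; try exact: is_tm_var.
      by apply: is_tm_par; right; exists k.+2.
    - by apply: Def_mono hY => x; left.
  by rewrite /Ms; dtac; exact: hYt.
have dMs x y : Ms y -> le lt x y -> Ms x.
  move=> [u [Uu [w [Vw Yy]]]] xy; exists u; split=> //; exists w; split=> //.
  by have [h _ _] := cY (dt u w Uu Vw); exact: h xy.
have gtMs x y : Ms x -> ~ Ms y -> lt x y.
  by move=> Mx nMy; apply: (notle hlt) => yx; apply: nMy; exact: dMs yx.
have MsV z w' : D z -> ~ Lam z -> Ms z -> V w' -> ll z w'.
  move=> Dz nLz [u [Uu [w [Vw Yz]]]] Vw'.
  have [h _ [b lb nYb]] := cY (dt u w Uu Vw).
  have zb : lt z b by apply: (notle hlt) => bz; apply: nYb; exact: h bz.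
  have [Xw wv] := Vv w Vw; have [Xw' wv'] := Vv w' Vw'.
  have lzw : ll z w.
    have [_ ob] := lb; split=> //.
    by apply: (Oc_below (@A_sub1 w) ob Dz nLz); right.
  case: (pselect (le lt w w')) => [ww'|/(notle hlt) w'w].
    exact: (ll_le_trans lzw Xw' ww').
  apply: (ll_exchange lzw Xw').
  by apply: (F_not_ll); apply: shV => //; right.
have MsU u y : U u -> ~ Ms y -> exists b, ll u b /\ lt b y.
  move=> Uu nMy; have [_ [b lb Yb] _] := cY (dt u w0 Uu Vw0).
  exists b; split=> //; apply: gtMs => //.
  by exists u; split=> //; exists w0.
have nMw0 : ~ Ms w0.
  move=> Mw0; have [Xw0 _] := Vv w0 Vw0.
  have := MsV w0 w0 (X_D Xw0) (X_Lam Xw0) Mw0 Vw0.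
  exact: (ll_irr).
pose W z := D z /\ (Ms z /\ exists y, ~ Ms y /\ F z y).
have hW : D1 B W.
  have hD : D1 B D by apply: Def_mono (D_D1) => x; left.
  have hF : D2 B F by apply: Def_mono (F_D2) => x; left.
  by rewrite /W; dtac.
have [z0 Wz0] : exists z, W z.
  have [_ [b lb Yb] _] := cY (dt u0 w0 Uu0 Vw0).
  have Mb : Ms b by exists u0; split=> //; exists w0.
  have Xb : OA b by case: lb.
  have [z [y [Dz Mz nMy Fzy]]] : exists z y, [/\ D z, Ms z, ~ Ms y & F z y].
    apply: (F_leaves_dec (k0 := 0) Pn dv hMs dMs (X_D Xb) Mb nMw0).
      exact: ltnW.
    by have [] := Vv w0 Vw0.
  by exists z; split=> //; split=> //; exists y.
have Wn z : W z -> ~ Lam z.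
  move=> [Dz [Mz [y [nMy Fzy]]]] Lz; have Ly := F_Lam Lz Fzy.
  have [b [lb byy]] := MsU u0 y Uu0 nMy.
  have [Xb _] := lb; apply: (X_Lam Xb); apply: (Lam_down Ly); by right.
have WV z w : W z -> V w -> ll z w.
  by move=> Wz Vw; have [Dz [Mz _]] := Wz; apply: MsV => //; exact: Wn.
have WX z : W z -> OA z by move=> Wz; exact: ll_X (WV z w0 Wz Vw0).
have UW u z : U u -> W z -> ll u z.
  move=> Uu Wz; have Xz := WX z Wz; have [Dz [Mz [y [nMy Fzy]]]] := Wz.
  have [b [lb byy]] := MsU u y Uu nMy.
  case: (pselect (le lt b z)) => [bz|/(notle hlt) zb].
    exact: (ll_le_trans lb Xz bz).
  apply: (ll_exchange lb Xz); apply: (F_not_ll).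
  by apply: (F_mono Fzy); [left | right | right].
exists W; split; last by exists z0.
- split=> //=.
  + by split; [exists u0 | exists z0].
  + move=> z Wz; split; first exact: WX.
    have [_ wv] := Vv w0 Vw0; right; exact: (lt_le_tr hlt (ll_lt (WV z w0 Wz Vw0)) wv).
  + split=> // p q [Dp [Mp [y [nMy Fpy]]]] [Dq [Mq _]] pq.
    by apply: (F_mono Fpy) => //; [left | right; exact: gtMs].
- split=> //=.
  + by split; [exists z0 | exists w0].
  + move=> z Wz; split; first exact: WX.
    have [_ vu] := Uv u0 Uu0; right; exact: (le_lt_tr hlt vu (ll_lt (UW u0 z Uu0 Wz))).
Qed.

(** A node stands for the interval between its sides; a point of [W] separates the intervals of the
    two children. *)
Lemma tree_many : False.
Proof.
apply: few; have n0 : 0 < n by exact: ltnW.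
have [N [a [aA Aa]]] := finite_enum; have [Xv lv] := dv.
pose a' k := if k < N then a k else v (k - N).
pose f (p : (C -> Prop) * (C -> Prop)) z :=
  (forall u, p.1 u -> lt u z) /\ forall w, p.2 w -> lt z w.
apply: (binary_tree hC hL (A := B) (a := a') (N := N + n) (good := node) (f := f)
  (r := (fun x => x = v 1, fun x => x = v 0))).
- move=> k kn; rewrite /a'; case: ltnP => kN; first by left; exact: aA.
  by right; exists (k - N) => //; rewrite ltn_subLR.
- move=> x [/Aa[k kN <-]|[k kn <-]].
    by exists k; rewrite /a' ?kN //; exact: leq_trans kN (leq_addr _ _).
  by exists (N + k); rewrite ?ltn_add2l // /a' ltnNge leq_addr /= addKn.
- split=> /=.
  + by split; dtac; right; [exists 1 | exists 0].
  + by split; [exists (v 1) | exists (v 0)].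
  + by move=> u ->; split; [exact: Xv | left].
  + by move=> u ->; split; [exact: Xv | left].
  + split=> [u w -> ->|w w' -> -> _]; first exact: lv.
    by split; [left | move=> x _ vx _; left; right].
- move=> p np; have [W [[_ _ _ _ [UW _]] [_ _ _ _ [WV _]] [z Wz]]] := node_split np.
  have [[hU hV] _ _ _ _] := np; split; last first.
    by exists z; split=> u h; apply: (ll_lt); [exact: UW | exact: WV].
  have hl := ltD_ hlt B; rewrite /f; move: hU hV; case: (p) => U V /= hU hV.
  by dtac.
- move=> p np; have [W [n1 n2' [z Wz]]] := node_split np.
  exists (p.1, W), (W, p.2); split=> //.
  + move=> x [h1 h2]; split=> //= w Vw; apply: (lt_tr hlt (h2 z Wz)).
    by have [_ _ _ _ [h _]] := n2'; apply: (ll_lt); exact: h.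
  + move=> x [h1 h2]; split=> //= u Uu; apply: (lt_tr hlt _ (h1 z Wz)).
    by have [_ _ _ _ [h _]] := n1; apply: (ll_lt); exact: h.
  + move=> x [_ h2] [h1 _]; exact: (lt_irr hlt (lt_tr hlt (h1 z Wz) (h2 z Wz))).
Qed.
End Tree.

Lemma dec_same_ge2 n : 2 <= n -> dec_same n.
Proof.
elim: n => // n IH; rewrite leq_eqVlt => /orP[/eqP <-|]; first exact: (dec_same2).
rewrite ltnS => n2; apply: contrapT => nP; have Pn := IH n2.
have [Y [hY sY cY]] := cut_family Pn n2 nP.
have [v hv] := nice_ex.
exact: (tree_many Pn n2 (nice_dec n hv) hY sY cY).
Qed.

Lemma dec_same_lt2 n : n < 2 -> dec_same n.
Proof.
case: n => [|[|//]] _ t u dt du Y hY sY Yt; first by apply: sY Yt.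
have [Xt _] := dt; have [Xu _] := du.
apply: (sY (fun=> u 0)) => [[]//|].
have : D1 A (fun x => Y (fun=> x)).
  by apply: (@Def_subst _ _ _ _ (fun _ w => w 0)) hY => k; exact: is_tm_var.
move=> /(X_same (Xt 0 isT) (Xu 0 isT)); apply.
by apply: sY Yt; case.
Qed.

Lemma dec_sameP n : dec_same n.
Proof. by case: (ltnP n 2); [exact: dec_same_lt2 | exact: dec_same_ge2]. Qed.

(** Nice tuples have this property by construction, and every decreasing tuple is now conjugate to
    one of them. *)
Lemma dec_Oc n t : dec n.+1 t -> Oc (A `|` initial t n) (t n).
Proof.
move=> dt; case: n dt => [|n] dt.
  have [Xt _] := dt; move=> psi hpsi epsi; apply: (Xt 0 isT) => //.
  by apply: Def_mono hpsi => x [//|[k]].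
have [v hv] := nice_ex.
have [g ga gv] := dec_conj (@dec_sameP n.+2) (nice_dec n.+2 hv) dt.
move=> psi hpsi epsi; have [Y [hY sY eY]] := D1_split_initial (ltn0Sn n) hpsi.
rewrite -gv // eY -(aut_scons (v n.+1) hY sY ga (t := v)); last first.
  by move=> k kn; apply: gv; exact: ltnW.
have hZ : D1 (A `|` initial v n.+1) (fun z => Y (scons z v)).
  apply: (@Def_support_subst _ _ _ Y n.+2 (fun k w => scons (w 0) v k)).
  - exact: suppW.
  - move=> [|k] kn; first exact: is_tm_var.
    by apply: is_tm_par; right; exists k.
  - by apply: Def_mono hY => x; left.
apply: (hv n.+1 (fun z => Y (scons z v))).
  by apply: Def_mono hZ => x [?|?]; [left; left | right].
apply: Ev_mono (Ev_aut ga epsi) => z.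
by rewrite eY (aut_scons z hY sY ga (t := v) (u := t)) // => k kn; apply: gv; exact: ltnW.
Qed.

(** * Coding orders by families above the cut *)

Lemma family : exists a : slot -> C, (forall p, OA (a p)) /\
  forall p q, ltp p q -> ll (a p) (a q).
Proof.
have [v hv] := nice_ex.
pose ord i j := exists p q : slot, [/\ unpickle i = Some p, unpickle j = Some q & ltp p q].
have [|||a ha] := @spread _ _ _ _ hC A v ord (countable_A).
- by move=> i [p [q [-> [<-]]]]; exact: ltp_irr.
- move=> i j k [p [q [e1 e2 h]]] [p' [q' [e3 e4 h']]]; exists p, q'; split=> //.
  by move: e3; rewrite e2 => -[e]; apply: ltp_trans h _; rewrite e.
- move=> t ht X hX Xv; have [N hN] := Def_support hX.
  apply: (dec_sameP (n := N)) (nice_dec N hv) _ _ hX _ Xv; last by move=> u w uw /(hN u w uw).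
  have ti i j : i <= j -> t i <= t j by rewrite leq_eqVlt => /orP[/eqP->//|/ht/ltnW].
  split=> k kN /=; first by have [h _] := nice_dec (t k).+1 hv; exact: h.
  exact: (dec_ll (nice_dec (t k.+1).+1 hv) (ht _ _ (ltnSn k))).
exists (fun p => a (pickle p)); split=> [p|p q pq].
  have [XV _] := nice_dec 1 hv; apply: Oc_closed (XV 0 isT) _ => psi hpsi pv.
  apply: (ha 1 (fun=> pickle p) _ (fun w => psi (w 0))) => //; first by move=> k [|l].
  by move=> w w' ww' /=; rewrite ww'.
pose s k := if k is 0 then pickle q else pickle p.
have sT : sameT A (fun k => v (minn k 1)) (fun k => a (s (minn k 1))).
  move=> Y hY Yv; apply: (ha 2 s _ (fun w => Y (fun k => w (minn k 1)))) => //.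
  - move=> [|k] [|[|l]] // _ _; exists p, q; by rewrite !pickleK.
  - apply: (@Def_subst _ _ _ _ (fun k w => w (minn k 1))) hY => k; exact: is_tm_var.
  - exact: (@supp_min _ 2 Y).
have [g ga e] := AUTw hC (countable_A) sT.
have e0 : g (v 0) = a (pickle q) := congr1 (@^~ 0) e.
have e1 : g (v 1) = a (pickle p) := congr1 (@^~ 1) e.
rewrite -e0 -e1; apply: (ll_aut ga).
by have [_ h] := nice_dec 2 hv; exact: h.
Qed.

Context (a : slot -> C) (aX : forall p, OA (a p)) (a_ll : forall p q, ltp p q -> ll (a p) (a q)).

Definition gap (I : set slot) z := OA z /\ forall p, I p -> ll z (a p) \/ ll (a p) z.

(** Two definable sets witness that [x] is incomparable to some [a p]. The second uses [x] as a
    parameter and is read as a relation in which [x] becomes the variable. *)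
Lemma gap_sep (I : set slot) x : ~ gap I x ->
  exists Y : C -> Prop, [/\ D1 (A `|` a @` I) Y, gap I `<=` Y & ~ Y x].
Proof.
move=> ng; case: (pselect (OA x)) => [Xx|]; last first.
  move=> /existsNP[psi /not_implyP[hpsi /not_implyP[epsi npsi]]].
  exists psi; split=> //; first by apply: Def_mono hpsi => y; left.
  by move=> y [Xy _]; exact: Xy.
have [p [Ip n1 n2]] : exists p, [/\ I p, ~ ll x (a p) & ~ ll (a p) x].
  apply: contrapT => no; apply: ng; split=> // p Ip; apply: contrapT => /not_orP[n1 n2].
  by apply: no; exists p.
have AI : A `|` [set a p] `<=` A `|` a @` I.
  by move=> y [?|->]; [left | right; exists p].
have [psi1 [h1 e1 np1]] : exists psi, [/\ D1 (A `|` [set a p]) psi, Ev psi & ~ psi x].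
  apply: contrapT => no; apply: n1; split=> // psi h e; apply: contrapT => np.
  by apply: no; exists psi.
have [psi2 [h2 e2 np2]] : exists psi, [/\ D1 (A `|` [set x]) psi, Ev psi & ~ psi (a p)].
  apply: contrapT => no; apply: n2; split=> // psi h e; apply: contrapT => np.
  by apply: no; exists psi.
have [R hR eR] := D1_split1 h2.
exists (fun y => psi1 y \/ R (a p) y); split.
- have h1' : D1 (A `|` a @` I) psi1 := Def_mono AI h1.
  have hR' : D2 (A `|` a @` I) R by apply: Def_mono hR => y; left.
  by dtac; right; exists p.
- move=> y [Xy /(_ p Ip)[[_ oy]|[_ ap]]]; [left; exact: oy | right].
  have [g ga gx] := X_conj Xy Xx.
  have h3 : D1 (A `|` [set y]) (R^~ y) := D2_at1 y hR.
  apply: ap h3 _; apply: Ev_mono (Ev_aut ga e2) => z.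
  by rewrite eR -gx -(D2_aut z y hR ga).
- by move=> [//|]; rewrite -eR.
Qed.

(** If [b] is below all parameters of [th], then [th] reaches into [Lam]. Otherwise let [aj] be the
    next smaller parameter: all [z] of [D] up to [b] with [ll aj z] satisfy [th], and [th] contains
    only points comparable to [aj]. So [ll aj z] is definable on [D] between [aj] and [b], but a
    step of [F] crosses this boundary, contrary to [ll_exchange]. *)
Lemma gap_no_isolated (I : set slot) (th : C -> Prop) : D1 (A `|` a @` I) th ->
  (exists x, th x) -> exists2 x, th x & ~ gap I x.
Proof.
move=> hth0 [b thb]; apply: contrapT => no.
have thg x : th x -> gap I x by move=> tx; apply: contrapT => ng; apply: no; exists x.
have [l [hl hth1]] := Def_params hth0; have [s0 [s0I ls0]] := finite_params hl.
have tot p q : [\/ ltp q p, p = q | ltp p q].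
  by case: (ltp_total q p) => [?|->|?]; [apply: Or31|apply: Or32|apply: Or33].
have [s [ss0 ps]] := @sort_strict _ (fun p q => ltp q p) s0 ltp_irr
  (fun p q r h h' => ltp_trans h' h) tot.
have sI p : p \in s -> I p by rewrite ss0; exact: s0I.
have hth : D1 (A `|` [set a p | p in [set p | p \in s]]) th.
  apply: Def_mono hth1 => x /ls0[?|[p /= ps0 <-]]; [by left | right].
  by exists p => //=; rewrite ss0.
have [Xb gb] := thg b thb.
pose above p := `[< ll b (a p) >].
pose up := seq.filter above s; pose dn := seq.filter (predC above) s.
have upP p : p \in up -> ll b (a p) by rewrite mem_filter => /andP[/asboolP].
have dnP p : p \in dn -> ll (a p) b.
  rewrite mem_filter => /andP[/asboolP nb ps'].
  by case: (gb p (sI p ps')).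
have sE p : p \in s -> p \in up \/ p \in dn.
  by rewrite !mem_filter /= => ->; case: (above p); [left|right].
pose a' o := if o is Some p then a p else b.
pose r o o' := `[< ll (a' o') (a' o) >].
(* [None] stands for [b], inserted into the decreasing list of parameters. *)
pose os := [seq Some p | p <- up] ++ None :: [seq Some p | p <- dn].
pose t k := a' (nth None os k); set m := size os; set kb := size up.
have tb : t kb = b by rewrite /t nth_cat size_map ltnn subnn.
have mE : m = kb + (size dn).+1 by rewrite /m size_cat /= !size_map.
have dt : dec m t.
  have pt : pairwise r os.
    have pa q : pairwise r [seq Some p | p <- seq.filter q s].
      rewrite pairwise_map; apply: pairwise_filter.
      by apply: sub_pairwise ps => p p' /asboolP h; apply/asboolP; exact: a_ll.
    rewrite pairwise_cat /= !pa /= andbT; apply/andP; split.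
      apply/allrelP => x y /mapP[p pu ->]; rewrite inE => /orP[/eqP->|/mapP[q qd ->]].
        by apply/asboolP; exact: upP.
      apply/asboolP; exact: (ll_tr (dnP q qd) (upP p pu)).
    by apply/allP => x /mapP[q qd ->]; apply/asboolP; exact: dnP.
  split=> [k km|k km].
    by rewrite /t; case: (nth None os k) => [p|] /=; [exact: aX | exact: Xb].
  have /(pairwiseP None) h := pt.
  have /asboolP // : r (nth None os k) (nth None os k.+1).
  by apply: h; rewrite ?inE //; exact: ltnW.
have inT p : p \in s -> exists k, [/\ k < m, k != kb & t k = a p].
  move=> /sE[pu|pd].
    have h : index p up < kb by rewrite index_mem.
    exists (index p up); split; [by rewrite mE ltn_addr | by rewrite ltn_eqF |].
    by rewrite /t nth_cat size_map h (nth_map p) // nth_index.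
  have h : index p dn < size dn by rewrite index_mem.
  exists (kb + (index p dn).+1); split.
  - by rewrite mE ltn_add2l.
  - by rewrite -[X in _ != X]addn0 eqn_add2l.
  - by rewrite /t nth_cat size_map ltnNge leq_addr /= addKn /= (nth_map p) // nth_index.
case dnE: dn => [|p0 dn'].
  have mk : m = kb.+1 by rewrite mE dnE addn1.
  have hth' : D1 (A `|` initial t kb) th.
    apply: Def_mono hth => x [?|[p /= /inT[k [km kk <-]] <-]]; [by left | right].
    by exists k => //; rewrite ltn_neqAle kk -ltnS -mk.
  have ob : Oc (A `|` initial t kb) b by rewrite -tb; apply: dec_Oc; rewrite -mk.
  have [y [_ Ly _ ty]] := Ev_ex 0 (Oc_Ev ob hth' thb).
  by have [Xy _] := thg y ty; exact: (X_Lam Xy).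
have kb1 : kb.+1 < m by rewrite mE dnE /= -addn2 leq_add2l.
set aj := t kb.+1.
have ajE : aj = a p0.
  by rewrite /aj /t nth_cat size_map ltnNge leqnSn /= subSnn /= dnE.
have Ip0 : I p0 by apply: sI; have : p0 \in dn by [rewrite dnE mem_head]; rewrite mem_filter => /andP[].
have Xaj : OA aj by have [h _] := dt; exact: h.
have lajb : ll aj b by have [_ h] := dt; rewrite -tb; exact: h.
have same_pos z : D z -> ll aj z -> le lt z b -> th z.
  move=> Dz laz zb.
  have nLz : ~ Lam z by move=> Lz; apply: (X_Lam Xaj); apply: (Lam_down Lz); right; exact: (ll_lt laz).
  have Xz : OA z := Oc_below (@subset_refl _ A) Xb Dz nLz zb.
  pose t' := upd t kb z.
  have dt' : dec m t'.
    have [Xt lt_] := dt; split=> k km; rewrite /t' /upd.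
      by case: eqP => // _; exact: Xt.
    case: (eqVneq k kb) => [->|nk].
      by rewrite gtn_eqF.
    case: eqP => [e|_]; last exact: lt_.
    have := lt_ k km; rewrite e tb => -[Xk ob]; split=> //.
    exact: (Oc_below (@A_sub1 (t k)) ob Dz nLz zb).
  have m1 : 1 < m by apply: leq_ltn_trans kb1.
  have : same (A `|` [set x | exists k, [/\ k < m, k != kb & t k = x]]) (t kb) z.
    by apply: replace_same => //; [exact: ltnW | exact: dec_sameP dt dt'].
  rewrite tb; apply=> //; apply: Def_mono hth => x [?|[p /= /inT ? <-]]; by [left | right].
(* A first-order description of the points [z] of [D] up to [b] with [ll aj z]. *)
pose Ls z := D z /\ (lt aj z /\ (le lt z b /\ forall s, D s -> le lt z s -> le lt s b -> th s)).
have Ls_in z : D z -> ll aj z -> le lt z b -> Ls z.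
  move=> Dz laz zb; split=> //; split; first exact: (ll_lt laz).
  split=> // s' Ds zs sb; apply: same_pos => //; apply: (ll_le_trans laz) => //.
  apply: (Oc_below (@subset_refl _ A) Xb Ds _ sb) => Ls'.
  by have [Xaj' _] := laz; apply: (X_Lam Xaj'); exact: (Lam_down Ls').
have Ls_ll z : Ls z -> OA z /\ ll aj z.
  move=> [Dz [ajz [zb h]]]; have [Xz gz] := thg z (h z Dz (or_introl erefl) zb).
  split=> //; have := gz p0 Ip0; rewrite -ajE => -[/(ll_lt) zaj|//].
  by case: (lt_irr hlt (lt_tr hlt zaj ajz)).
pose S z := forall l, Ls l -> lt z l.
set B := A `|` initial t m.
have hS : D1 B S.
  have hth' : D1 B th.
    apply: Def_mono hth => x [?|[p /= /inT[k [km kk <-]] <-]]; [by left | right].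
    by exists k.
  have hlt1 := ltD_ hlt B; have hlt2 := leD hlt B.
  have hD : D1 B D by apply: Def_mono (D_D1) => x; left.
  have Baj : B aj by right; exists kb.+1.
  have Bb : B b by right; exists kb => //; exact: ltnW.
  by rewrite /S /Ls; dtac.
have [z [y [Dz Sz nSy Fzy]]] : exists z y, [/\ D z, S z, ~ S y & F z y].
  apply: (F_leaves_dec (k0 := kb) (z0 := aj) (z1 := b) (@dec_sameP m) dt hS).
  - by move=> x y Sy xy l' Ll'; exact: (le_lt_tr hlt xy (Sy l' Ll')).
  - exact: (X_D Xaj).
  - by move=> l' [_ []].
  - move=> /(_ b) h; apply: (lt_irr hlt (h _)).
    by apply: Ls_in => //; [exact: (X_D Xb) | left].
  - exact: ltnW.
  - by rewrite tb; left.
move: nSy => /existsNP[l' /not_implyP[Ll' /(notlt hlt) ly]].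
have zl := Sz l' Ll'; have [Xl ajl] := Ls_ll l' Ll'.
have Fzl : F z l' by apply: (F_mono Fzy) => //; [left | right].
case: (pselect (le lt aj z)) => [ajz|/(notle hlt) zaj]; last first.
  apply: (F_not_ll (x := aj) (y := l') _ ajl).
  by apply: (F_mono Fzl); [right | right; exact: (ll_lt ajl) | left].
have nLz : ~ Lam z by move=> Lz; exact: (X_Lam Xaj (Lam_down Lz ajz)).
have Xz : OA z by apply: (Oc_below (@subset_refl _ A) Xl Dz nLz); right.
have ajz' : ll aj z := ll_exchange ajl Xz (F_not_ll Fzl).
have [_ [_ [lb _]]] := Ll'.
apply: (lt_irr hlt (Sz z (Ls_in z Dz ajz' _))).
by right; exact: (lt_le_tr hlt zl lb).
Qed.

(* Two elements of [OA] incomparable for [ll] are in the same place of the order type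
   coded by the model. *)
Definition inc x y := [/\ OA x, OA y, ~ ll x y & ~ ll y x].

Lemma inc_sym x y : inc x y -> inc y x.
Proof. by move=> []. Qed.

Lemma inc_ll x x' y y' : inc x x' -> inc y y' -> ll x y -> ll x' y'.
Proof.
move=> [Xx Xx' nxx' nx'x] [Xy Xy' nyy' ny'y] xy.
have xy' : ll x y' := ll_exchange xy Xy' ny'y.
apply: contrapT => nx'y'; apply: nxx'.
exact: (ll_exchange xy' Xx' nx'y').
Qed.

Lemma inc_aut g x y : aut A g -> inc x y -> inc (g x) (g y).
Proof.
move=> ga [Xx Xy nxy nyx]; have [h ha [gh hg]] := aut_inv ga.
split; [exact: X_aut ga Xx | exact: X_aut ga Xy | |] => /(ll_aut ha);
  by rewrite !gh.
Qed.

Lemma inc_a p q : inc (a p) (a q) -> p = q.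
Proof. by move=> [_ _ n1 n2]; case: (ltp_total p q) => // /a_ll. Qed.

Lemma ltp_ll p q : ltp p q <-> ll (a p) (a q).
Proof.
split; first exact: a_ll.
case: (ltp_total p q) => [//|->|/a_ll h h']; first by move=> /(ll_irr).
by case: (ll_irr (ll_tr h h')).
Qed.

(** The finite set [A] is named in the count, so that the automorphisms in question preserve [OA]
    and [ll]. *)
Lemma models_of_orders : False.
Proof.
apply: few; have [N [ea [eA Ae]]] := finite_enum.
have cI (I : set slot) : countable (A `|` a @` I).
  apply: countableU; first exact: (countable_A).
  by apply: card_le_trans (card_image_le _ _) _; exact: countableP.
have [M hM] : exists M : (nat -> bool) -> set C, forall x,
    [/\ countable (M x), A `|` a @` block x `<=` M x, elem_sub (M x)
      & forall z, M x z -> ~ gap (block x) z].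
  suff H x : exists M, [/\ countable M, A `|` a @` block x `<=` M, elem_sub M
      & forall z, M z -> ~ gap (block x) z].
    by have [M hM] := choice H; exists M.
  apply: (omitting_types hC hL (cI (block x))); first exact: gap_sep.
  by move=> Y hY; exact: gap_no_isolated.
apply: (count_models hL hC (M := M) (N := N) (t := fun _ => ea)).
- by move=> x; have [] := hM x.
- by move=> x; have [] := hM x.
- move=> x; exists (fun n => a (n, 1%R)).
    move=> n m e; have : inc (a (n, 1%R)) (a (m, 1%R)).
      by rewrite -e; split=> //; exact: (ll_irr).
    by move=> /inc_a [].
  by move=> n; have [_ sub _ _] := hM x; apply: sub; right; exists (n, 1%R) => //; apply: Or42.
- by move=> x k kN; have [_ sub _ _] := hM x; apply: sub; left; exact: eA.
move=> x y g [ig _] gM gea.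
have ga : aut A g by split=> // z /Ae[k kN <-]; exact: gea.
have [h ha [gh hg]] := aut_inv ga.
have near x' z : M x' z -> OA z -> exists p, block x' p /\ inc z (a p).
  move=> Mz Xz; have [_ _ _ ng] := hM x'; apply: contrapT => no.
  apply: (ng z Mz); split=> // p Ip; apply: contrapT => /not_orP[n1 n2].
  by apply: no; exists p.
have Ma x' p : block x' p -> M x' (a p).
  by move=> Ip; have [_ sub _ _] := hM x'; apply: sub; right; exists p.
have H p : exists q, block x p -> block y q /\ inc (g (a p)) (a q).
  case: (pselect (block x p)) => Ip; last by exists p.
  have [|q [Iq i]] := near y (g (a p)) _ (X_aut ga (aX p)); last by exists q.
  by rewrite -gM; exact: Ma.
have [f hf] := choice H.
apply: (block_rigid (h := f)).
- by move=> p /hf[].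
- move=> q Iq; have [|p [Ip i]] := near x (h (a q)) _ (X_aut ha (aX q)).
    by rewrite gM hg; exact: Ma.
  exists p => //; have [Ifp i'] := hf p Ip.
  have {}i := inc_aut ga i; rewrite hg in i.
  apply: inc_a; have [X1 X2 n1 n2] := i'; split=> // l.
    have ii : inc (a (f p)) (a (f p)) by split=> //; exact: (ll_irr).
    by have := inc_ll (inc_sym i') i l => /(ll_irr).
  by have := inc_ll i (inc_sym i') l => /(ll_irr).
- move=> p q Ip Iq; have [_ ip] := hf p Ip; have [_ iq] := hf q Iq.
  rewrite !ltp_ll; split=> l.
    by apply: (inc_ll ip iq); exact: (ll_aut ga l).
  have := ll_aut ha (inc_ll (inc_sym ip) (inc_sym iq) l).
  by rewrite !gh.
Qed.

End NonSimple.

Lemma many_of_bad (L : language) (T : theory L) (K : Type) (C : structure L)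
    (lt : C -> C -> Prop) (B : set C) (x0 : C) :
  countable_language L -> monster K T C -> wqo_order lt -> small K B ->
  ~ nobad B x0 lt -> countable_model_classes T #= [set: set nat].
Proof.
move=> hL hC hlt sB bad; apply: contrapT => few.
have [A [c [E [G tw]]]] := tower_ex hC hlt sB bad.
have [D cD] := complete_cof_ex hL hC hlt tw few.
have [d hd] := cofinal_seq tw cD.
have [a [aX a_ll]] := family hL hC hlt tw cD hd few.
exact: (models_of_orders hL hC hlt tw cD hd few aX a_ll).
Qed.

(** * Non-convex types *)

Section Near.
Context (L : language) (T : theory L) (K : Type) (C : structure L).
Context (hC : monster K T C).
Context (x0 : C).
Implicit Types (A B : set C) (lt : C -> C -> Prop) (pi rho : set C).
Local Notation P := (same set0 x0).
Local Notation tp := (locus set0 x0).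

Definition unsep lt pi rho x y := forall z, pi z -> ~ rho z ->
  ~ ((lt x z /\ lt z y) \/ (lt y z /\ lt z x)).

(** A relation with a single class on [P] would make the union trivial. *)
Definition proper lt pi rho := [/\ tp pi, tp rho &
  exists x y, [/\ P x, P y & ~ unsep lt pi rho x y]].

(* On [P] the relations [unsep lt pi rho] are convex equivalence relations; they
   form a chain, so their union [sim] over the proper ones is one too. *)
Definition sim lt x y := exists pi rho, proper lt pi rho /\ unsep lt pi rho x y.

Lemma unsep_rev lt pi rho x y : unsep (fun x y => lt y x) pi rho x y <-> unsep lt pi rho x y.
Proof. by split=> h z hz nz h'; apply: (h z hz nz); case: h' => -[? ?]; [right|left|right|left]. Qed.

Lemma sim_rev lt x y : sim (fun x y => lt y x) x y <-> sim lt x y.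
Proof.
split=> -[pi [rho [[h1 h2 [a [b [Pa Pb n]]]] /unsep_rev h]]]; exists pi, rho; split=> //;
  by split=> //; exists a, b; split=> // /unsep_rev.
Qed.

Lemma tp_P pi x : tp pi -> P x -> pi x.
Proof. by move=> [h hx] Px; exact: Px. Qed.

Lemma P_aut g x : aut set0 g -> P x -> P (g x).
Proof. by move=> ga Px; exact: same_trans Px (same_aut ga). Qed.

Lemma small0 : small K (@set0 C).
Proof. by apply: (small_countable (nat_lt_K hC)); exact: countable0. Qed.

Section Order.
Context (lt : C -> C -> Prop) (hlt : wqo_order lt).

Lemma unsep_D2 pi rho : tp pi -> tp rho -> D2 set0 (unsep lt pi rho).
Proof. by move=> [h1 _] [h2 _]; have h := ltD_ hlt set0; rewrite /unsep; dtac. Qed.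

(** For transitivity: a separating point is outside [rho], so it differs from the middle point and
    separates it from one of the ends. *)
Lemma unsep_ceq pi rho : tp pi -> tp rho -> ceq lt set0 x0 (unsep lt pi rho).
Proof.
move=> tpi trho; split; first exact: unsep_D2.
- split.
  + by move=> x _ z _ _ [] [h h']; exact: (lt_irr hlt (lt_tr hlt h h')).
  + by move=> x y _ _ h z hz nz h'; apply: (h z hz nz); case: h'; [right|left].
  + move=> x y w Px Py Pw xy yw z hz nz h.
    have zy : z <> y by move=> e; apply: nz; rewrite e; exact: tp_P.
    case: (lt_tot hlt z y) => [h1|//|h1]; case: h => -[h2 h3].
    * by apply: (xy z hz nz); left.
    * by apply: (yw z hz nz); right.
    * by apply: (yw z hz nz); left.
    * by apply: (xy z hz nz); right.
- move=> x y w Px Py Pw xw xy yw z hz nz [] [h1 h2]; apply: (xw z hz nz).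
    by left; split=> //; exact: (lt_le_tr hlt h2 yw).
  by case: (le_gtF hlt xy); exact: (lt_tr hlt h1 h2).
Qed.

Lemma unsep_aut pi rho g x y : tp pi -> tp rho -> aut set0 g ->
  unsep lt pi rho x y <-> unsep lt pi rho (g x) (g y).
Proof. by move=> h1 h2; apply: D2_aut; exact: unsep_D2. Qed.

Lemma sim_aut g x y : aut set0 g -> sim lt x y <-> sim lt (g x) (g y).
Proof.
by move=> ga; split=> -[pi [rho [pr h]]]; exists pi, rho; split=> //;
  have [h1 h2 _] := pr; move: h; rewrite (unsep_aut x y h1 h2 ga).
Qed.

Lemma sim_sym x y : P x -> P y -> sim lt x y -> sim lt y x.
Proof.
move=> Px Py [pi [rho [pr h]]]; exists pi, rho; split=> //.
by have [h1 h2 _] := pr; have [_ [_ sy _] _] := unsep_ceq h1 h2; exact: sy.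
Qed.

Lemma sim_trans x y z : P x -> P y -> P z -> sim lt x y -> sim lt y z -> sim lt x z.
Proof.
move=> Px Py Pz [pi [rho [pr h]]] [pi' [rho' [pr' h']]].
have [h1 h2 _] := pr; have [h1' h2' _] := pr'.
have c1 := unsep_ceq h1 h2; have c2 := unsep_ceq h1' h2'.
have [_ [_ _ t1] _] := c1; have [_ [_ _ t2] _] := c2.
have [s|s] := ceq_chain hC hlt small0 c1 c2.
  by exists pi', rho'; split=> //; apply: (t2 x y z) => //; exact: s.
by exists pi, rho; split=> //; apply: (t1 x y z) => //; exact: s.
Qed.

Lemma sim_between x y z : P x -> P y -> P z -> sim lt x z -> le lt x y -> le lt y z -> sim lt x y.
Proof.
move=> Px Py Pz [pi [rho [pr h]]] xy yz; exists pi, rho; split=> //.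
by have [h1 h2 _] := pr; have [_ _ cv] := unsep_ceq h1 h2; exact: (cv x y z).
Qed.

(** By [alternation] for an automorphism over [B] that takes [x] to [z]. *)
Lemma orbit_convex B a x y z : same B a x -> same B a z -> P a -> P y -> small K B ->
  lt x y -> lt y z -> same B a y.
Proof.
move=> ax az Pa Py sB xy yz; apply: contrapT => nay.
have [psi [hpsi [pa npy]]] : exists psi : C -> Prop, D1 B psi /\ psi a /\ ~ psi y.
  apply: contrapT => no; apply: nay => psi h1 h2; apply: contrapT => h3.
  by apply: no; exists psi.
have [g ga gx] := AUT hC sB (same_trans (same_sym ax) az).
have zP : zhom P by exact: zhom_same.
have Pg u : P u -> P (g u) by apply: P_aut; exact: aut_mono ga.
have Px : P x by apply: same_trans Pa _; exact: same_mono ax.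
apply: (alternation hlt zP hpsi ga Pg Px Py xy _ (ax _ hpsi pa) npy).
by rewrite gx.
Qed.

Context (nonconvex : forall pi, tp pi -> exists x y z,
  [/\ P x, P y, pi z, ~ P z & lt x z /\ lt z y]).

Lemma proper_ex pi : tp pi -> exists rho, proper lt pi rho.
Proof.
move=> tpi; have [x [y [z [Px Py piz nPz [xz zy]]]]] := nonconvex tpi.
have [rho trho nrho] : exists2 rho, tp rho & ~ rho z.
  apply: contrapT => no; apply: nPz => psi h1 h2; apply: contrapT => h3.
  by apply: no; exists psi.
exists rho; split=> //; exists x, y; split=> // h.
by apply: (h z piz nrho); left.
Qed.

(* The semiinterval at [a] cut out by [theta] is an equivalence class, so [theta]
   covers a neighbourhood of every point of that class; a definable subset of [P]
   meets no [pi `\` rho]. *)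
Lemma sim_of_subset B a b (theta : C -> Prop) : small K B -> nobad B a lt ->
  P a -> same B a b -> lt a b -> D1 (B `|` [set a]) theta -> theta b ->
  (forall x, theta x -> P x) -> sim lt a b.
Proof.
move=> sB nb Pa sab ab hth thb thP.
have Q_P x : same B a x -> P x.
  by move=> ax; apply: same_trans Pa _; exact: same_mono ax.
have saa : same B a a := @same_refl _ _ B a.
have [S sS eS] := semi_ex hC hlt sB saa sab (or_intror ab) hth thb.
have [E [hE [rf sy tr] eE]] := semi_det hC sB (wo_lt hlt B a) sS nb.
have Eab : E a b.
  by apply: (proj1 (iffLR (eE b sab) _)); apply/eS => //; split; [right | left; left].
have [g ga gab] := AUT hC sB sab.
have g0 : aut set0 g by exact: aut_mono ga.
have key x : same B a x -> E b x -> le lt b x -> sim lt b x.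
  move=> ax Ebx bx.
  have Eax : E a x by exact: tr Eab Ebx.
  have ax' : le lt a x by exact: (le_tr hlt (or_intror ab) bx).
  have /(eS x ax)[_ hS] : S x by apply/eE.
  have sub s : P s -> lt b s -> lt s x -> theta s.
    move=> Ps bs sx; case: hS => [xb|h].
      by case: (le_gtF hlt xb); exact: (lt_tr hlt bs sx).
    by apply: h; [exact: (orbit_convex sab ax Pa Ps sB bs sx) | right | right].
  pose B' := ((B `|` [set a]) `|` [set b]) `|` [set x].
  have sB' : small K B'.
    do 3!apply: (small_add1 (nat_lt_K hC)); exact: sB.
  have BB' : B `|` [set a] `<=` B' by move=> u ?; left; left.
  have [||||pi tpi hpi] := @COMPACT _ _ _ _ hC B' tp (fun s => lt b s -> lt s x -> theta s) sB'.
  - by move=> X [hX _]; exact: Def_mono hX.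
  - exact: locus_directed.
  - have h1 := ltD_ hlt B'; have h2 : D1 B' theta := Def_mono BB' hth.
    by dtac; [left; right | right].
  - by move=> s /locusP; exact: sub.
  have [rho pr] := proper_ex tpi; exists pi, rho; split=> // z piz nrho [] [h1 h2].
    by apply: nrho; have [_ trho _] := pr; apply: (tp_P trho); apply: thP; exact: hpi.
  by case: (le_gtF hlt bx); exact: (lt_tr hlt h1 h2).
(* [key] treats pairs starting at [b]; [g] moves the pair [a], [b] to such a pair. *)
rewrite (sim_aut a b g0) gab; apply: key.
- exact: same_trans sab (same_aut ga).
- by rewrite -{1}gab -(D2_aut a b hE ga).
- by right; rewrite -{1}gab -(aut_lt hlt _ _ ga).
Qed.

End Order.
End Near.

(* [inr false] and [inr true] are endpoints added below and above all slots. *)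
Definition label := (slot + bool)%type.

Definition ltlab (i j : label) : Prop :=
  match i, j with
  | inl p, inl q => ltp p q
  | inl _, inr b => b
  | inr b, inl _ => ~~ b
  | inr b, inr b' => ~~ b && b'
  end.

Lemma ltlab_irr i : ~ ltlab i i.
Proof. by case: i => [p /ltp_irr|[]]. Qed.

Lemma ltlab_trans i j k : ltlab i j -> ltlab j k -> ltlab i k.
Proof. by case: i j k => [p|[]] [q|[]] [r|[]] //=; exact: ltp_trans. Qed.

Lemma ltlab_total i j : [\/ ltlab i j, i = j | ltlab j i].
Proof.
case: i j => [p|[]] [q|[]] /=; try (by apply: Or31); try (by apply: Or32);
  try (by apply: Or33).
by case: (ltp_total p q) => [?|->|?]; [apply: Or31|apply: Or32|apply: Or33].
Qed.

(** * Morley sequences at the end of the locus, and the omitted holes *)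

Section NonConvex.
Context (L : language) (T : theory L) (K : Type) (C : structure L).
Context (hL : countable_language L) (hC : monster K T C).
Context (lt : C -> C -> Prop) (hlt : wqo_order lt).
Local Notation gt := (fun x y => lt y x).
Context (nb : forall (A : set C) x0, small K A -> nobad A x0 lt /\ nobad A x0 gt).
Context (x0 : C).
Implicit Types (A B : set C) (psi : C -> Prop).
Local Notation P := (same set0 x0).
Local Notation tp := (locus set0 x0).
Local Notation sim := (sim x0 lt).
Context (nonconvex : forall pi, tp pi -> exists x y z,
  [/\ P x, P y, pi z, ~ P z & lt x z /\ lt z y]).

Let nonconvex_gt pi : tp pi -> exists x y z, [/\ P x, P y, pi z, ~ P z & gt x z /\ gt z y].
Proof. by move=> /nonconvex[x [y [z [h1 h2 h3 h4 [h5 h6]]]]]; exists y, x, z. Qed.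

Let sC : small K (@set0 C) := small0 hC.

Lemma P_conj x y : P x -> P y -> exists2 g, aut set0 g & g x = y.
Proof. by move=> Px Py; exact: (AUT hC sC (same_trans (same_sym Px) Py)). Qed.

Lemma tpT : tp setT.
Proof. by split=> //; exact: Def_True. Qed.

Lemma P_up x : P x -> exists2 y, P y & lt x y.
Proof.
move=> Px; have [a [b [z [Pa Pb _ _ [az zb]]]]] := nonconvex tpT.
have [g ga gx] := P_conj Pa Px; exists (g b); first exact: P_aut ga Pb.
by rewrite -gx -(aut_lt hlt _ _ ga); exact: (lt_tr hlt az zb).
Qed.

Definition Evp psi := exists2 y0, P y0 & forall y, P y -> le lt y0 y -> psi y.

Lemma P_max x y : P x -> P y -> exists z, [/\ P z, le lt x z & le lt y z].
Proof.
move=> Px Py; case: (lt_tot hlt x y) => [h|e|h].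
- by exists y; split=> //; [right | left].
- by exists y; split=> //; left.
- by exists x; split=> //; [left | right].
Qed.

Lemma Evp_and psi chi : Evp psi -> Evp chi -> Evp (fun y => psi y /\ chi y).
Proof.
move=> [y P1 h1] [y' P2 h2]; have [z [Pz yz y'z]] := P_max P1 P2; exists z => // w Pw zw.
by split; [apply: h1 => //; exact: (le_tr hlt yz zw)|apply: h2 => //; exact: (le_tr hlt y'z zw)].
Qed.

Lemma Evp_ultra psi : D1 setT psi -> Evp psi \/ Evp (fun y => ~ psi y).
Proof.
move=> hpsi; have zP : zhom P by exact: zhom_same.
have [[y Py h]|[y Py h]] := fconv_last (lt_lin hlt P) (@same_refl _ _ set0 x0)
  (finconv hlt zP hpsi); [left|right]; exists y => // z Pz yz.
  by have [] := h z Pz yz.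
by move=> hz; apply: (h z Pz yz).
Qed.

Lemma Evp_aut psi g : aut set0 g -> Evp psi -> Evp (fun y => psi (g y)).
Proof.
move=> ga [y Py h]; have [k ka [gk kg]] := aut_inv ga.
exists (k y); first exact: P_aut ka Py.
move=> z Pz kyz; apply: h; first exact: P_aut ga Pz.
by rewrite -(kg y) -(aut_le hlt _ _ ga).
Qed.

Definition Op B x := forall psi, D1 B psi -> Evp psi -> psi x.

Lemma Op_mono B B' x : B `<=` B' -> Op B' x -> Op B x.
Proof. by move=> BB h psi hpsi; apply: h; exact: Def_mono hpsi. Qed.

Lemma Op_ex B : small K B -> exists x, Op B x.
Proof.
move=> sB; have [|||x hx] := @SAT _ _ _ _ hC B [set psi : set C | D1 B psi /\ Evp psi] sB.
- by move=> X [].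
- split; first by exists setT; split; [exact: Def_True | exists x0].
  move=> X Y [hX eX] [hY eY]; exists (X `&` Y) => //.
  by split; [dtac | exact: Evp_and].
- by move=> X [_ [y Py h]]; exists y; apply: h => //; left.
by exists x => psi h1 h2; apply: hx; split.
Qed.

Lemma Op_same B x y : Op B x -> Op B y -> same B x y.
Proof.
move=> ox oy psi hpsi px; case: (Evp_ultra (psi := psi)); [exact: Def_mono hpsi|exact: oy|].
by move=> h; case: (ox _ (Def_not hpsi) h).
Qed.

Lemma Op_P B x : Op B x -> P x.
Proof.
move=> ox psi hpsi p0; apply: ox; first by apply: Def_mono hpsi.
by exists x0 => // y Py _; exact: Py.
Qed.

Lemma Op_gt B x a : Op B x -> B a -> P a -> lt a x.
Proof.
move=> ox Ba Pa; apply: (ox (lt a)).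
  by have h := ltD_ hlt B; dtac.
by have [y Py ay] := P_up Pa; exists y => // z _ yz; exact: (lt_le_tr hlt ay yz).
Qed.

(* A proper convex equivalence relation has no class cofinal in [P]. *)
Lemma Op_nsim B x a : Op B x -> B a -> P a -> ~ sim a x.
Proof.
move=> ox Ba Pa [pi [rho [[tpi trho [u [w [Pu Pw nuw]]]] nax]]].
have [h1 [rf sy tr] cv] := unsep_ceq hlt tpi trho.
pose psi y := unsep lt pi rho a y.
have hpsi : D1 B psi.
  have h : D2 B (unsep lt pi rho) by apply: Def_mono h1.
  by rewrite /psi; dtac.
have [[y Py h]|h] := Evp_ultra (psi := psi) (Def_mono (@subsetT _ B) hpsi); last first.
  exact: (ox _ (Def_not hpsi) h) nax.
have all_ z : P z -> le lt a z -> psi z.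
  move=> Pz az; have [m [Pm ym zm]] := P_max Py Pz.
  by apply: (cv a z m) => //; exact: h.
have no u' w' : P u' -> P w' -> le lt u' w' -> ~ unsep lt pi rho u' w' -> False.
  move=> Pu' Pw' uw'; have [g ga gu] := P_conj Pu' Pa.
  rewrite (unsep_aut hlt u' w' tpi trho ga) gu; apply; apply: all_.
    exact: P_aut ga Pw'.
  by rewrite -gu -(aut_le hlt _ _ ga).
case: (pselect (le lt u w)) => [uw|/(notle hlt) wu]; first exact: (no u w).
by apply: (no w u) => //; [right | move=> /(sy _ _ Pw Pu)].
Qed.

(** The base of [Op] is not fixed by the automorphisms in use, so its parameters have to be moved
    along. *)
Lemma D1_image B (g h : C -> C) psi : aut set0 g -> cancel g h -> D1 B psi ->
  D1 (g @` B) (fun x => psi (h x)).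
Proof.
move=> ga gh [n [phi [u [hu e]]]].
have [h' ha [gh' h'g]] := aut_inv ga.
exists n, phi, (fun i => match u i with inl k => inl k | inr x => inr (g x) end); split.
  by move=> i; have := hu i; case: (u i) => //= x Bx; exists x.
move=> v; have := e (h' \o v) => /=.
have -> : h (v 0) = h' (v 0) by rewrite -{1}(h'g (v 0)) gh.
move=> ->; have [ih _] := ha.
rewrite (sat_iso phi (tmv v \o _) ih).
suff -> : tmv (h' \o v) \o u = h' \o (tmv v \o (fun i => match u i with inl k => inl k | inr x => inr (g x) end)) by [].
by apply/funext => i /=; case: (u i) => //= x; rewrite gh'.
Qed.

Lemma Op_aut B g x : aut set0 g -> Op B x -> Op (g @` B) (g x).
Proof.
move=> ga ox psi hpsi epsi; have [h ha [gh hg]] := aut_inv ga.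
have hpsi' : D1 B (fun y => psi (g y)).
  apply: Def_mono (D1_image ha hg hpsi) => _ [_ [z Bz <-] <-]; by rewrite gh.
exact: ox hpsi' (Evp_aut ga epsi).
Qed.

(* Morley sequences of the type at the right end of [P]. *)
Definition mor n (t : nat -> C) := forall k, k < n -> Op (initial t k) (t k).

Lemma mor_ex : exists v, forall n, mor n v.
Proof.
have [|v hv] := greedy_seq (Q := Op) x0 _; last by exists v => n k _; exact: hv.
move=> v k; apply: Op_ex; apply: (small_countable (nat_lt_K hC)).
exact: initial_countable.
Qed.

(** The usual argument for a stationary type: [Op] determines one complete type over every set and
    is carried along by automorphisms. *)
Lemma mor_same n t u : mor n t -> mor n u ->
  forall Y, Def set0 Y -> supp n Y -> Y t -> Y u.
Proof.
elim: n t u => [|n IH] t u mt mu Y hY sY Yt; first exact: sY Yt.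
have [g ga gt] : exists2 g, aut set0 g & forall k, k < n -> g (t k) = u k.
  by apply: (tuple_conj hC (countable0 _)); apply: IH => k kn; [apply: mt|apply: mu]; exact: ltnW.
have o1 : Op (initial u n) (g (t n)).
  apply: Op_mono (Op_aut ga (mt n (ltnSn n))) => x [k kn <-].
  by exists (t k); [exists k | exact: gt].
have o2 := mu n (ltnSn n).
have h : Y (upd u n (g (t n))).
  apply: (sY (g \o t)); last by rewrite -(Def_aut _ hY ga).
  move=> k; rewrite ltnS leq_eqVlt /upd => /orP[/eqP->|kn] /=; first by rewrite eqxx.
  by rewrite ltn_eqF // gt.
apply: (sY (upd u n (u n))); first by move=> k _; rewrite /upd; case: eqP => [->|].
apply: (Op_same o1 o2 (X := fun x => Y (upd u n x))) h.
apply: (@Def_support_subst _ _ _ Y n.+1 (fun k w => if k == n then w 0 else u k)).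
- exact: (suppW sY).
- move=> k; rewrite ltnS leq_eqVlt => /orP[/eqP->|kn].
    by rewrite eqxx; exact: is_tm_var.
  by rewrite ltn_eqF //; apply: is_tm_par; exists k.
- exact: Def_mono hY.
Qed.

Lemma mor_sub v (t : nat -> nat) n : (forall n, mor n v) ->
  (forall i j, i < j -> j < n -> t i < t j) -> mor n (v \o t).
Proof.
move=> mv ht k kn; apply: Op_mono (mv (t k).+1 (t k) (ltnSn _)) => x [i ik <-].
by exists (t i) => //; exact: ht.
Qed.

Lemma labelled_family : exists (v : nat -> C) (a : label -> C), (forall n, mor n v) /\
  forall n (s : nat -> label), (forall k l, k < l -> l < n -> ltlab (s k) (s l)) ->
  forall Y, Def set0 Y -> supp n Y -> Y v -> Y (a \o s).
Proof.
have [v mv] := mor_ex.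
pose ord i j := exists p q : label, [/\ unpickle i = Some p, unpickle j = Some q & ltlab q p].
have [|||a ha] := @spread _ _ _ _ hC set0 v ord (countable0 _).
- by move=> i [p [q [-> [<-]]]]; exact: ltlab_irr.
- move=> i j k [p [q [e1 e2 h]]] [p' [q' [e3 e4 h']]]; exists p, q'; split=> //.
  by move: e3; rewrite e2 => -[e]; apply: ltlab_trans h' _; rewrite -e.
- move=> t ht X hX Xv; have [N hN] := Def_support hX.
  apply: (mor_same (mv N)) hX _ Xv; last by move=> u w uw /(hN u w uw).
  by apply: mor_sub => // i j ij _; exact: ht.
exists v, (fun p => a (pickle p)); split=> // n s hs Y hY sY Yv.
apply: (ha n (fun k => pickle (s k)) _ Y hY sY Yv) => k l kl ln.
by exists (s l), (s k); rewrite !pickleK; split=> //; exact: hs.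
Qed.

Context (v : nat -> C) (a : label -> C) (mv : forall n, mor n v).
Context (ha : forall n (s : nat -> label), (forall k l, k < l -> l < n -> ltlab (s k) (s l)) ->
  forall Y, Def set0 Y -> supp n Y -> Y v -> Y (a \o s)).

Let double_mono i j : i < j -> i.*2 < j.*2. Proof. by rewrite ltn_double. Qed.

(** Only even indices of [v] are used; an odd one supplies the auxiliary point in
    [hole_no_isolated]. *)
Lemma a_conj n (s : nat -> label) : (forall k l, k < l -> l < n -> ltlab (s k) (s l)) ->
  exists2 g, aut set0 g & forall k, k < n -> g (v k.*2) = a (s k).
Proof.
move=> hs; have md : mor n (v \o double).
  by apply: mor_sub => // i j ij _; exact: double_mono.
apply: (tuple_conj hC (countable0 _) (t := v \o double) (u := a \o s)) => Y hY sY Yv.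
exact: (ha hs hY sY (mor_same md (@mv n) hY sY Yv)).
Qed.

Lemma vP k : P (v k).
Proof. exact: Op_P (mv (ltnSn k)). Qed.

Lemma aP i : P (a i).
Proof.
have [|g ga e] := @a_conj 1 (fun=> i); first by move=> k [].
by rewrite -(e 0 isT); apply: (P_aut ga); exact: vP.
Qed.

Lemma a_lt i j : ltlab i j -> lt (a i) (a j) /\ ~ sim (a i) (a j).
Proof.
move=> ij; have [|g ga e] := @a_conj 2 (fun k => if k is 0 then i else j).
  by move=> [|k] [|[|l]].
have o2 : Op (initial v 2) (v 2) := mv (ltnSn 2).
have v0 : initial v 2 (v 0) by exists 0.
have e0 : g (v 0) = a i := e 0 isT; have e2 : g (v 2) = a j := e 1 isT.
rewrite -e0 -e2; split; first by rewrite -(aut_lt hlt _ _ ga); exact: Op_gt o2 v0 (vP 0).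
by rewrite -(sim_aut x0 hlt _ _ ga); exact: Op_nsim o2 v0 (vP 0).
Qed.

Lemma sim_refl x : P x -> sim x x.
Proof.
move=> Px; have [rho pr] := proper_ex nonconvex tpT; exists setT, rho; split=> //.
by have [h1 h2 _] := pr; have [_ [rf _ _] _] := unsep_ceq hlt h1 h2; exact: rf.
Qed.

(** The endpoints ensure a member of the family on each side of a hole. *)
Definition hole (I : set label) z := [/\ P z, lt (a (inr false)) z, lt z (a (inr true))
  & forall i, I i -> ~ sim z (a i)].

Lemma hole_sep (I : set label) x : I (inr false) -> I (inr true) -> ~ hole I x ->
  exists Y : C -> Prop, [/\ D1 (a @` I) Y, hole I `<=` Y & ~ Y x].
Proof.
move=> I0 I1 nh; have hl := ltD_ hlt (a @` I).
case: (pselect (P x)) => [Px|nP]; last first.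
  have [psi [h1 h2 h3]] : exists psi : C -> Prop, [/\ D1 set0 psi, psi x0 & ~ psi x].
    apply: contrapT => no; apply: nP => psi h1 h2; apply: contrapT => h3.
    by apply: no; exists psi.
  exists psi; split=> //; first by apply: Def_mono h1.
  by move=> y [Py _ _ _]; exact: Py.
case: (pselect (lt (a (inr false)) x)) => [l0|n0]; last first.
  exists (lt (a (inr false))); split=> //; last by move=> y [].
  by dtac; exists (inr false).
case: (pselect (lt x (a (inr true)))) => [l1|n1]; last first.
  exists (fun y => lt y (a (inr true))); split=> //; last by move=> y [].
  by dtac; exists (inr true).
have [i [Ii [pi [rho [pr h]]]]] : exists i, I i /\ sim x (a i).
  apply: contrapT => no; apply: nh; split=> // i Ii h; apply: no; by exists i.
have [h1 h2 _] := pr.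
exists (fun y => ~ unsep lt pi rho y (a i)); split.
- have hn : D2 (a @` I) (unsep lt pi rho) by apply: Def_mono (unsep_D2 hlt h1 h2).
  by dtac; exists i.
- by move=> y [_ _ _ ns] u; apply: (ns i Ii); exists pi, rho.
- by [].
Qed.

(** Between the neighbours [t j] and [t jj] of [b] lies the point [y], which can replace either of
    them without changing its type over the other parameters. If [b] is between a neighbour and [y],
    or equal to [y], then [b] has the type of that neighbour over the others, and [sim_of_subset]
    relates the two by [sim]. *)
Lemma hole_no_isolated (I : set label) (th : C -> Prop) : I (inr false) -> I (inr true) ->
  D1 (a @` I) th -> (exists x, th x) -> exists2 x, th x & ~ hole I x.
Proof.
move=> I0 I1 hth0 [b thb]; apply: contrapT => no.
have thg x : th x -> hole I x by move=> tx; apply: contrapT => ng; apply: no; exists x.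
have thP x : th x -> P x by move=> /thg[].
have [l [hl hth1]] := Def_params hth0.
have [|s0 [s0I ls0]] := @finite_params _ _ set0 a I l; first by move=> x /hl ?; right.
have [s [ss0 ps]] :=
  sort_strict (inr false :: inr true :: s0) ltlab_irr ltlab_trans ltlab_total.
have sI i : i \in s -> I i by rewrite ss0 !inE => /or3P[/eqP->|/eqP->|/s0I].
have [Pb fb bl nsb] := thg b thb.
set m := size s; pose t k := a (nth (inr false) s k).
have sinc k k' : k < k' -> k' < m -> ltlab (nth (inr false) s k) (nth (inr false) s k').
  move=> kk' k'm; have /(pairwiseP (inr false)) h := ps.
  apply/asboolP; apply: (h k k') => //; rewrite inE //.
  exact: ltn_trans kk' k'm.
have fs : inr false \in s by rewrite ss0 !inE eqxx.
have ls : inr true \in s by rewrite ss0 !inE eqxx orbT.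
pose below i := `[< lt (a i) b >].
set jj := find (predC below) s.
have jjm : jj < m.
  rewrite -has_find; apply/hasP; exists (inr true) => //=.
  by apply/asboolP => h; exact: (lt_irr hlt (lt_tr hlt h bl)).
have jj0 : 0 < jj.
  rewrite lt0n; apply/eqP => jj0.
  have : predC below (nth (inr false) s jj) by apply: nth_find; rewrite has_find.
  have fm : index (inr false : label) s < m by rewrite index_mem.
  have : nth (inr false) s jj = inr false.
    case: (posnP (index (inr false : label) s)) => [e|pos].
      by rewrite jj0 -e nth_index.
    have := sinc 0 _ pos fm; rewrite nth_index //.
    by case: (nth _ _ 0) => [p|[]].
  by move=> -> /= /asboolP; apply.
have bjj : lt b (t jj).
  have nb' : ~ lt (t jj) b.
    have : predC below (nth (inr false) s jj) by apply: nth_find; rewrite has_find.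
    by move=> /= /asboolP.
  case: (lt_tot hlt b (t jj)) => // e; case: (nsb (nth (inr false) s jj)).
    by apply: sI; exact: mem_nth.
  by rewrite -/(t jj) -e; exact: sim_refl.
set j := jj.-1; have jjE : jj = j.+1 by rewrite /j prednK.
have jm : j < m by apply: leq_ltn_trans jjm; rewrite jjE.
have tjb : lt (t j) b.
  have jf : j < find (predC below) s by rewrite -/jj jjE.
  by have := before_find (inr false) jf => /negbFE/asboolP.
have m1 : 1 < m by apply: leq_ltn_trans jjm.
have [g ga gv] := a_conj (s := nth (inr false) s) sinc.
set y := g (v j.*2.+1).
have rep i : i = j \/ i = jj -> same [set x | exists k, [/\ k < m, k != i & t k = x]] (t i) y.
  move=> ij; have im : i < m by case: ij => ->.
  suff : same (set0 `|` [set x | exists k, [/\ k < m, k != i & t k = x]]) (t i) y.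
    by apply: same_mono => x ?; right.
  apply: replace_same => // Y hY sY Yt.
  (* Strictly increasing for [i = j] and for [i = jj], as [j.*2.+1] lies between [j.*2] and
     [jj.*2]. *)
  pose tau k := if k == i then j.*2.+1 else k.*2.
  have taum p q : p < q -> q < m -> tau p < tau q.
    move=> pq qm; rewrite /tau; case: (eqVneq p i) => pi; case: (eqVneq q i) => qi.
    - by move: pq; rewrite pi qi ltnn.
    - case: ij => ij; move: pq; rewrite pi ij ?jjE => jq.
        by rewrite -ltnS -doubleS; apply: leq_trans (_ : j.+1.*2 < q.*2.+1) => //;
          rewrite ltnS leq_double.
      by rewrite (leq_trans (_ : j.*2.+1 < j.+1.*2)) // ltnW // ltn_double.
    - case: ij => ij; move: pq; rewrite qi ij ?jjE => pj.
        by rewrite ltnS leq_double ltnW.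
      by rewrite ltnS leq_double.
    - by rewrite ltn_double.
  have Y1 : Y (g \o (v \o double)) by apply: sY Yt => k km /=; rewrite gv.
  rewrite -(Def_aut _ hY ga) in Y1.
  have Y2 : Y (v \o tau).
    have md : mor m (v \o double).
      by apply: mor_sub => // p q pq _; exact: double_mono.
    exact: (mor_same md (mor_sub mv taum) hY sY Y1).
  rewrite (Def_aut _ hY ga) in Y2; apply: sY Y2 => k km /=.
  by rewrite /tau /upd; case: eqP => // _; rewrite gv.
have hthB i : i < m -> D1 ([set x | exists k, [/\ k < m, k != i & t k = x]] `|` [set t i]) th.
  move=> im; apply: Def_mono hth1 => x /ls0[//|[o os0 <-]].
  have os : o \in s by rewrite ss0 !inE os0 !orbT.
  have om : index o s < m by rewrite index_mem.
  have te : t (index o s) = a o by rewrite /t nth_index.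
  case: (eqVneq (index o s) i) => [e|ne]; first by right; rewrite -te e.
  by left; exists (index o s).
have sB i : small K [set x | exists k, [/\ k < m, k != i & t k = x]].
  apply: (small_countable (nat_lt_K hC)).
  have: countable (range t) by exact: countable_range.
  by apply: sub_countable; apply: subset_card_le => x [k [_ _ <-]]; exists k.
have tP k : P (t k) by exact: aP.
case: (pselect (le lt b y)) => [byy|/(notle hlt) yb].
  have sjb : same [set x | exists k, [/\ k < m, k != j & t k = x]] (t j) b.
    case: byy => [->|byy]; first by apply: rep; left.
    apply: (orbit_convex hC hlt (@same_refl _ _ _ (t j)) (rep j (or_introl erefl)) (tP j) Pb (sB j) tjb byy).
  have := sim_of_subset hC hlt nonconvex (sB j) (nb (t j) (sB j)).1 (tP j) sjb tjb (hthB j jm) thb thP.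
  move=> /(sim_sym hlt (tP j) Pb); apply: nsb; apply: sI; exact: mem_nth.
have hgt := wqo_order_rev hlt.
have sjb : same [set x | exists k, [/\ k < m, k != jj & t k = x]] (t jj) b.
  by apply: (orbit_convex hC hgt (@same_refl _ _ _ (t jj)) (rep jj (or_intror erefl)) (tP jj) Pb (sB jj)).
have := sim_of_subset hC hgt nonconvex_gt (sB jj) (nb (t jj) (sB jj)).2 (tP jj) sjb bjj (hthB jj jjm) thb thP.
move=> /sim_rev/(sim_sym hlt (tP jj) Pb); apply: nsb; apply: sI; exact: mem_nth.
Qed.

Definition labels_of (x : nat -> bool) : set label :=
  [set i | if i is inl p then block x p else True].

Lemma models_of_labels : countable_model_classes T #= [set: set nat].
Proof.
have cI (I : set label) : countable (a @` I).
  by apply: card_le_trans (card_image_le _ _) _; exact: countableP.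
have [M hM] : exists M : (nat -> bool) -> set C, forall x,
    [/\ countable (M x), a @` labels_of x `<=` M x, elem_sub (M x)
      & forall z, M x z -> ~ hole (labels_of x) z].
  suff H x : exists M, [/\ countable M, a @` labels_of x `<=` M, elem_sub M
      & forall z, M z -> ~ hole (labels_of x) z].
    by have [M hM] := choice H; exists M.
  apply: (omitting_types hC hL (cI (labels_of x))); first by move=> z; exact: hole_sep.
  by move=> Y hY; exact: hole_no_isolated.
have Ma x i : labels_of x i -> M x (a i).
  by move=> Ii; have [_ sub _ _] := hM x; apply: sub; exists i.
have a_inj i j : sim (a i) (a j) -> i = j.
  move=> s; case: (ltlab_total i j) => [ij|//|ji].
    by have [_ []] := a_lt ij.
  have [_ []] := a_lt ji; exact: (sim_sym hlt (aP i) (aP j) s).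
have a_lt' i j : ltlab i j <-> lt (a i) (a j).
  split; first by move=> /a_lt[].
  case: (ltlab_total i j) => [//|->|/a_lt[h _] h']; first by move=> /(lt_irr hlt).
  by case: (lt_irr hlt (lt_tr hlt h h')).
(* The two named points are the endpoints, index 0 the lower and index 1 the upper one; beyond them
   nothing is omitted. *)
apply: (count_models hL hC (M := M) (N := 2)
  (t := fun _ k => a (inr (k == 1)))).
- by move=> x; have [] := hM x.
- by move=> x; have [] := hM x.
- move=> x; exists (fun n => a (inl (n, 1%R))).
    move=> n m e; have : sim (a (inl (n, 1%R))) (a (inl (m, 1%R))).
      by rewrite e; exact: sim_refl (aP _).
    by move=> /a_inj[].
  by move=> n; apply: Ma; apply: Or42.
- by move=> x k _; exact: Ma.
move=> x y g ga gM ge.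
have g0 : g (a (inr false)) = a (inr false) := ge 0 isT.
have g1 : g (a (inr true)) = a (inr true) := ge 1 isT.
have [h ha' [gh hg]] := aut_inv ga.
have h0 : h (a (inr false)) = a (inr false) by rewrite -{1}g0 gh.
have h1 : h (a (inr true)) = a (inr true) by rewrite -{1}g1 gh.
have close x' z f p : aut set0 f -> f (a (inr false)) = a (inr false) ->
    f (a (inr true)) = a (inr true) -> z = f (a (inl p)) -> M x' z ->
    exists q, block x' q /\ sim z (a (inl q)).
  move=> fa f0 f1 zE Mz; have [_ _ _ nh] := hM x'.
  have Pz : P z by rewrite zE; apply: (P_aut fa); exact: aP.
  have [o [Io s]] : exists i, labels_of x' i /\ sim z (a i).
    apply: contrapT => no; apply: (nh z Mz); split=> //.
    - by rewrite zE -f0 -(aut_lt hlt _ _ fa) -a_lt'.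
    - by rewrite zE -f1 -(aut_lt hlt _ _ fa) -a_lt'.
    - by move=> i Ii s; apply: no; exists i.
  case: o Io s => [q Iq s|w _ s]; first by exists q.
  have : sim (f (a (inl p))) (f (a (inr w))).
    by rewrite -zE; case: (w) s; rewrite ?f0 ?f1.
  by rewrite -(sim_aut x0 hlt _ _ fa) => /a_inj.
have H p : exists q, block x p -> block y q /\ sim (g (a (inl p))) (a (inl q)).
  case: (pselect (block x p)) => Ip; last by exists p.
  have [|q hq] := close y (g (a (inl p))) g p ga g0 g1 erefl; last by exists q.
  by rewrite -gM; exact: Ma.
have [f hf] := choice H.
have Pg z : P z -> P (g z) by exact: P_aut.
(* If the order were not preserved, convexity of the [sim]-classes would merge the classes of the
   two images under [g]. *)
have mono p q : block x p -> block x q -> ltp p q -> ltp (f p) (f q).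
  move=> Ip Iq pq; have [_ sp] := hf p Ip; have [_ sq] := hf q Iq.
  have l1 : lt (g (a (inl p))) (g (a (inl q))) by rewrite -(aut_lt hlt _ _ ga) -a_lt'.
  have ns : ~ sim (g (a (inl p))) (g (a (inl q))).
    by rewrite -(sim_aut x0 hlt _ _ ga); have [] := @a_lt (inl p) (inl q) pq.
  apply/(a_lt' (inl (f p)) (inl (f q))); apply: (notle hlt) => le_.
  have P1 := Pg _ (aP (inl p)); have P2 := Pg _ (aP (inl q)).
  have P3 := aP (inl (f p)); have P4 := aP (inl (f q)).
  apply: ns; case: (pselect (le lt (g (a (inl q))) (a (inl (f p))))) => h2.
    apply: (sim_between hlt P1 P2 P3 sp _ h2); by right.
  have {}h2 := notle hlt h2.
  have s3 : sim (a (inl (f q))) (a (inl (f p))).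
    apply: (sim_between hlt P4 P3 P2 _ le_ (or_intror h2)).
    exact: (sim_sym hlt P2 P4 sq).
  apply: (sim_trans hC hlt P1 P3 P2 sp).
  apply: (sim_trans hC hlt P3 P4 P2 (sim_sym hlt P4 P3 s3)).
  exact: (sim_sym hlt P2 P4 sq).
apply: (block_rigid (h := f)).
- by move=> p /hf[].
- move=> q Iq; have [|p [Ip s]] := close x (h (a (inl q))) h q ha' h0 h1 erefl.
    by rewrite gM hg; exact: (Ma y).
  exists p => //; have [Ifp sp] := hf p Ip.
  have Phq : P (h (a (inl q))) by apply: (P_aut ha'); exact: aP.
  have : sim (g (h (a (inl q)))) (g (a (inl p))) by rewrite -(sim_aut x0 hlt _ _ ga).
  rewrite hg => s'; have P1 := Pg _ (aP (inl p)).
  by have [] := a_inj (inl q) (inl (f p)) (sim_trans hC hlt (aP _) P1 (aP _) s' sp).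
- move=> p q Ip Iq; split; first exact: mono.
  case: (ltp_total p q) => [//|->|qp]; first by move=> /ltp_irr.
  by move=> h'; case: (@ltp_irr (f p)); exact: ltp_trans h' (mono q p Iq Ip qp).
Qed.

End NonConvex.

(** * From a non-convex type to gap points, and the conclusion *)

Section Convexity.
Context (L : language) (C : structure L).
Context (lt : C -> C -> Prop) (hlt : wqo_order lt).

Lemma wom_pair_lt p x0 : complete_type set0 p -> realizations p x0 ->
  wom_pair set0 p (fun x y => [/\ realizations p x, realizations p y & lt x y]).
Proof.
move=> cp px0; have PE := complete_type_locus cp px0.
have zP : zhom (realizations p).
  by move=> x y /PE Px /PE Py; exact: same_trans (same_sym Px) Py.
split=> //.
- apply/rel_definable_binary; exists lt => //; exact: ltD.
- split=> [x Px [_ _ /(lt_irr hlt)//]|x y z Px Py Pz [_ _ xy] [_ _ yz]|x y Px Py].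
    by split=> //; exact: (lt_tr hlt xy yz).
  by case: (lt_tot hlt x y) => h; [apply: Or31|apply: Or32|apply: Or33].
- move=> X /rel_definable_unary[Y hY ->].
  have [l [cl hl]] := finconv hlt zP hY.
  exists (size l), (fun i => nth set0 l i); split=> [i|].
    have : List.In (nth set0 l i) l.
      case: i => k /=; elim: (l) k => //= S l' IH [|k] kl /=; [by left | right].
      exact: IH.
    move=> /cl[sP cS]; split=> // x y z Sx Py Sz [_ _ xy] [_ _ yz]; exact: cS xy yz.
  apply/seteqP; split=> x.
    move=> /hl[S iS Sx]; suff [k kl e] : exists2 k, k < size l & nth set0 l k = S.
      by exists (Ordinal kl) => //=; rewrite e.
    elim: (l) iS => //= S' l' IH [->|/IH[k kl e]]; first by exists 0.
    by exists k.+1.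
  move=> [[k kl] _ /= Sx]; apply/hl; exists (nth set0 l k) => //.
  by elim: (l) k kl {Sx} => //= S l' IH [|k] kl /=; [left | right; exact: IH].
Qed.

(** A [pi] without such points would define an extension in which the realizations are convex. *)
Lemma nonconvex_gaps p x0 : complete_type set0 p -> realizations p x0 ->
  ~ convex_type set0 p -> forall pi, locus set0 x0 pi -> exists x y z,
  [/\ same set0 x0 x, same set0 x0 y, pi z, ~ same set0 x0 z & lt x z /\ lt z y].
Proof.
move=> cp px0 nc pi [hpi pi0]; have PE := complete_type_locus cp px0.
apply: contrapT => no; apply: nc.
have [theta [ho e]] := D1_pformula hpi.
exists (fun x y => [/\ realizations p x, realizations p y & lt x y]), lt, theta; split.
- exact: wom_pair_lt cp px0.
- split; first by apply/definable_binary; exact: ltD.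
  apply/seteqP; split=> w /=; rewrite /binary /=.
    by move=> [p0 p1 h]; split=> //; apply: ord2P.
  by move=> [h hp]; split=> //; exact: hp.
- by rewrite (complete_type_eq cp px0); split=> //; apply/e.
- exact: lt_lin.
- split=> [x /PE Px|x y z /PE Px /e piy /PE Pz xy yz].
    by apply/e; exact: Px.
  apply/PE; apply: contrapT => nPy; apply: no; exists x, z, y; by split.
Qed.

End Convexity.

Theorem theorem1 (L : language) (T : theory L) (K : Type) (C : structure L)
    (hL : countable_language L)
    (hT : complete_theory T)
    (hC : monster K T C)
    (hwqom : weakly_quasi_o_minimal C)
    (hcond : ~ has_simple_semiintervals K C \/
       exists p : set (pformula C 1),
         complete_type set0 p /\ ~ convex_type set0 p) :
  countable_model_classes T #= [set: set nat].
Proof.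
have [lt hlt] := wqo_order_ex hwqom; have hgt := wqo_order_rev hlt.
apply: contrapT => few.
have nb A x0 : small K A -> nobad A x0 lt /\ nobad A x0 (fun x y => lt y x).
  by move=> sA; split; apply: contrapT => bad; apply: few;
    [exact: (many_of_bad hL hC hlt sA bad) | exact: (many_of_bad hL hC hgt sA bad)].
case: hcond => [ns|[p [cp nc]]]; first exact: ns (simple_of_nobad hC hlt nb).
have [x0 px0] : realizations p !=set0.
  by have [_ _ sat _] := hC; apply: sat (small0 hC) cp.
have gaps := nonconvex_gaps hlt cp px0 nc.
have [v [a [mv ha]]] := labelled_family hC hlt x0.
exact: few (models_of_labels hL hC hlt nb gaps mv ha).
Qed.
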